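(* Let $1<p<+\infty$ and let $\mathcal{F}_W^p$ be a radial Fock-type space containing all polynomials. Then any nontrivial backward shift invariant subspace of $\mathcal{F}_W^p$ is of the form $\mathcal{P}_n$ for some integer $n\ge 0$ and, thus, the backward shift $L$ is unicellular on $\mathcal{F}_W^p$.
   Context: A weight is a positive Lebesgue-measurable function $W$ on $\mathbb{C}$; it is always assumed that on every compact subset of $\mathbb{C}$ the weight $W$ is bounded from above and from below by positive constants. $m_2$ is planar Lebesgue measure. The Fock-type space $\mathcal{F}_W^p$ is the Banach space of entire functions $F$ with $\|F\|^p_{\mathcal{F}_W^p}=\int_{\mathbb{C}}|F(z)|^pW(z)\,dm_2(z)<+\infty$. It is radial if $W(z)=W(|z|)$ for all $z\in\mathbb{C}$. $\mathcal{P}_n$ is the set of all polynomials of degree at most $n$. The backward shift is $Lf(z)=\frac{f(z)-f(0)}{z}$. A closed linear subspace $\mathcal{M}$ of $\mathcal{F}_W^p$ is backward shift invariant if $Lf\in\mathcal{M}$ for every $f\in\mathcal{M}$. A subspace is nontrivial if it is different from $\{0\}$ and from the whole space. An operator is unicellular if its closed invariant subspaces are totally ordered by inclusion. *)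

(* Defs.v *)
(* The complex numbers are R[i], over a realType R. *)
From HB Require Import structures.
From mathcomp Require Import all_boot all_order all_algebra.
From mathcomp Require Import complex.
From mathcomp Require Import all_classical all_reals all_analysis.
Set Implicit Arguments.
Unset Strict Implicit.
Unset Printing Implicit Defensive.
Import Order.TTheory GRing.Theory Num.Theory.
Import numFieldNormedType.Exports.
Local Open Scope classical_set_scope.
Local Open Scope ring_scope.
Local Open Scope complex_scope.

(* R[i] carries no topology in the libraries; its regular module R[i]^o carries
   the one given by the modulus. *)
Notation Cplx R := (R[i]^o) (only parsing).

Definition of_plane (R : realType) (xy : R * R) : Cplx R := xy.1 +i* xy.2.

Definition borel_m2 (R : realType) : {measure set (measurableTypeR R * measurableTypeR R) -> \bar R} :=
  (@lebesgue_measure R \x @lebesgue_measure R)%E.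

(* The sigma-algebra of this type is that of the Lebesgue measurable subsets of
   the plane: the Caratheodory measurable sets of the outer measure induced by
   the product measure on the Borel sets. *)
Definition plane (R : realType) := caratheodory_type ((@borel_m2 R)^*)%mu.

Definition m2 (R : realType) : {measure set (plane R) -> \bar R} :=
  @completed_measure_extension _ _ _ (@borel_m2 R).

Definition weight (R : realType) (W : Cplx R -> R) : Prop :=
  [/\ forall z, 0 < W z,
      measurable_fun [set: plane R] (fun xy => W (of_plane xy)) &
      forall K : set (Cplx R), compact K ->
        exists c d : R, [/\ 0 < c, 0 < d & forall z, K z -> c <= W z <= d]].

Definition radial (R : realType) (W : Cplx R -> R) : Prop :=
  forall z : Cplx R, W z = W `|z|.

(* Differentiability over the field R[i], that is, complex differentiability. *)
Definition entire (R : realType) (F : Cplx R -> Cplx R) : Prop :=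
  forall z : Cplx R, derivable F z 1.

Definition fock_norm (R : realType) (p : R) (W : Cplx R -> R)
    (F : Cplx R -> Cplx R) : \bar R :=
  ((\int[m2 R]_xy (Normc.normc (F (of_plane xy)) `^ p * W (of_plane xy))%:E)
     `^ p^-1)%E.

Definition fock (R : realType) (p : R) (W : Cplx R -> R) :
    set (Cplx R -> Cplx R) :=
  [set F | entire F /\ (fock_norm p W F < +oo)%E].

(* The value at 0 is the one that removes the singularity of the quotient. *)
Definition backward_shift (R : realType) (f : Cplx R -> Cplx R) :
    Cplx R -> Cplx R :=
  fun z => if z == 0 then f^`()%classic 0 else (f z - f 0) / z.

Definition linear_subspace (R : realType) (X M : set (Cplx R -> Cplx R)) : Prop :=
  [/\ M `<=` X, M 0 &
      forall (a : R[i]) (f g : Cplx R -> Cplx R), M f -> M g -> M (a *: f + g)].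

Definition closed_in_fock (R : realType) (p : R) (W : Cplx R -> R)
    (M : set (Cplx R -> Cplx R)) : Prop :=
  forall f, fock p W f ->
    (forall e : R, 0 < e -> exists2 g, M g & (fock_norm p W (f - g)%R < e%:E)%E) ->
    M f.

Definition invariant_subspace (R : realType) (p : R) (W : Cplx R -> R)
    (T : (Cplx R -> Cplx R) -> Cplx R -> Cplx R)
    (M : set (Cplx R -> Cplx R)) : Prop :=
  [/\ linear_subspace (fock p W) M, closed_in_fock p W M &
      forall f, M f -> M (T f)].

Definition nontrivial (R : realType) (X M : set (Cplx R -> Cplx R)) : Prop :=
  M <> [set 0] /\ M <> X.

Definition unicellular (R : realType) (p : R) (W : Cplx R -> R)
    (T : (Cplx R -> Cplx R) -> Cplx R -> Cplx R) : Prop :=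
  forall M N, invariant_subspace p W T M -> invariant_subspace p W T N ->
    M `<=` N \/ N `<=` M.

Definition polynomials (R : realType) : set (Cplx R -> Cplx R) :=
  [set F | exists q : {poly R[i]}, F = horner q].

Definition polynomials_upto (R : realType) (n : nat) : set (Cplx R -> Cplx R) :=
  [set F | exists2 q : {poly R[i]}, (size q <= n.+1)%N & F = horner q].

(* Main.v *)
(** Write [f = sum_k a_k z^k] for [f] in the space.

Key step: if [f] is not a polynomial, then [L^n f / a_n] tends to [1] in the weighted mean along a
sequence of indices [n]. Let [rho_i] be the radius at which the maximal term
[mu r = sup_k |a_k| r^k] reaches [4^i]. As the [rho_i] are unbounded, there are infinitely many [j]
with [rho_(j+1) - rho_i >= 2^-i] for all [i <= j]. Take [n] nearly attaining the maximal term just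
beyond [rho_j]: geometric series bound [|L^n f / a_n - 1|] by a multiple of
[1 + |f| + mu |z| + |z|^2], uniformly in [j], and dominated convergence applies. That [mu |z|] lies
in the weighted [L^p] space comes from averaging [|f|] over rotations by roots of unity (Jensen,
Fatou and the rotation invariance of planar measure).

Applied with the weight [|z|^(k p) W] and [L^k f] in place of [f], this puts every [z^k] in a closed
invariant subspace containing [f]. Polynomials are dense: Fejer means do not increase the norm,
again by averaging over roots of unity, and converge pointwise, hence in norm (Scheffe). So an
invariant subspace that contains polynomials of unbounded degree, or a function that is not a
polynomial, is the whole space.

The power series of an entire function comes from Goursat's bisection argument for the form
[F dz / (z - lam)] pulled back along [(s, t) |-> lam + e^(-s) (r e^(i t) - lam)]; integrals along
curves are increments of primitives. *)
Require Import Defs.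
From HB Require Import structures.
From mathcomp Require Import all_boot all_order all_algebra.
From mathcomp Require Import complex ring lra zify.
From mathcomp Require Import all_classical all_reals all_analysis measurable_realfun.
Set Implicit Arguments.
Unset Strict Implicit.
Unset Printing Implicit Defensive.
Import Order.TTheory GRing.Theory Num.Theory.
Import numFieldNormedType.Exports.
Local Open Scope classical_set_scope.
Local Open Scope ring_scope.

(** The obstacle is a majorant of [L^n f / a_n - 1] that does not depend on the chosen index. For
    [|z| < s] a geometric series gives a bound of order [|z| / (s - |z|)], and for [|z| > r] the
    polynomial part gives [r / (|z| - r)]; the two ranges overlap, but both bounds are poor when the
    gap is short. The scales are matched so that the loss is affordable: with thresholds 4^i and
    gaps 2^-i, a loss of 2^i |z| is at most 4^i + |z|^2, and 4^i is at most 1 + 4 mu |z|.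
    Summability of 2^-i is what makes such gaps exist. The passage from 1 to z^k rests on the
    identity z^k L^k g = g - q with q a polynomial of degree below k: the changed weight turns an
    approximation of 1 into one of z^k, and q lies in the subspace by induction on k. Circle means
    are replaced by finite averages over roots of unity, so that the finite Jensen inequality and
    single rotations suffice, without polar coordinates. Jensen and the passages to the limit both
    come from the tangent line of x^p. *)

Local Notation nc := Normc.normc.

(** * Power series *)

Section modulus.
Variable R : realType.
Implicit Types (z w : R[i]) (x y : R).

Lemma normE z : `|z| = (nc z)%:C%C.
Proof. by case: z => a b; rewrite normc_def. Qed.

Lemma nc_ge0 z : 0 <= nc z.
Proof. by case: z => a b; rewrite sqrtr_ge0. Qed.

Lemma nc0 : nc (0 : R[i]) = 0. Proof. exact: Normc.normc0. Qed.

Lemma nc1 : nc (1 : R[i]) = 1. Proof. exact: Normc.normc1. Qed.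

Lemma ncM z w : nc (z * w) = nc z * nc w. Proof. exact: Normc.normcM. Qed.

Lemma ncV z : nc z^-1 = (nc z)^-1. Proof. exact: Normc.normcV. Qed.

Lemma ncf z w : nc (z / w) = nc z / nc w. Proof. by rewrite ncM ncV. Qed.

Lemma ncX z n : nc (z ^+ n) = nc z ^+ n.
Proof. by elim: n => [|n IH]; rewrite ?expr0 ?nc1 // !exprS ncM IH. Qed.

Lemma ncD z w : nc (z + w) <= nc z + nc w. Proof. exact: le_normcD. Qed.

Lemma ncN z : nc (- z) = nc z. Proof. exact: normcN. Qed.

Lemma ncB z w : nc (z - w) <= nc z + nc w.
Proof. by rewrite -(ncN w) ncD. Qed.

Lemma nc_distC z w : nc (z - w) = nc (w - z).
Proof. by rewrite -ncN opprB. Qed.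

Lemma nc_eq0 z : (nc z == 0) = (z == 0).
Proof. by apply/eqP/eqP => [/Normc.eq0_normc|->]; rewrite ?nc0. Qed.

Lemma nc_gt0 z : (0 < nc z) = (z != 0).
Proof. by rewrite lt0r nc_ge0 andbT nc_eq0. Qed.

Lemma nc_triangle u z w : nc (z - w) <= nc (z - u) + nc (u - w).
Proof. by rewrite -[z - w](subrKA u) ncD. Qed.

Lemma nc_sum (I : Type) (r : seq I) (P : pred I) (F : I -> R[i]) :
  nc (\sum_(i <- r | P i) F i) <= \sum_(i <- r | P i) nc (F i).
Proof.
elim/big_ind2: _ => [|a b c d ab cd|//]; first by rewrite nc0.
by rewrite (le_trans (ncD _ _))// lerD.
Qed.

Lemma ncR x : nc x%:C%C = `|x|.
Proof. by rewrite /= expr0n/= addr0 sqrtr_sqr. Qed.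

Lemma ncR_ge0 x : 0 <= x -> nc x%:C%C = x.
Proof. by move=> x0; rewrite ncR ger0_norm. Qed.

Lemma sqr_nc z : nc z ^+ 2 = complex.Re z ^+ 2 + complex.Im z ^+ 2.
Proof. by case: z => a b /=; rewrite sqr_sqrtr// addr_ge0 ?sqr_ge0. Qed.

Lemma ler_Re_nc z : `|complex.Re z| <= nc z.
Proof.
by rewrite -(@ler_pXn2r _ 2) ?nnegrE ?nc_ge0 // sqr_nc real_normK ?num_real// lerDl sqr_ge0.
Qed.

Lemma ler_Im_nc z : `|complex.Im z| <= nc z.
Proof.
by rewrite -(@ler_pXn2r _ 2) ?nnegrE ?nc_ge0 // sqr_nc real_normK ?num_real// lerDr sqr_ge0.
Qed.

Lemma nc_le_ReIm z : nc z <= `|complex.Re z| + `|complex.Im z|.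
Proof.
rewrite {1}[z]complexE (le_trans (ncD _ _))// ncM !ncR.
by rewrite [nc 'i%C]/= expr0n/= add0r expr1n sqrtr1 mul1r.
Qed.

End modulus.

Lemma cvg0P (R : realType) (u : nat -> R) :
  u @ \oo --> 0 <-> forall e, 0 < e -> exists N, forall n, (N <= n)%N -> `|u n| < e.
Proof.
split=> [/cvgr0Pnorm_lt u0 e /u0[N _ HN]|H]; first by exists N => n /HN.
apply/cvgr0Pnorm_lt => e /H[N HN]; exists N => // n; exact: HN.
Qed.

Section power_series.
Variable R : realType.
Implicit Types (a : nat -> R[i]) (F : R[i] -> R[i]) (z : R[i]).

Definition psum a z n : R[i] := \sum_(k < n) a k * z ^+ k.

(** Stated without an infinite sum: the terms are bounded on every circle, that is, the radius of
    convergence is infinite, and the partial sums converge pointwise, measured by the real modulus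
    so that real limits suffice. *)
Definition expansion a F : Prop :=
  (forall r : R, exists C : R, forall k, nc (a k) * r ^+ k <= C) /\
  (forall z, nc (F z - psum a z n) @[n --> \oo] --> 0).

Definition coef_shift n a k : R[i] := a (n + k)%N.

Lemma expansion_coef a F r : expansion a F ->
  exists2 C : R, 0 < C & forall k, nc (a k) * r ^+ k <= C.
Proof.
move=> [/(_ r)[C HC] _]; exists (`|C| + 1); first by rewrite ltr_pwDr.
by move=> k; rewrite (le_trans (HC k))// (le_trans (ler_norm C))// lerDl.
Qed.

Lemma psumB a z m n :
  psum a z (m + n) - psum a z m = z ^+ m * psum (coef_shift m a) z n.
Proof.
rewrite /psum -!(big_mkord xpredT (fun k => a k * z ^+ k)).
rewrite (big_cat_nat _ (leq_addr n m)) //=.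
rewrite addrAC subrr add0r -{1}[m]add0n big_addn addKn big_mkord mulr_sumr.
by apply: eq_bigr => i _; rewrite /coef_shift addnC exprD; ring.
Qed.

Lemma geometric_le (x : R) n : 0 <= x < 1 -> \sum_(k < n) x ^+ k <= (1 - x)^-1.
Proof.
move=> /andP[x0 x1].
rewrite -[leRHS]mul1r ler_pdivlMr ?subr_gt0// mulrC.
have -> : (1 - x) * \sum_(k < n) x ^+ k = 1 - x ^+ n.
  by rewrite -opprB mulNr -subrX1 opprB.
by rewrite gerBl exprn_ge0.
Qed.

Lemma psum_le a (r C : R) z n : nc z < r ->
  (forall k, nc (a k) * r ^+ k <= C) ->
  nc (psum a z n) <= C * (r / (r - nc z)).
Proof.
move=> zr Ca; have r0 : 0 < r by exact: le_lt_trans (nc_ge0 z) zr.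
have C0 : 0 <= C by rewrite (le_trans _ (Ca 0%N))// mulr_ge0 ?nc_ge0.
have x1 : 0 <= nc z / r < 1 by rewrite divr_ge0 ?nc_ge0 ?ltW//= ltr_pdivrMr ?mul1r.
rewrite (le_trans (nc_sum _ _ _))//.
have -> : r / (r - nc z) = (1 - nc z / r)^-1.
  by field; rewrite gt_eqF// subr_eq0 gt_eqF.
rewrite (@le_trans _ _ (C * \sum_(k < n) (nc z / r) ^+ k)) //; last first.
  by rewrite ler_wpM2l// geometric_le.
rewrite mulr_sumr; apply: ler_sum => k _.
rewrite ncM ncX expr_div_n mulrA ler_pdivlMr ?exprn_gt0// mulrAC.
by rewrite ler_wpM2r ?exprn_ge0 ?nc_ge0.
Qed.

(** The remainder is [z^m] times the series with shifted coefficients. The bound is asked only of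
    the coefficients from [m] on, so that [C] can be adapted to the tail alone. *)
Lemma expansion_tail a F (r C : R) z m : expansion a F -> nc z < r ->
  (forall k, nc (a (m + k)%N) * r ^+ k <= C) ->
  nc (F z - psum a z m) <= C * nc z ^+ m * (r / (r - nc z)).
Proof.
move=> [_ /(_ z) aF] zr Ca; apply/ler_addgt0Pr => e e0.
have /cvg0P/(_ e e0)[N HN] := aF.
have NmN : (N <= m + N)%N by rewrite leq_addl.
have := HN _ NmN; rewrite ger0_norm ?nc_ge0// => /ltW Fe.
rewrite (le_trans (nc_triangle (psum a z (m + N)) _ _))// addrC lerD//.
rewrite psumB ncM ncX [leRHS]mulrAC [leRHS]mulrC ler_wpM2l ?exprn_ge0 ?nc_ge0//.
exact: psum_le.
Qed.

Lemma psum_shift a z n :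
  psum a z n.+1 = a 0%N + z * psum (coef_shift 1 a) z n.
Proof.
have := psumB a z 1 n; rewrite add1n expr1 => <-.
by rewrite {3}/psum big_ord1 expr0 mulr1 subrKC.
Qed.

Lemma expansion_at0 a F : expansion a F -> F 0 = a 0%N.
Proof.
move=> aF; apply/eqP; rewrite -subr_eq0 -nc_eq0; apply/eqP.
have [C C0 HC] := expansion_coef 1 aF.
apply/eqP; rewrite eq_le nc_ge0 andbT.
have := @expansion_tail a F 1 C 0 1 aF.
rewrite nc0 ltr01 expr1 mulr0 mul0r /psum big_ord1 expr0 mulr1; apply=> // k.
by have := HC (1 + k)%N; rewrite !expr1n.
Qed.

End power_series.
(** * Goursat's theorem and power series of entire functions *)

Section curves.
Variable R : realType.
Implicit Types (P Q f g : R -> R[i]) (x : R) (c d : R[i]).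

(** Taken in components, so that real calculus applies to each of them. *)
Definition cder P x d :=
  is_derive x (1 : R) (fun t => complex.Re (P t)) (complex.Re d) /\
  is_derive x (1 : R) (fun t => complex.Im (P t)) (complex.Im d).

Definition ccont f := forall x e, 0 < e ->
  exists2 d : R, 0 < d & forall y, `|y - x| < d -> nc (f y - f x) < e.

Lemma Re_add c d : complex.Re (c + d) = complex.Re c + complex.Re d.
Proof. by case: c => a b; case: d. Qed.

Lemma Im_add c d : complex.Im (c + d) = complex.Im c + complex.Im d.
Proof. by case: c => a b; case: d. Qed.

Lemma Re_sub c d : complex.Re (c - d) = complex.Re c - complex.Re d.
Proof. by case: c => a b; case: d. Qed.

Lemma Im_sub c d : complex.Im (c - d) = complex.Im c - complex.Im d.
Proof. by case: c => a b; case: d. Qed.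

Lemma Re_mul c d : complex.Re (c * d) = complex.Re c * complex.Re d - complex.Im c * complex.Im d.
Proof. by case: c => a b; case: d. Qed.

Lemma Im_mul c d : complex.Im (c * d) = complex.Re c * complex.Im d + complex.Im c * complex.Re d.
Proof. by case: c => a b; case: d. Qed.

Lemma is_derive_ext (f g : R -> R) (x d d' : R) : is_derive x 1 f d ->
  f =1 g -> d = d' -> is_derive x 1 g d'.
Proof. by move=> df /funext <- <-. Qed.

Lemma cderD P Q x c d : cder P x c -> cder Q x d -> cder (fun t => P t + Q t) x (c + d).
Proof.
move=> [P1 P2] [Q1 Q2]; split.
- by apply: is_derive_ext (is_deriveD P1 Q1) _ _ => [t|]; rewrite raddfD.
- by apply: is_derive_ext (is_deriveD P2 Q2) _ _ => [t|]; rewrite raddfD.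
Qed.

Lemma cderM P Q x c d : cder P x c -> cder Q x d ->
  cder (fun t => P t * Q t) x (P x * d + c * Q x).
Proof.
move=> [P1 P2] [Q1 Q2]; split.
- apply: is_derive_ext (is_deriveB (is_deriveM P1 Q1) (is_deriveM P2 Q2)) _ _ => [t|].
    by rewrite Re_mul.
  by rewrite Re_add !Re_mul /GRing.scale/=; ring.
- apply: is_derive_ext (is_deriveD (is_deriveM P1 Q2) (is_deriveM P2 Q1)) _ _ => [t|].
    by rewrite Im_mul.
  by rewrite Im_add !Im_mul /GRing.scale/=; ring.
Qed.

Lemma cder_cst c x : cder (fun=> c) x 0.
Proof. by split; exact: is_derive_cst. Qed.

Lemma cder_id x : cder (fun t => t%:C%C) x 1.
Proof. by split; [exact: is_derive_id|exact: is_derive_cst]. Qed.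

Lemma cderZ P x c d : cder P x d -> cder (fun t => c * P t) x (c * d).
Proof. by move=> Pd; have := cderM (cder_cst c x) Pd; rewrite mul0r addr0. Qed.

Lemma cderB P Q x c d : cder P x c -> cder Q x d -> cder (fun t => P t - Q t) x (c - d).
Proof.
move=> Pc /(cderZ (-1)) Qd; have := cderD Pc Qd; rewrite mulN1r; congr cder.
by apply/funext => t; rewrite mulN1r.
Qed.

Lemma cder_eq P x c d : cder P x c -> c = d -> cder P x d.
Proof. by move=> + <-. Qed.

(** Pairing the curve with the fixed vector [u = P b - P a] gives a real function whose increment is
    [|u|^2]; the real mean value theorem and Cauchy-Schwarz bound it by [|u| C (b - a)]. *)
Lemma mean_value P f a b C : a <= b -> (forall x, a <= x <= b -> cder P x (f x)) ->
  (forall x, a <= x <= b -> nc (f x) <= C) -> nc (P b - P a) <= C * (b - a).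
Proof.
move=> ab dP fC; set u := P b - P a.
have [->|u0] := eqVneq u 0.
  rewrite nc0 mulr_ge0 ?subr_ge0// (le_trans (nc_ge0 (f a)))// fC// lexx ab//.
rewrite -(ler_pM2l (_ : 0 < nc u)) ?nc_gt0// -expr2.
pose h t : R := complex.Re u * complex.Re (P t) + complex.Im u * complex.Im (P t).
have dh x : a <= x <= b ->
    is_derive x 1 h (complex.Re u * complex.Re (f x) + complex.Im u * complex.Im (f x)).
  by move=> /dP[P1 P2]; exact: is_deriveD (is_deriveZ _ P1) (is_deriveZ _ P2).
have dh' x : x \in `]a, b[ ->
    is_derive x 1 h (complex.Re u * complex.Re (f x) + complex.Im u * complex.Im (f x)).
  by rewrite in_itv/= => /andP[/ltW ax /ltW xb]; apply: dh; rewrite ax.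
have ch : {within `[a, b], continuous h}.
  by apply/derivable_within_continuous => x; rewrite in_itv/= => /dh dhx; exact: ex_derive.
have [c] := MVT_segment ab dh' ch; rewrite in_itv/= => /[dup] cab /fC fcC.
have -> : h b - h a = nc u ^+ 2.
  by rewrite sqr_nc /h /u !Re_sub !Im_sub; ring.
move=> ->; rewrite mulrA ler_wpM2r ?subr_ge0//.
rewrite (@le_trans _ _ (nc u * nc (f c)))//; last by rewrite ler_wpM2l ?nc_ge0.
set X := leLHS; rewrite (le_trans (ler_norm X))//.
rewrite -(@ler_pXn2r _ 2) ?nnegrE ?mulr_ge0 ?nc_ge0 //.
rewrite real_normK ?num_real// exprMn !sqr_nc -subr_ge0.
set v := (X in 0 <= X).
(* Lagrange's identity: the defect in Cauchy-Schwarz is a square. *)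
have -> : v = (complex.Re u * complex.Im (f c) - complex.Im u * complex.Re (f c)) ^+ 2.
  by rewrite /v /X; ring.
exact: sqr_ge0.
Qed.

Lemma cder_increment P Q f a b : a <= b ->
  (forall x, a <= x <= b -> cder P x (f x)) ->
  (forall x, a <= x <= b -> cder Q x (f x)) -> P b - P a = Q b - Q a.
Proof.
move=> ab dP dQ; apply/eqP; rewrite -subr_eq0 -nc_eq0 eq_le nc_ge0 andbT.
have := @mean_value (fun t => P t - Q t) (fun=> 0) a b 0 ab.
have -> : P b - P a - (Q b - Q a) = P b - Q b - (P a - Q a) by ring.
rewrite mul0r; apply => x xab; last by rewrite nc0.
by have := cderB (dP x xab) (dQ x xab); rewrite subrr.
Qed.

Lemma ccont_Re f : ccont f -> continuous (fun t => complex.Re (f t)).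
Proof.
move=> cf x; apply/cvgrPdist_lt => e e0; have [d d0 Hd] := cf x e e0.
exists d => //= y xy.
rewrite -Re_sub (le_lt_trans (ler_Re_nc _))// nc_distC; by apply: Hd; rewrite distrC.
Qed.

Lemma ccont_Im f : ccont f -> continuous (fun t => complex.Im (f t)).
Proof.
move=> cf x; apply/cvgrPdist_lt => e e0; have [d d0 Hd] := cf x e e0.
exists d => //= y xy.
rewrite -Im_sub (le_lt_trans (ler_Im_nc _))// nc_distC; by apply: Hd; rewrite distrC.
Qed.

(** The base point -1 leaves room below 0: the later integrals start at 0 and need a two-sided
    derivative there. *)
Lemma real_primitive (h : R -> R) : continuous h ->
  exists H : R -> R, forall x, -1 < x -> is_derive x 1 H (h x).
Proof.
move=> ch; exists (fun x => \int[@lebesgue_measure R]_(t in `[(-1)%R, x]) h t)%R => x x1.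
have [] := @continuous_FTC1_closed R h (-1) x (x + 1) _ _ x1 (ch x).
- by rewrite ltrDl.
- apply: continuous_compact_integrable; first exact: segment_compact.
  exact/continuous_subspaceT.
- move=> dH HE; have := @derivableP _ _ _ _ _ _ dH; rewrite -derive1E HE; exact.
Qed.

Lemma primitive_exists f : ccont f -> exists P, forall x, -1 < x -> cder P x (f x).
Proof.
move=> cf; have [A dA] := real_primitive (ccont_Re cf).
have [B dB] := real_primitive (ccont_Im cf).
by exists (fun t => A t +i* B t)%C => x x1; split; [exact: dA|exact: dB].
Qed.

(** A total choice of primitive, so that an integral can be written as an increment of [prim f]. For
    a discontinuous [f] the value is a mere default. *)
Definition prim f : R -> R[i] :=
  if pselect (ccont f) is left cf then projT1 (cid (primitive_exists cf)) else f.

Lemma primP f x : ccont f -> -1 < x -> cder (prim f) x (f x).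
Proof.
rewrite /prim; case: pselect => // cf _; case: cid => /= P; exact.
Qed.

End curves.

(** * Bisection of rectangles *)

Section bisection.
Variable R : realType.

Lemma nested_intervals (u v : nat -> R) :
  (forall n, u n <= u n.+1) -> (forall n, v n.+1 <= v n) -> (forall n, u n <= v n) ->
  exists s, forall n, u n <= s <= v n.
Proof.
move=> uS vS uv.
have ndu : {homo u : m n / (m <= n)%N >-> m <= n} by apply: homo_leq => // ? ? ?; exact: le_trans.
have niv : {homo v : m n / (m <= n)%N >-> n <= m}.
  by apply: (homo_leq (r := fun x y => y <= x)) => // x y z xy yz; exact: le_trans xy.
have ub m : ubound (range u) (v m).
  move=> _ [n _ <-]; have [nm|/ltnW mn] := leqP n m.
    by rewrite (le_trans (ndu _ _ nm)).
  by rewrite (le_trans (uv n))// niv.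
exists (sup (range u)) => n; apply/andP; split.
  by apply: ub_le_sup; [exists (v 0%N); exact: ub|exists n].
by apply: ge_sup; [exists (u 0%N), 0%N|exact: ub].
Qed.

(** [J a b c d] stands for the integral along the boundary of [[a, b] x [c, d]]. If it is not 0,
    some quarter of the rectangle carries at least a quarter of its modulus, hence at least [N 4^-n]
    remains after [n] steps; this contradicts an [o(q^2)] bound at the common point of the nested
    rectangles. Only rectangles with sides [q l] and [q m] occur. *)
Lemma bisection (J : R -> R -> R -> R -> R[i]) (a0 c0 l m : R) :
  0 <= l -> 0 <= m ->
  (forall a b e c d, J a e c d = J a b c d + J b e c d) ->
  (forall a b c d e, J a b c e = J a b c d + J a b d e) ->
  (forall s t e, a0 <= s -> c0 <= t -> 0 < e -> exists2 d, 0 < d &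
     forall a c q, a0 <= a -> c0 <= c -> 0 < q < d ->
       a <= s <= a + q * l -> c <= t <= c + q * m ->
       nc (J a (a + q * l) c (c + q * m)) <= e * q ^+ 2) ->
  J a0 (a0 + l) c0 (c0 + m) = 0.
Proof.
move=> l0 m0 J1 J2 Jloc; apply/eqP; rewrite -nc_eq0 eq_le nc_ge0 andbT leNgt; apply/negP.
set N := nc _ => N0.
pose q n : R := 2^-1 ^+ n.
have q0 n : 0 < q n by rewrite exprn_gt0.
have qS n : q n = q n.+1 + q n.+1 by rewrite /q exprS; lra.
pose good n (p : R * R) :=
  N * q n ^+ 2 <= nc (J p.1 (p.1 + q n * l) p.2 (p.2 + q n * m)).
pose near n (p p' : R * R) := [/\ p.1 <= p'.1 <= p.1 + q n.+1 * l,
  p.2 <= p'.2 <= p.2 + q n.+1 * m & good n.+1 p'].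
have step n p : good n p -> exists p', near n p p'.
  case: p => a c; rewrite /good/= => ac; apply: contrapT => /forallNP no.
  pose a' := a + q n.+1 * l; pose c' := c + q n.+1 * m.
  have ea : a + q n * l = a' + q n.+1 * l by rewrite qS /a'; ring.
  have ec : c + q n * m = c' + q n.+1 * m by rewrite qS /c'; ring.
  have ql : 0 <= q n.+1 * l by rewrite mulr_ge0// ltW.
  have qm : 0 <= q n.+1 * m by rewrite mulr_ge0// ltW.
  have bad x y : x \in [:: a; a'] -> y \in [:: c; c'] ->
      nc (J x (x + q n.+1 * l) y (y + q n.+1 * m)) < N * q n.+1 ^+ 2.
    move=> xa yc; rewrite ltNge; apply/negP => H; apply: (no (x, y)); split => //=.
      by move: xa; rewrite !inE => /orP[]/eqP->; rewrite !lerDl lexx ?ql.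
    by move: yc; rewrite !inE => /orP[]/eqP->; rewrite !lerDl lexx ?qm.
  have := bad _ _ (mem_head a _) (mem_head c _).
  have := bad a c' (mem_head a _) _; have := bad a' c _ (mem_head c _).
  have := bad a' c' _ _; rewrite !inE !eqxx !orbT => /(_ isT isT) h1 /(_ isT) h2 /(_ isT) h3 h4.
  move: ac; apply/negP; rewrite -ltNge ea ec (J1 _ a') (J2 a _ _ c') (J2 a' _ _ c').
  apply: (le_lt_trans (ncD _ _)); apply: (le_lt_trans (lerD (ncD _ _) (ncD _ _))).
  rewrite -/a' -/c' in h1 h2 h3 h4 *.
  have -> : N * q n ^+ 2 = N * q n.+1 ^+ 2 + N * q n.+1 ^+ 2 + (N * q n.+1 ^+ 2 + N * q n.+1 ^+ 2).
    by rewrite qS; ring.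
  by rewrite ltrD// ltrD.
pose next n p := if pselect (exists p', near n p p') is left h then projT1 (cid h) else p.
pose p := fix p n := if n is n'.+1 then next n' (p n') else (a0, c0).
have gp n : good n (p n) /\ near n (p n) (p n.+1).
  have nxt k : good k (p k) -> near k (p k) (p k.+1).
    move=> /step h; rewrite /= /next; case: pselect => // h'; by case: cid.
  suff gn : good n (p n) by split=> //; exact: nxt.
  elim: n => [|n /nxt[]//].
  by rewrite /good /= /q expr0 !mul1r expr1n mulr1 lexx.
have [s Hs] : exists s, forall n, (p n).1 <= s <= (p n).1 + q n * l.
  apply: (@nested_intervals (fun n => (p n).1) (fun n => (p n).1 + q n * l)) => n;
    have [_ [/andP[h1 h2] _ _]] := gp n => //.
    by rewrite (qS n) mulrDl addrA lerD2r.
  by rewrite lerDl mulr_ge0// ltW.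
have [t Ht] : exists t, forall n, (p n).2 <= t <= (p n).2 + q n * m.
  apply: (@nested_intervals (fun n => (p n).2) (fun n => (p n).2 + q n * m)) => n;
    have [_ [_ /andP[h1 h2] _]] := gp n => //.
    by rewrite (qS n) mulrDl addrA lerD2r.
  by rewrite lerDl mulr_ge0// ltW.
have pge n : a0 <= (p n).1 /\ c0 <= (p n).2.
  elim: n => [|n [h1 h2]] //; have [_ [/andP[h3 _] /andP[h4 _] _]] := gp n.
  by split; [exact: le_trans h3|exact: le_trans h4].
(* With [N / 2] the local upper bound falls below the lower bound [N q^2] preserved by the
   bisection. *)
have [d d0 Hd] := Jloc s t (N / 2) (proj1 (andP (Hs 0%N))) (proj1 (andP (Ht 0%N))) (divr_gt0 N0 (ltr0Sn _ 1)).
have [n qn] : exists n, q n < d.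
  have : q @ \oo --> 0 by apply: cvg_expr; rewrite ger0_norm; lra.
  by move=> /cvg0P /(_ d d0)[n /(_ n (leqnn n))]; rewrite ger0_norm ?ltW// => ?; exists n.
have [h _] := gp n; have [h1 h2] := pge n.
have := le_trans h (Hd _ _ (q n) h1 h2 _ (Hs n) (Ht n)).
rewrite q0 qn => /(_ isT); apply/negP; rewrite -ltNge ltr_pM2r ?exprn_gt0//.
by rewrite ltr_pdivrMr//; lra.
Qed.

End bisection.
(** The nonstrict bound holds at [w = z] as well, so no punctured neighbourhood is needed. *)
Definition complex_derivative (R : realType) (F : R[i] -> R[i]) (z D : R[i]) : Prop :=
  forall e : R, 0 < e -> exists2 d : R, 0 < d &
    forall w, nc (w - z) < d -> nc (F w - F z - D * (w - z)) <= e * nc (w - z).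

Lemma derivable_complex_derivative (R : realType) (F : R[i]^o -> R[i]^o) (z : R[i]^o) :
  derivable F z 1 -> complex_derivative F z (F^`()%classic z).
Proof.
move=> dF e e0; rewrite derive1E.
have /cvgrPdist_lt /(_ e%:C%C) : (h^-1 *: (F (h *: 1 + z) - F z)) @[h --> (0:R[i]^o)^'] --> 'D_1 F z.
  exact: dF.
rewrite ltcR => /(_ e0)[d /= d0 Hd]; move: d0; rewrite ltcE/= => /andP[/eqP d1 d0].
have {d1}dE : d = (complex.Re d)%:C%C by case: d d1 {d0 Hd} => a b /= ->.
exists (complex.Re d) => // w wz.
have [->|wz0] := eqVneq w z; first by rewrite !subrr mulr0 subr0 nc0 mulr0.
have wz0' : w - z != 0 by rewrite subr_eq0.
have := Hd (w - z) _ wz0'.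
rewrite /ball_/= sub0r normrN dE normE ltcR => /(_ wz).
rewrite normE ltcR /GRing.scale/= mulr1 subrK.
set D := 'D_1 F z => /ltW H.
have -> : F w - F z - D * (w - z) = - (w - z) * (D - (w - z)^-1 * (F w - F z)) :> R[i].
  by field.
by rewrite ncM ncN mulrC ler_wpM2r ?nc_ge0.
Qed.

Section more_curves.
Variable R : realType.
Implicit Types (P f g : R -> R[i]).

Lemma ccontI f : continuous (fun t => complex.Re (f t)) ->
  continuous (fun t => complex.Im (f t)) -> ccont f.
Proof.
move=> cr ci x e e0; have e20 : 0 < e / 2 by lra.
have /cvgrPdist_lt/(_ _ e20)[d d0 Hd] := cr x.
have /cvgrPdist_lt/(_ _ e20)[d' d'0 Hd'] := ci x.
exists (Num.min d d'); first by rewrite lt_min d0.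
move=> y; rewrite lt_min distrC => /andP[/Hd + /Hd'] => /= h1 h2.
rewrite nc_distC (le_lt_trans (nc_le_ReIm _))// Re_sub Im_sub.
by rewrite [e]splitr ltrD.
Qed.

Lemma ccontD f g : ccont f -> ccont g -> ccont (fun t => f t + g t).
Proof.
move=> cf cg; apply: ccontI => x.
- under eq_fun do rewrite Re_add.
  by apply: cvgD; exact: ccont_Re.
- under eq_fun do rewrite Im_add.
  by apply: cvgD; exact: ccont_Im.
Qed.

Lemma ccont_comp (F : R[i] -> R[i]) f : (forall z, exists D, complex_derivative F z D) ->
  ccont f -> ccont (fun t => F (f t)).
Proof.
move=> dF cf x e e0; have [D dD] := dF (f x).
have [d d0 Hd] := dD 1 ltr01.
have D1 : 0 < nc D + 2 by rewrite ltr_wpDl ?nc_ge0.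
have m0 : 0 < Num.min d (e / (nc D + 2)) by rewrite lt_min d0 divr_gt0.
have [d' d'0 Hd'] := cf x _ m0.
exists d' => // y /Hd'; rewrite lt_min => /andP[/Hd h1].
rewrite ltr_pdivlMr// => h2.
have -> : F (f y) - F (f x) = (F (f y) - F (f x) - D * (f y - f x)) + D * (f y - f x).
  by rewrite subrK.
rewrite (le_lt_trans (ncD _ _))// (le_lt_trans _ h2)// ncM.
by have := nc_ge0 (f y - f x); lra.
Qed.

Lemma ccontM f g : ccont f -> ccont g -> ccont (fun t => f t * g t).
Proof.
move=> cf cg; have [fr gr] := (ccont_Re cf, ccont_Re cg).
have [fi gi] := (ccont_Im cf, ccont_Im cg).
apply: ccontI => x.
- under eq_fun do rewrite Re_mul.
  by apply: cvgB; apply: cvgM; [exact: fr|exact: gr|exact: fi|exact: gi].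
- under eq_fun do rewrite Im_mul.
  by apply: cvgD; apply: cvgM; [exact: fr|exact: gi|exact: fi|exact: gr].
Qed.

Lemma cder_ccont P f : (forall x, cder P x (f x)) -> ccont P.
Proof.
by move=> dP; apply: ccontI => x; apply: differentiable_continuous;
   apply/derivable1_diffP; [have [? _] := dP x|have [_ ?] := dP x]; exact: ex_derive.
Qed.

Lemma ccont_cst (c : R[i]) : ccont (fun=> c).
Proof. by apply: (@cder_ccont _ (fun=> 0)) => x; exact: cder_cst. Qed.

Lemma ccontV f : ccont f -> (forall x, f x != 0) -> ccont (fun t => (f t)^-1).
Proof.
move=> cf f0; pose n2 t := complex.Re (f t) ^+ 2 + complex.Im (f t) ^+ 2.
have cn : continuous n2.
  by move=> x; apply: cvgD; apply: cvgM; (exact: (ccont_Re cf))||exact: (ccont_Im cf).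
have n20 x : n2 x != 0.
  by rewrite /n2 -sqr_nc expf_eq0/= nc_eq0.
have fV t : (f t)^-1 = (complex.Re (f t) / n2 t -i* (complex.Im (f t) / n2 t))%C.
  by rewrite /n2; case: (f t) => a b; rewrite /GRing.inv/= ?mulNr.
apply: ccontI => x; under eq_fun do rewrite fV/=.
- by apply: cvgM; [exact: (ccont_Re cf)|apply: cvgV; [exact: n20|exact: cn]].
- apply: cvgN; apply: cvgM; [exact: (ccont_Im cf)|apply: cvgV; [exact: n20|exact: cn]].
Qed.

Lemma ccont_bounded f a b : a <= b -> ccont f ->
  exists2 M : R, 0 < M & forall x, a <= x <= b -> nc (f x) <= M.
Proof.
move=> ab cf.
have cn : continuous (fun t => `|complex.Re (f t)| + `|complex.Im (f t)|).
  by move=> x; apply: cvgD; apply: cvg_norm; [exact: ccont_Re|exact: ccont_Im].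
have [c _ Hc] := EVT_max ab (continuous_subspaceT cn).
exists (`|complex.Re (f c)| + `|complex.Im (f c)| + 1).
  by rewrite ltr_wpDl ?addr_ge0.
by move=> x xab; rewrite (le_trans (nc_le_ReIm _))// ler_wpDr// Hc// in_itv.
Qed.

Lemma cder_sum (P f : nat -> R -> R[i]) x n : (forall i, cder (P i) x (f i x)) ->
  cder (fun t => \sum_(i < n) P i t) x (\sum_(i < n) f i x).
Proof.
move=> dP; elim: n => [|n IH].
  by rewrite big_ord0; have := cder_cst (0 : R[i]) x; congr cder; apply/funext => t; rewrite big_ord0.
rewrite big_ord_recr/=; have := cderD IH (dP n); congr cder.
by apply/funext => t; rewrite big_ord_recr.
Qed.

Definition cis (t : R) : R[i] := (cos t +i* sin t)%C.

Lemma nc_cis t : nc (cis t) = 1.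
Proof. by rewrite /= cos2Dsin2 sqrtr1. Qed.

Lemma cis_neq0 t : cis t != 0.
Proof. by rewrite -nc_eq0 nc_cis oner_neq0. Qed.

Lemma cisD s t : cis (s + t) = cis s * cis t.
Proof. by rewrite /cis cosD sinD; congr (_ +i* _)%C; ring. Qed.

Lemma cisMn t n : cis (t *+ n) = cis t ^+ n.
Proof.
elim: n => [|n IH]; first by rewrite mulr0n expr0 /cis cos0 sin0.
by rewrite mulrS cisD IH exprS.
Qed.

Lemma cis0 : cis 0 = 1. Proof. by rewrite /cis cos0 sin0. Qed.

Lemma cis2pi : cis (pi *+ 2) = 1. Proof. by rewrite /cis cos2pi sin2pi. Qed.

Lemma cder_cis (a t : R) : cder (fun x => cis (a * x)) t (a%:C%C * 'i%C * cis (a * t)).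
Proof.
have d : is_derive t 1 (fun x => a * x) a.
  by apply: is_derive_eq (is_deriveZ a (is_derive_id t 1)) _; rewrite /GRing.scale/= mulr1.
split.
- by apply: is_derive_ext (is_derive1_comp (is_derive_cos _) d) _ _ => [x|] //=; ring.
- by apply: is_derive_ext (is_derive1_comp (is_derive_sin _) d) _ _ => [x|] //=; ring.
Qed.

Lemma cder_expN (s : R) : cder (fun x => (expR (- x))%:C%C) s (- (expR (- s))%:C%C).
Proof.
split => /=; last by rewrite oppr0; exact: is_derive_cst.
apply: is_derive_ext (is_derive1_comp (is_derive_expR _) (is_deriveNid _ _)) _ _ => [x|] //=.
by rewrite mulrN1.
Qed.

End more_curves.

(** * Cauchy's integral formula *)

Section cauchy.
Variables (R : realType) (F : R[i] -> R[i]) (lam : R[i]) (r : R).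
Hypothesis dF : forall z, exists D, complex_derivative F z D.
Hypothesis lamr : nc lam < r.

Local Notation ex s := (expR (- s))%:C%C.
(** [pt] contracts the circle, which is [s = 0], to [lam] as [s] grows. Along it [dz / (z - lam)]
    becomes [- ds + k dt] with [k = w' / w]; [A] and [B] integrate the two components of the form,
    the first up to sign. *)
Let w t := r%:C%C * cis t - lam.
Let k t := r%:C%C * 'i%C * cis t / w t.
Let pt s t := lam + ex s * w t.
Let A t := prim (fun s => F (pt s t)).
Let B s := prim (fun t => F (pt s t) * k t).
Let Kp := prim k.

Let r0 : 0 < r. Proof. exact: le_lt_trans (nc_ge0 _) lamr. Qed.

Let w_ge t : r - nc lam <= nc (w t).
Proof.
have := ncD (w t) lam; rewrite /w subrK ncM nc_cis mulr1 ncR_ge0; last exact: ltW.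
by rewrite lerBlDr.
Qed.

Let w_le t : nc (w t) <= 2 * r.
Proof.
rewrite (le_trans (ncB _ _))// ncM nc_cis mulr1 ncR_ge0; last exact: ltW.
by move: lamr; lra.
Qed.

Let w_neq0 t : w t != 0.
Proof. by rewrite -nc_gt0 (lt_le_trans _ (w_ge t))// subr_gt0. Qed.

Let dw t : cder w t (r%:C%C * 'i%C * cis t).
Proof.
have := cderB (cderZ r%:C%C (cder_cis 1 t)) (cder_cst lam t).
rewrite !mul1r !subr0 mulrA; congr cder; apply/funext => s; by rewrite mul1r.
Qed.

Let cw : ccont w. Proof. exact: cder_ccont dw. Qed.

Let ccis : ccont (@cis R).
Proof.
apply: (@cder_ccont _ _ (fun t => 'i%C * cis t)) => t.
have := cder_cis 1 t; rewrite !mul1r; congr cder; apply/funext => s; by rewrite mul1r.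
Qed.

Let ck : ccont k.
Proof.
apply: ccontM; last exact: ccontV.
by apply: ccontM => //; exact: ccont_cst.
Qed.

Let k_le t : nc (k t) <= r / (r - nc lam).
Proof.
rewrite /k ncf !ncM nc_cis mulr1 ncR_ge0; last exact: ltW.
rewrite [nc 'i%C]/= expr0n/= add0r expr1n sqrtr1 mulr1 ler_pM2l//.
by rewrite lef_pV2 ?w_ge// posrE ?subr_gt0// (lt_le_trans _ (w_ge t))// subr_gt0.
Qed.

Let cF (f : R -> R[i]) (cf : ccont f) : ccont (fun t => F (f t)) := ccont_comp dF cf.

Let ex_ccont : ccont (fun s : R => ex s).
Proof. exact: cder_ccont (@cder_expN R). Qed.

Let cFs t : ccont (fun s => F (pt s t)).
Proof.
apply: cF; apply: ccontD; first exact: ccont_cst.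
by apply: ccontM => //; exact: ccont_cst.
Qed.

Let cFt s : ccont (fun t => F (pt s t) * k t).
Proof.
apply: ccontM => //; apply: cF; apply: ccontD; first exact: ccont_cst.
by apply: ccontM => //; exact: ccont_cst.
Qed.

(** The integral of the pulled back form around [[a, b] x [c, d]], counterclockwise; the sides in
    direction [s] enter through [- A]. *)
Let J a b c d := - (A c b - A c a) + (A d b - A d a) + (B b d - B b c) - (B a d - B a c).

Let ex_lip (s s' : R) : 0 <= s -> 0 <= s' -> nc (ex s - ex s') <= `|s - s'|.
Proof.
wlog ss : s s' / s' <= s.
  move=> H s0 s'0; case: (leP s' s) => [|/ltW] h; first exact: H.
  by rewrite nc_distC distrC H.
move=> s0 s'0; rewrite ger0_norm ?subr_ge0// -[leRHS]mul1r.
apply: (@mean_value _ (fun s : R => ex s) (fun s : R => - ex s)) => // x /andP[h _].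
  exact: cder_expN.
by rewrite ncN ncR_ge0 ?expR_ge0// -expR0 ler_expR oppr_le0 (le_trans s'0).
Qed.

Let w_lip t t' : nc (w t - w t') <= r * `|t - t'|.
Proof.
wlog tt : t t' / t' <= t.
  move=> H; case: (leP t' t) => [|/ltW] h; first exact: H.
  by rewrite nc_distC distrC H.
rewrite ger0_norm ?subr_ge0//.
apply: (@mean_value _ w _) => // x _; first exact: dw.
rewrite !ncM nc_cis ncR_ge0 ?[nc 'i%C]/= ?expr0n/= ?add0r ?expr1n ?sqrtr1 ?mulr1//; exact: ltW.
Qed.

Let pt_lip s t s' t' : 0 <= s -> 0 <= s' ->
  nc (pt s t - pt s' t') <= r * `|t - t'| + 2 * r * `|s - s'|.
Proof.
move=> s0 s'0.
have -> : pt s t - pt s' t' = ex s * (w t - w t') + w t' * (ex s - ex s').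
  by rewrite /pt; ring.
rewrite (le_trans (ncD _ _))// !ncM lerD//.
  rewrite -[leRHS]mul1r ler_pM ?nc_ge0// ?w_lip//.
  by rewrite ncR_ge0 ?expR_ge0// -expR0 ler_expR oppr_le0.
by rewrite ler_pM ?nc_ge0// ex_lip.
Qed.

(** Near one point [F] is affine up to an error [rho] of size [e' q L]. The affine part has the
    primitives [SA] and [SB] along the sides, and their increments cancel around the rectangle. The
    sides have length [O(q)], which leaves [O(e' q^2)]. *)
Let J_local S m s t e : 0 <= S -> 0 <= m -> 0 <= s -> 0 <= t -> 0 < e -> exists2 d, 0 < d &
     forall a c q, 0 <= a -> 0 <= c -> 0 < q < d ->
       a <= s <= a + q * S -> c <= t <= c + q * m ->
       nc (J a (a + q * S) c (c + q * m)) <= e * q ^+ 2.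
Proof.
move=> S0 m0 s0 t0 e0.
pose K := r / (r - nc lam).
have K0 : 0 < K by rewrite divr_gt0// subr_gt0.
pose L := r * m + 2 * r * S.
have L0 : 0 <= L by rewrite /L addr_ge0// !mulr_ge0// ltW.
(* [N - 1] is what the four sides contribute, in units of [e' q^2]; the added 1 keeps [N] positive
   when [S] and [m] vanish. *)
pose N := L * (2 * S + 2 * (m * K)) + 1.
have N0 : 0 < N.
  by rewrite /N ltr_wpDl// mulr_ge0// addr_ge0// mulr_ge0// mulr_ge0// ltW.
pose e' := e / N.
have e'0 : 0 < e' by rewrite divr_gt0.
have [D dD] := dF (pt s t); have [d d0 Hd] := dD e' e'0.
exists (d / (L + 1)); first by rewrite divr_gt0// ltr_wpDl.
move=> a c q a0 c0 /andP[q0]; rewrite ltr_pdivlMr ?ltr_wpDl// => qd /andP[as_ sa] /andP[ct tc].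
set b := a + q * S; set h := c + q * m.
have ab : a <= b by rewrite lerDl mulr_ge0// ltW.
have ch : c <= h by rewrite lerDl mulr_ge0// ltW.
pose rho x y := F (pt x y) - F (pt s t) - D * (pt x y - pt s t).
have rhoP x y : a <= x <= b -> c <= y <= h -> nc (rho x y) <= e' * (q * L).
  move=> /andP[ax xb] /andP[cy yh].
  have dxs : `|x - s| <= q * S by rewrite ler_norml; apply/andP; split; rewrite /b in xb; lra.
  have dyt : `|y - t| <= q * m by rewrite ler_norml; apply/andP; split; rewrite /h in yh; lra.
  have lip : nc (pt x y - pt s t) <= q * L.
    rewrite (le_trans (pt_lip _ _ _ _))//; first exact: le_trans ax.
    rewrite /L mulrDr lerD//; first by rewrite mulrCA ler_pM2l.
    by rewrite [leRHS]mulrCA ler_pM2l// mulr_gt0.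
  rewrite (le_trans (Hd _ _))//; last by rewrite ler_pM2l.
  by rewrite (le_lt_trans lip)// (le_lt_trans _ qd)// ler_pM2l// lerDl.
(* The affine approximation at [pt x y] reads [c1 + D e^(-x) w y]; its product with [k] has an
   explicit primitive because [k w = w']. *)
pose c1 := F (pt s t) + D * (lam - pt s t).
pose SA y x := c1 * x%:C%C - D * (ex x * w y).
pose SB x y := c1 * Kp y + D * ex x * w y.
have dSA y x : cder (SA y) x (F (pt x y) - rho x y).
  have := cderB (cderZ c1 (cder_id x)) (cderZ (D * w y) (cder_expN x)).
  rewrite /SA; have -> : (fun t0 : R => c1 * t0%:C%C - D * w y * ex t0) = (fun x0 : R => c1 * x0%:C%C - D * (ex x0 * w y)).
    by apply/funext => z; ring.
  by move=> /cder_eq; apply; rewrite /rho /c1 /pt; ring.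
have dSB x y : -1 < y -> cder (SB x) y (F (pt x y) * k y - rho x y * k y).
  move=> y1; have := cderD (cderZ c1 (primP ck y1)) (cderZ (D * ex x) (dw y)).
  rewrite -/Kp => /cder_eq; apply.
  have -> : r%:C%C * 'i%C * cis y = k y * w y by rewrite /k divfK.
  by rewrite /rho /c1 /pt; ring.
have EA y : c <= y <= h -> nc ((A y b - A y a) - (SA y b - SA y a)) <= e' * (q * L) * (q * S).
  move=> yc; have -> : q * S = b - a by rewrite /b; ring.
  have -> : (A y b - A y a) - (SA y b - SA y a) = (A y b - SA y b) - (A y a - SA y a) by ring.
  apply: (@mean_value _ (fun x => A y x - SA y x) (fun x => rho x y)) => // x xab; last exact: rhoP.
  have x1 : -1 < x by case/andP: xab => ? ?; rewrite (lt_le_trans _ (le_trans a0 _))// ltrN10.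
  by have := cderB (primP (cFs y) x1) (dSA y x); rewrite opprB addrC subrK.
have EB x : a <= x <= b -> nc ((B x h - B x c) - (SB x h - SB x c)) <= e' * (q * L) * K * (q * m).
  move=> xa; have -> : q * m = h - c by rewrite /h; ring.
  have -> : (B x h - B x c) - (SB x h - SB x c) = (B x h - SB x h) - (B x c - SB x c) by ring.
  apply: (@mean_value _ (fun y => B x y - SB x y) (fun y => rho x y * k y)) => // y ych; last first.
    by rewrite ncM ler_pM ?nc_ge0// ?rhoP.
  have y1 : -1 < y by case/andP: ych => ? ?; rewrite (lt_le_trans _ (le_trans c0 _))// ltrN10.
  by have := cderB (primP (cFt x) y1) (dSB x y y1); rewrite opprB addrC subrK.
have -> : J a b c h = - ((A c b - A c a) - (SA c b - SA c a))
    + ((A h b - A h a) - (SA h b - SA h a)) + ((B b h - B b c) - (SB b h - SB b c))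
    - ((B a h - B a c) - (SB a h - SB a c)).
  by rewrite /J /SA /SB; ring.
rewrite (le_trans (ncB _ _))// (le_trans (lerD (ncD _ _) (lexx _)))//.
rewrite (le_trans (lerD (lerD (ncD _ _) (lexx _)) (lexx _)))// ncN.
have lc : c <= c <= h by rewrite lexx.
have lh : c <= h <= h by rewrite lexx andbT.
have la : a <= a <= b by rewrite lexx.
have lb : a <= b <= b by rewrite lexx andbT.
rewrite (le_trans (lerD (lerD (lerD (EA _ lc) (EA _ lh)) (EB _ lb)) (EB _ la)))//.
have -> : e' * (q * L) * (q * S) + e' * (q * L) * (q * S) + e' * (q * L) * K * (q * m) +
   e' * (q * L) * K * (q * m) = e' * (N - 1) * q ^+ 2 by rewrite /N; ring.
rewrite ler_pM2r ?exprn_gt0// /e' mulrAC -mulrA ler_piMr//; first exact: ltW.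
by rewrite ler_pdivrMr// mul1r gerBl.
Qed.

(** The sides [t = 0] and [t = 2 pi] have the same image and cancel, so the integral over the
    contracted circle does not depend on [S]; for large [S] the values of [F] on it are uniformly
    close to [F lam]. The integral of [k] alone stays unevaluated here. *)
Lemma cauchy_formula : prim (fun t => F (r%:C%C * cis t) * k t) (pi *+ 2)
  - prim (fun t => F (r%:C%C * cis t) * k t) 0 = F lam * (prim k (pi *+ 2) - prim k 0).
Proof.
have pi2 : 0 <= pi *+ 2 :> R by rewrite mulrn_wge0// pi_ge0.
have BS S : 0 <= S -> B S (pi *+ 2) - B S 0 = B 0 (pi *+ 2) - B 0 0.
  move=> S0; have : J 0 (0 + S) 0 (0 + pi *+ 2) = 0.
    apply: bisection => //.
    - by move=> *; rewrite /J; ring.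
    - by move=> *; rewrite /J; ring.
    - by move=> s t e s0 t0 e0; exact: J_local.
  rewrite !add0r /J.
  have -> : A (pi *+ 2) = A 0 by rewrite /A /pt /w cis2pi cis0.
  by rewrite addNr add0r => /eqP; rewrite subr_eq0 => /eqP.
have <- : B 0 = prim (fun t => F (r%:C%C * cis t) * k t).
  rewrite /B; congr prim; apply/funext => t.
  by rewrite /pt oppr0 expR0 mul1r /w addrC subrK.
apply/eqP; rewrite -subr_eq0 -nc_eq0 eq_le nc_ge0 andbT.
apply/ler_addgt0Pr => e e0; rewrite add0r.
have [D dD] := dF lam; have [d d0 Hd] := dD 1 ltr01.
pose K := r / (r - nc lam).
have K0 : 0 < K by rewrite divr_gt0// subr_gt0.
pose e' := e / (K * (pi *+ 2) + 1).
have N0 : 0 < K * (pi *+ 2) + 1 by rewrite ltr_wpDl// mulr_ge0// ltW.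
have e'0 : 0 < e' by rewrite divr_gt0.
(* As [|w t| <= 2 r], the factor [4 r] brings the contracted circle within half the required
   distance of [lam]. *)
pose S := Num.max 0 (- ln (Num.min d (e' / (nc D + 1)) / (4 * r))).
have D1 : 0 < nc D + 1 by rewrite ltr_wpDl ?nc_ge0.
have M0 : 0 < Num.min d (e' / (nc D + 1)) by rewrite lt_min d0 divr_gt0.
have S0 : 0 <= S by rewrite le_max lexx.
have ptS t : nc (pt S t - lam) < Num.min d (e' / (nc D + 1)).
  rewrite /pt addrC addKr ncM ncR_ge0 ?expR_ge0//.
  rewrite (@le_lt_trans _ _ (expR (- S) * (2 * r)))//; first by rewrite ler_wpM2l// expR_ge0.
  have : expR (- S) <= Num.min d (e' / (nc D + 1)) / (4 * r).
    rewrite -[leRHS]lnK ?posrE ?divr_gt0 ?mulr_gt0// ler_expR lerNl le_max lexx orbT//.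
  rewrite ler_pdivlMr ?mulr_gt0// => h; rewrite (lt_le_trans _ h)//.
  by rewrite ltr_pM2l ?expR_gt0// ltr_pM2r//; lra.
have FS t : nc (F (pt S t) - F lam) <= e'.
  have := ptS t; rewrite lt_min => /andP[/Hd h1]; rewrite ltr_pdivlMr// => h2.
  have -> : F (pt S t) - F lam = (F (pt S t) - F lam - D * (pt S t - lam)) + D * (pt S t - lam).
    by rewrite subrK.
  by rewrite (le_trans (ncD _ _))// (le_trans _ (ltW h2))// ncM; lra.
rewrite -(BS _ S0) mulrBr.
have -> : B S (pi *+ 2) - B S 0 - (F lam * prim k (pi *+ 2) - F lam * prim k 0) =
  (B S (pi *+ 2) - F lam * prim k (pi *+ 2)) - (B S 0 - F lam * prim k 0) by ring.
rewrite (@le_trans _ _ (e' * K * (pi *+ 2 - 0)))//; last first.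
  rewrite subr0 -mulrA /e' mulrAC -mulrA ler_piMr//; first exact: ltW.
  by rewrite ler_pdivrMr// mul1r lerDl.
apply: (@mean_value _ (fun t => B S t - F lam * prim k t) (fun t => (F (pt S t) - F lam) * k t)) => // t /andP[t0 _].
  have t1 : -1 < t by rewrite (lt_le_trans _ t0)// ltrN10.
  by have := cderB (primP (cFt S) t1) (cderZ (F lam) (primP ck t1)); rewrite -mulrBl.
by rewrite ncM ler_pM ?nc_ge0.
Qed.

End cauchy.
Lemma geometric_le0 (R : realType) (x C q : R) : 0 <= q < 1 ->
  (forall n, x <= C * q ^+ n) -> x <= 0.
Proof.
move=> /andP[q0 q1] H; apply/ler_addgt0Pr => e e0; rewrite add0r.
have : (fun n => C * q ^+ n) @ \oo --> 0.
  by rewrite -(mulr0 C); apply: cvgM; [exact: cvg_cst|apply: cvg_expr; rewrite ger0_norm].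
move=> /cvg0P/(_ e e0)[n /(_ n (leqnn n)) /ltW h].
by rewrite (le_trans (H n))// (le_trans (ler_norm _)).
Qed.

Definition circ (R : realType) (f : R -> R[i]) := prim f (pi *+ 2) - prim f 0.

Definition cauchy_kernel (R : realType) (r : R) (lam : R[i]) (t : R) : R[i] :=
  r%:C%C * 'i%C * cis t / (r%:C%C * cis t - lam).

(** The integral of [F(z) / z^(n+1) dz] over the circle of radius [r], with [dz = i z dt]; the
    factor [2 pi i] is not yet divided out. *)
Definition cauchy_coef (R : realType) (F : R[i] -> R[i]) (r : R) n :=
  circ (fun t => F (r%:C%C * cis t) * ('i%C * (r%:C%C * cis t) ^- n)).

Section cauchy_coefficients.
Variables (R : realType) (F : R[i] -> R[i]) (r : R).
Hypothesis dF : forall z, exists D, complex_derivative F z D.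
Hypothesis r0 : 0 < r.
Implicit Types lam : R[i].

Let g t := r%:C%C * cis t.
Local Notation k := (cauchy_kernel r).
Local Notation c := (cauchy_coef F r).

Let g0 t : g t != 0.
Proof. by rewrite -nc_eq0 ncM nc_cis mulr1 ncR_ge0 ?gt_eqF// ltW. Qed.

Let ncg t : nc (g t) = r.
Proof. by rewrite ncM nc_cis mulr1 ncR_ge0// ltW. Qed.

Let nci : nc ('i%C : R[i]) = 1.
Proof. by rewrite /= expr0n/= add0r expr1n sqrtr1. Qed.

Let gB lam t : nc lam < r -> g t - lam != 0.
Proof.
by move=> lr; apply: contraTneq lr => /eqP; rewrite subr_eq0 => /eqP <-; rewrite ncg ltxx.
Qed.

(** Iterates [k = i + (lam / g) k]. The exact remainder makes it unnecessary to exchange an infinite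
    sum with an integral. *)
Let k_geometric lam t n : nc lam < r ->
  k lam t = \sum_(j < n) lam ^+ j * ('i%C * (g t) ^- j) + (lam / g t) ^+ n * k lam t.
Proof.
move=> lr; elim: n => [|n IH]; first by rewrite big_ord0 expr0 mul1r add0r.
rewrite big_ord_recr/= {1}IH -addrA; congr (_ + _).
have kE : k lam t = 'i%C + lam / g t * k lam t.
  rewrite /cauchy_kernel -/(g t); have := gB t lr; have := g0 t.
  have -> : r%:C%C * 'i%C * cis t = 'i%C * g t by rewrite /g; ring.
  by move=> ? ?; field; apply/andP.
rewrite {1}kE mulrDr mulrA -exprSr [in LHS]expr_div_n [X in X + _ = _]mulrAC.
by rewrite -[X in X + _ = _]mulrA.
Qed.

Let k_le lam t : nc lam < r -> nc (k lam t) <= r / (r - nc lam).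
Proof.
move=> lr; rewrite /cauchy_kernel ncf !ncM nc_cis nci !mulr1 ncR_ge0; last exact: ltW.
have h : r - nc lam <= nc (g t - lam).
  by have := ncD (g t - lam) lam; rewrite subrK ncg lerBlDr.
by rewrite ler_pM2l// lef_pV2// posrE ?subr_gt0// (lt_le_trans _ h)// subr_gt0.
Qed.

Let dg t : cder g t ('i%C * g t).
Proof.
have := cderZ r%:C%C (cder_cis 1 t); rewrite !mul1r /g mulrCA; congr cder.
by apply/funext => s; rewrite mul1r.
Qed.

Let ccg : ccont g. Proof. exact: cder_ccont dg. Qed.

Let cF : ccont (fun t => F (g t)) := ccont_comp dF ccg.

Let cgV n : ccont (fun t => 'i%C * (g t) ^- n).
Proof.
apply: ccontM; first exact: ccont_cst.
apply: ccontV => [|t]; last by rewrite expf_neq0.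
elim: n => [|n IH]; first by under [X in ccont X]eq_fun do rewrite expr0; exact: ccont_cst.
by under [X in ccont X]eq_fun do rewrite exprS; exact: ccontM.
Qed.

Let ck lam : nc lam < r -> ccont (k lam).
Proof.
move=> lr; apply: ccontM.
  have -> : (fun t => r%:C%C * 'i%C * cis t) = (fun t => 'i%C * g t).
    by apply/funext => t; rewrite /g; ring.
  by apply: ccontM => //; exact: ccont_cst.
apply: ccontV => [|t]; last exact: gB.
apply: (@cder_ccont _ _ (fun t => 'i%C * g t)) => t.
by have := cderB (dg t) (cder_cst lam t); rewrite subr0.
Qed.

Let pi2 : 0 <= pi *+ 2 :> R. Proof. by rewrite mulrn_wge0// pi_ge0. Qed.

Let gtN1 (t : R) : 0 <= t -> -1 < t.
Proof. by apply: lt_le_trans; rewrite ltrN10. Qed.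

Lemma cauchy_coefs : exists2 M : R, 0 < M &
  (forall n, nc (c n) * r ^+ n <= M * (pi *+ 2)) /\
  forall lam, nc lam < r -> forall n,
    nc (F lam * circ (k lam) - \sum_(j < n) lam ^+ j * c j) <=
    M * (r / (r - nc lam)) * (pi *+ 2) * (nc lam / r) ^+ n.
Proof.
have [M M0 HM] := ccont_bounded pi2 cF.
exists M => //; split.
  move=> n; rewrite -ler_pdivlMr ?exprn_gt0// mulrAC.
  rewrite -[X in _ <= _ * X]subr0; apply: (@mean_value _ _ (fun t => F (g t) * ('i%C * (g t) ^- n))) => // t h.
    by apply: primP; [exact: ccontM|case/andP: h => + _; exact: gtN1].
  by rewrite !ncM ncV ncX ncg nci mul1r ler_wpM2r ?HM// invr_ge0 exprn_ge0// ltW.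
move=> lam lr n; rewrite -(cauchy_formula dF lr).
pose P t := prim (fun t => F (g t) * k lam t) t -
  \sum_(j < n) lam ^+ j * prim (fun t => F (g t) * ('i%C * (g t) ^- j)) t.
have -> : prim (fun t : R => F (r%:C%C * cis t) * (r%:C%C * 'i%C * cis t / (r%:C%C * cis t - lam))) (pi *+ 2) -
  prim (fun t : R => F (r%:C%C * cis t) * (r%:C%C * 'i%C * cis t / (r%:C%C * cis t - lam))) 0 -
  \sum_(j < n) lam ^+ j * c j = P (pi *+ 2) - P 0.
  rewrite /P.
  under eq_bigr do rewrite /cauchy_coef /circ mulrBr.
  by rewrite sumrB; rewrite /g /cauchy_kernel; ring.
rewrite -[X in _ <= _ * X * _]subr0 mulrAC.
apply: (@mean_value _ P (fun t => F (g t) * k lam t -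
  \sum_(j < n) lam ^+ j * (F (g t) * ('i%C * (g t) ^- j)))) => // t /[dup] h /andP[/gtN1 t0 _].
  apply: cderB; first by apply: primP => //; apply: ccontM => //; exact: ck.
  apply: (@cder_sum _ (fun j t => lam ^+ j * prim (fun t => F (g t) * ('i%C * (g t) ^- j)) t)
    (fun j t => lam ^+ j * (F (g t) * ('i%C * (g t) ^- j)))) => j; apply: cderZ; apply: primP => //; exact: ccontM.
have -> : F (g t) * k lam t - \sum_(j < n) lam ^+ j * (F (g t) * ('i%C * (g t) ^- j)) =
    F (g t) * ((lam / g t) ^+ n * k lam t).
  rewrite {1}(k_geometric t n lr) mulrDr mulr_sumr addrAC.
  under [X in _ - X]eq_bigr do rewrite mulrCA.
  by rewrite subrr add0r.
rewrite ncM ncM ncX ncf ncg [leRHS]mulrAC -[leRHS]mulrA ler_pM ?mulr_ge0 ?exprn_ge0 ?divr_ge0 ?nc_ge0 ?(ltW r0) ?HM//.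
by rewrite ler_wpM2l ?k_le// exprn_ge0// divr_ge0 ?nc_ge0// ltW.
Qed.

End cauchy_coefficients.

Lemma circ_primitive (R : realType) (f P : R -> R[i]) : ccont f ->
  (forall t, cder P t (f t)) -> circ f = P (pi *+ 2) - P 0.
Proof.
move=> cf dP; apply: (@cder_increment _ _ _ f) => // [|t /andP[t0 _]].
  by rewrite mulrn_wge0// pi_ge0.
by apply: primP => //; apply: lt_le_trans t0; rewrite ltrN10.
Qed.

Lemma cisN (R : realType) (t : R) : cis (- t) = (cis t)^-1.
Proof.
by apply: (mulfI (cis_neq0 t)); rewrite -cisD subrr cis0 divff// cis_neq0.
Qed.

(** For [n > 0] the integrand is a multiple of [e^(-i n t)], which has a [2 pi]-periodic
    primitive. *)
Lemma cauchy_coef1 (R : realType) (r : R) n : 0 < r ->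
  cauchy_coef (fun=> 1) r n = if n == 0%N then (pi *+ 2)%:C%C * 'i%C else 0.
Proof.
move=> r0; rewrite /cauchy_coef.
have gE t : 1 * ('i%C * (r%:C%C * cis t) ^- n) = ('i%C * r%:C%C ^- n) * cis (- n%:R * t).
  by rewrite mul1r exprMn invfM mulrA mulNr cisN mulr_natl cisMn.
rewrite (_ : (fun t => _) = (fun t => ('i%C * r%:C%C ^- n) * cis (- n%:R * t))); last exact/funext.
case: n gE => [|n] gE /=.
  rewrite (_ : (fun t => _) = (fun=> 'i%C)); last first.
    by apply/funext => t; rewrite oppr0 mul0r cis0 expr0 invr1 !mulr1.
  rewrite (@circ_primitive _ _ (fun t => 'i%C * t%:C%C)); first last.
  - by move=> t; have := cderZ 'i%C (cder_id t); rewrite mulr1.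
  - exact: ccont_cst.
  - by rewrite mulr0 subr0 mulrC.
have dc t : cder (fun t => ('i%C * r%:C%C ^- n.+1) * cis (- n.+1%:R * t)) t
  (('i%C * r%:C%C ^- n.+1) * ((- n.+1%:R)%:C%C * 'i%C * cis (- n.+1%:R * t))).
  by apply: cderZ; exact: cder_cis.
rewrite (@circ_primitive _ _ (fun t => (- n.+1%:R)%:C%C^-1 * 'i%C^-1 * (('i%C * r%:C%C ^- n.+1) * cis (- n.+1%:R * t)))).
- have -> : - n.+1%:R * (pi *+ 2) = - ((pi *+ 2) *+ n.+1) :> R by rewrite mulNr mulr_natl.
  by rewrite cisN cisMn cis2pi expr1n mulr0 cis0 invr1 subrr.
- exact: cder_ccont dc.
- move=> t; have := cderZ ((- n.+1%:R)%:C%C^-1 * 'i%C^-1) (dc t).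
  move=> /cder_eq; apply.
  have : (- n.+1%:R)%:C%C != 0 :> R[i] by rewrite -nc_eq0 ncR normr_eq0 oppr_eq0 pnatr_eq0.
  have : 'i%C != 0 :> R[i] by rewrite -nc_eq0 /= expr0n/= add0r expr1n sqrtr1 oner_neq0.
  have : r%:C%C != 0 :> R[i] by rewrite -nc_eq0 ncR normr_eq0 gt_eqF.
  set x := r%:C%C; set y := (- _)%:C%C; set i := 'i%C => x0 i0 y0.
  have := expf_neq0 n.+1 x0; set X := x ^+ n.+1 => X0; set w := cis _.
  by field; rewrite X0 i0 -(natrD _ 1) pnatr_eq0.
Qed.

(** The expansion is applied to the constant function 1: only its zeroth coefficient survives and
    the error decays geometrically, so no winding number has to be computed. *)
Lemma cauchy_kernel_integral (R : realType) (r : R) (lam : R[i]) : nc lam < r ->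
  circ (cauchy_kernel r lam) = (pi *+ 2)%:C%C * 'i%C.
Proof.
move=> lr; have r0 : 0 < r by exact: le_lt_trans (nc_ge0 _) lr.
have dF (z : R[i]) : exists D, complex_derivative (fun=> 1 : R[i]) z D.
  exists 0 => e e0; exists 1 => // w _.
  by rewrite subrr mul0r subr0 nc0 mulr_ge0 ?nc_ge0 ?ltW.
have [M M0 [_ /(_ lam lr) H]] := cauchy_coefs dF r0.
apply/eqP; rewrite -subr_eq0 -nc_eq0 eq_le nc_ge0 andbT.
apply: (@geometric_le0 _ _ (M * (r / (r - nc lam)) * (pi *+ 2) * (nc lam / r)) (nc lam / r)).
  by rewrite divr_ge0 ?nc_ge0 ?(ltW r0)//= ltr_pdivrMr// mul1r.
move=> n; rewrite -mulrA -exprS; have := H n.+1; rewrite mul1r big_ord_recl expr0 mul1r.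
rewrite cauchy_coef1// eqxx big1 ?addr0// => i _.
by rewrite cauchy_coef1//= mulr0.
Qed.

Lemma entire_local_expansion (R : realType) (F : R[i] -> R[i]) (r : R) :
  (forall z, exists D, complex_derivative F z D) -> 0 < r ->
  exists (a : nat -> R[i]) (M : R), [/\ 0 < M, forall n, nc (a n) * r ^+ n <= M &
   forall z, nc z < r -> forall n,
     nc (F z - psum a z n) <= M * (r / (r - nc z)) * (nc z / r) ^+ n].
Proof.
move=> dF r0; have [M M0 [H1 H2]] := cauchy_coefs dF r0.
set P : R[i] := (pi *+ 2)%:C%C * 'i%C.
have pi0 : 0 < pi *+ 2 :> R by rewrite mulrn_wgt0// pi_gt0.
have ncP : nc P = pi *+ 2.
  by rewrite ncM ncR_ge0 ?ltW// [nc 'i%C]/= expr0n/= add0r expr1n sqrtr1 mulr1.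
have P0 : P != 0 by rewrite -nc_eq0 ncP gt_eqF.
exists (fun n => cauchy_coef F r n / P), M; split=> // [n|z zr n].
  by rewrite ncf ncP mulrAC ler_pdivrMr.
have := H2 z zr n; rewrite cauchy_kernel_integral// -/P.
have -> : F z * P - \sum_(j < n) z ^+ j * cauchy_coef F r j =
    P * (F z - psum (fun n => cauchy_coef F r n / P) z n).
  rewrite mulrBr mulrC; congr (_ - _); rewrite /psum mulr_sumr; apply: eq_bigr => j _.
  by rewrite mulrA mulrCA divff// mulr1 mulrC.
rewrite ncM ncP mulrAC [leRHS]mulrC.
by rewrite ler_pM2l.
Qed.
(** By strong induction the two partial sums of length [m + 1] differ by [(a_m - b_m) z^m], while
    both are within [O(z^(m+1))] of [F]; divide by [x^m] and let [x] tend to 0. *)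
Lemma local_expansion_unique (R : realType) (F : R[i] -> R[i]) (a b : nat -> R[i]) (r s M N : R) :
  0 < r -> 0 < s -> 0 < M -> 0 < N ->
  (forall z, nc z < r -> forall n,
     nc (F z - psum a z n) <= M * (r / (r - nc z)) * (nc z / r) ^+ n) ->
  (forall z, nc z < s -> forall n,
     nc (F z - psum b z n) <= N * (s / (s - nc z)) * (nc z / s) ^+ n) -> a =1 b.
Proof.
move=> r0 s0 M0 N0 Fa Fb.
have half (u : R) z : 0 < u -> nc z <= u / 2 -> u / (u - nc z) <= 2.
  by move=> u0 zu; rewrite ler_pdivrMr ?subr_gt0; lra.
pose rho := Num.min (r / 2) (s / 2).
have rho0 : 0 < rho by rewrite lt_min !divr_gt0.
elim/ltn_ind => m IH.
have psE z : psum a z m.+1 - psum b z m.+1 = (a m - b m) * z ^+ m.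
  rewrite /psum !big_ord_recr/= opprD addrACA -mulrBl -sumrB big1 ?add0r// => i _.
  by rewrite IH// subrr.
pose C := M * 2 / r ^+ m.+1 + N * 2 / s ^+ m.+1.
have C0 : 0 < C by rewrite addr_gt0// divr_gt0 ?mulr_gt0// exprn_gt0.
have small x : 0 < x <= rho -> nc (a m - b m) <= C * x.
  move=> /andP[x0]; rewrite le_min => /andP[xr xs].
  have ncx : nc x%:C%C = x by rewrite ncR_ge0// ltW.
  have xr' : nc x%:C%C < r by rewrite ncx; lra.
  have xs' : nc x%:C%C < s by rewrite ncx; lra.
  rewrite -(ler_pM2r (exprn_gt0 m x0)) -{1}ncx -ncX -ncM -psE.
  have -> : psum a x%:C%C m.+1 - psum b x%:C%C m.+1 =
     (F x%:C%C - psum b x%:C%C m.+1) - (F x%:C%C - psum a x%:C%C m.+1) by ring.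
  rewrite (le_trans (ncB _ _))// (le_trans (lerD (Fb _ xs' m.+1) (Fa _ xr' m.+1)))// addrC.
  have -> : C * x * x ^+ m = C * x ^+ m.+1 by rewrite exprS mulrA.
  rewrite /C mulrDl ncx !expr_div_n.
  have term (u U : R) : 0 < u -> 0 < U -> x <= u / 2 ->
      U * (u / (u - x)) * (x ^+ m.+1 / u ^+ m.+1) <= U * 2 / u ^+ m.+1 * x ^+ m.+1.
    move=> u0 U0 xu; rewrite [leLHS]mulrA [leLHS]mulrAC ler_pM2r ?exprn_gt0//.
    by rewrite ler_pM2r ?invr_gt0 ?exprn_gt0// ler_pM2l// -ncx half// ncx.
  by apply: lerD; apply: term.
apply/eqP; rewrite -subr_eq0 -nc_eq0 eq_le nc_ge0 andbT.
apply/ler_addgt0Pr => e e0; rewrite add0r.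
have m0 : 0 < Num.min rho (e / C) <= rho by rewrite lt_min rho0 divr_gt0//= ge_min lexx.
rewrite (le_trans (small _ m0))// mulrC -ler_pdivlMr// ge_min lexx orbT//.
Qed.

(** The coefficients obtained on the unit circle serve every radius, by uniqueness. *)
Lemma complex_derivative_expansion (R : realType) (F : R[i] -> R[i]) :
  (forall z, exists D, complex_derivative F z D) -> exists a, expansion a F.
Proof.
move=> dF; have [a [M [M0 aM Fa]]] := entire_local_expansion dF ltr01.
have aE r : 0 < r -> exists M : R, [/\ 0 < M, forall n, nc (a n) * r ^+ n <= M &
   forall z, nc z < r -> forall n,
     nc (F z - psum a z n) <= M * (r / (r - nc z)) * (nc z / r) ^+ n].
  move=> r0; have [b [N [N0 bN Fb]]] := entire_local_expansion dF r0.
  have /funext -> := local_expansion_unique ltr01 r0 M0 N0 Fa Fb.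
  by exists N.
exists a; split.
  move=> r; have r10 : 0 < `|r| + 1 by rewrite ltr_wpDl.
  have [N [N0 aN _]] := aE _ r10; exists N => k; rewrite (le_trans _ (aN k))//.
  rewrite ler_wpM2l ?nc_ge0// (le_trans (ler_norm _))// normrX.
  by rewrite lerXn2r ?nnegrE ?normr_ge0// ?(ltW r10)// lerDl.
move=> z; have r0 : 0 < nc z + 1 by rewrite ltr_wpDl ?nc_ge0.
have zr : nc z < nc z + 1 by rewrite ltrDl.
have [N [N0 _ FN]] := aE _ r0.
set C := N * ((nc z + 1) / (nc z + 1 - nc z)) in FN *.
have qC : (fun n => C * (nc z / (nc z + 1)) ^+ n) @ \oo --> 0.
  rewrite -(mulr0 C); apply: cvgM; first exact: cvg_cst.
  apply: cvg_expr; rewrite ger0_norm ?divr_ge0 ?nc_ge0 ?(ltW r0)//.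
  by rewrite ltr_pdivrMr// mul1r.
apply: (squeeze_cvgr _ (cvg_cst 0) qC); near=> n.
by rewrite nc_ge0 /=; exact: FN.
Unshelve. all: by end_near. Qed.

Lemma entire_expansion (R : realType) (F : R[i]^o -> R[i]^o) :
  entire F -> exists a, expansion a F.
Proof.
move=> eF; apply: complex_derivative_expansion => z.
by exists (F^`()%classic z); exact: derivable_complex_derivative.
Qed.

(** * Backward shift *)

Section backward_shift.
Variable R : realType.
Implicit Types (a : nat -> R[i]) (F : R[i]^o -> R[i]^o).

(** Needed because [backward_shift] is defined at 0 through the derivative: both [D x] and [a_1 x]
    approximate [F x - F 0] up to [o(x)]. *)
Lemma expansion_derive0 a F : entire F -> expansion a F -> F^`()%classic 0 = a 1%N.
Proof.
move=> eF aF; have dF := derivable_complex_derivative (eF 0).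
set D := F^`()%classic 0 in dF *.
have [C C0 HC] := expansion_coef 2 aF.
apply/eqP; rewrite -subr_eq0 -nc_eq0 eq_le nc_ge0 andbT.
apply/ler_addgt0Pr => e e0; rewrite add0r.
have e20 : 0 < e / 2 by lra.
have [d d0 Hd] := dF _ e20.
(* Chosen so that the remainder [2 C x^2] of the series is at most [e x / 2]. *)
have [x x0 [xd x1 xe]] : exists2 x, 0 < x & [/\ x <= d / 2, x <= 1 & x * (4 * C) <= e].
  exists (Num.min (d / 2) (Num.min 1 (e / (4 * C)))).
    by rewrite !lt_min ltr01 !divr_gt0// mulr_gt0.
  split; rewrite -?ler_pdivlMr ?mulr_gt0//; last by rewrite !ge_min lexx !orbT.
    by rewrite ge_min lexx.
  by rewrite !ge_min lexx orbT.
have ncx : nc x%:C%C = x by rewrite ncR_ge0// ltW.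
rewrite -(ler_pM2r x0) -{1}ncx -ncM.
have -> : (D - a 1%N) * x%:C%C =
   (F x%:C%C - psum a x%:C%C 2) - (F x%:C%C - F 0 - D * (x%:C%C - 0)) :> R[i].
  rewrite /psum !big_ord_recr big_ord0/= expr0 expr1 mulr1 add0r (expansion_at0 aF); ring.
rewrite (le_trans (ncB _ _))//.
have h1 := Hd x%:C%C; rewrite subr0 ncx in h1; have {}h1 : nc (F x%:C%C - F 0 - D * x%:C%C) <= e / 2 * x by apply: h1; lra.
have h2 := @expansion_tail _ a F 2 C x%:C%C 2 aF.
rewrite ncx in h2.
have {}h2 : nc (F x%:C%C - psum a x%:C%C 2) <= C * x ^+ 2 * (2 / (2 - x)).
  apply: h2; first lra.
  by move=> k; rewrite (le_trans _ (HC (2 + k)%N))// ler_wpM2l ?nc_ge0// ler_eXn2l ?ltr1n ?leq_addl.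
rewrite subr0 (le_trans (lerD h2 h1))//.
have h3 : 2 / (2 - x) <= 2 by rewrite ler_pdivrMr; lra.
have h4 : C * x ^+ 2 * (2 / (2 - x)) <= C * x ^+ 2 * 2 by rewrite ler_pM2l// mulr_gt0// exprn_gt0.
rewrite (le_trans (lerD h4 (lexx _)))//.
have : x * (x * (4 * C)) <= x * e by rewrite ler_pM2l.
lra.
Qed.

Lemma backward_shiftM F z : backward_shift F z * z = F z - F 0 :> R[i].
Proof.
rewrite /backward_shift; case: eqVneq => [->|z0]; first by rewrite mulr0 subrr.
by rewrite divfK.
Qed.

Lemma expansion_backward_shift a F : entire F -> expansion a F ->
  expansion (coef_shift 1 a) (backward_shift F).
Proof.
move=> eF aF; split.
  move=> r; have [C C0 HC] := expansion_coef (`|r| + 1) aF; exists C => k.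
  have r1 : 1 <= `|r| + 1 by rewrite lerDr.
  rewrite /coef_shift (le_trans _ (HC (1 + k)%N))// ler_wpM2l ?nc_ge0//.
  rewrite (le_trans (ler_norm _))// normrX (@le_trans _ _ ((`|r| + 1) ^+ k))//.
    by rewrite lerXn2r ?nnegrE ?normr_ge0 ?addr_ge0// lerDl.
  by rewrite ler_weXn2l// leq_addl.
move=> z; have [->|z0] := eqVneq z 0.
  apply/cvg0P => e e0; exists 1%N => -[//|n] _.
  rewrite /backward_shift eqxx (expansion_derive0 eF aF) /psum big_ord_recl/= expr0 mulr1.
  rewrite big1 => [|i _]; last by rewrite expr0n/= mulr0.
  by rewrite addr0 subrr nc0 normr0.
have -> : (fun n => nc (backward_shift F z - psum (coef_shift 1 a) z n)) =
    (fun n => nc (F z - psum a z n.+1) / nc z).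
  apply/funext => n; rewrite -ncf; congr nc; apply: (mulIf z0).
  rewrite divfK// mulrBl backward_shiftM psum_shift (expansion_at0 aF).
  by rewrite opprD addrA [z * _]mulrC.
rewrite -(mul0r (nc z)^-1); apply: cvgM; last exact: cvg_cst.
have [_ /(_ z)] := aF.
by rewrite -(cvg_shiftS (fun n => nc (F z - psum a z n))).
Qed.

Lemma expansion_iter a F n : (forall k, entire (iter k (@backward_shift R) F)) ->
  expansion a F -> expansion (coef_shift n a) (iter n (@backward_shift R) F).
Proof.
move=> eF aF; elim: n => [|n IH].
  by rewrite (_ : coef_shift 0 a = a).
have := expansion_backward_shift (eF n) IH; rewrite iterS; congr expansion.
by apply/funext => k; rewrite /coef_shift addnA addn1.
Qed.

Lemma iter_backward_shiftM a F n z : (forall k, entire (iter k (@backward_shift R) F)) ->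
  expansion a F -> iter n (@backward_shift R) F z * z ^+ n = F z - psum a z n :> R[i].
Proof.
move=> eF aF; elim: n => [|n IH]; first by rewrite expr0 mulr1 /psum big_ord0 subr0.
rewrite iterS exprS mulrA backward_shiftM mulrBl IH.
rewrite (expansion_at0 (expansion_iter n eF aF)) /coef_shift addn0.
by rewrite /psum big_ord_recr/= opprD addrA.
Qed.

End backward_shift.
(** * Rotation invariance of planar measure *)

Section rotation_invariance.
Variable R : realType.
Local Notation rT := (measurableTypeR R).
Local Notation leb := (@lebesgue_measure R).

(** The translated measure has the same values on half-open intervals, which determine Lebesgue
    measure. *)
Lemma lebesgue_translation (t : R) (A : set rT) : measurable A ->
  leb ((fun x => x + t) @^-1` A) = leb A.
Proof.
move=> mA.
have mt : measurable_fun [set: rT] (fun x : rT => x + t : rT) by exact: measurable_funD.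
pose phi : {mfun rT >-> rT} := HB.pack (fun x : rT => x + t : rT) (isMeasurableFun.Build _ _ _ _ _ mt).
rewrite (@lebesgue_measure_unique R (pushforward leb phi) _ _ mA)//.
move=> X [[a b] _ <-] /=; rewrite /pushforward/=.
have -> : (fun x : rT => x + t) @^-1` `]a, b] = `](a - t), (b - t)]%classic.
  by apply/seteqP; split => x /=; rewrite !in_itv/= ltrBlDr lerBrDr.
rewrite !lebesgue_measure_itv/= !lte_fin ltrD2r; case: ifP => // _.
by rewrite !EFinN -!EFinD opprB; congr EFin; ring.
Qed.

Definition shear2 (t : R) (p : rT * rT) : rT * rT := (p.1, p.2 + t * p.1).
Definition shear1 (t : R) (p : rT * rT) : rT * rT := (p.1 + t * p.2, p.2).

Lemma measurable_shear2 t : measurable_fun setT (shear2 t).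
Proof.
apply: measurable_fun_pair => //=; apply: measurable_funD => //.
exact: measurable_funM.
Qed.

Lemma measurable_shear1 t : measurable_fun setT (shear1 t).
Proof.
apply: measurable_fun_pair => //=; apply: measurable_funD => //.
exact: measurable_funM.
Qed.

(** Each vertical slice is merely translated. *)
Lemma borel_m2_shear2 t (A : set (rT * rT)) : measurable A ->
  borel_m2 R (shear2 t @^-1` A) = borel_m2 R A.
Proof.
move=> mA; rewrite /borel_m2 /= /product_measure1; apply: eq_integral => x _ /=.
rewrite -(@lebesgue_translation (t * x) (xsection A x)); last exact: measurable_xsection.
congr leb; apply/seteqP; split => y /=; by rewrite /xsection/= !inE.
Qed.

Lemma borel_m2E (A : set (rT * rT)) : measurable A ->
  borel_m2 R A = (leb \x^ leb)%E A.
Proof.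
by move=> mA; apply: product_measure_unique => //= B C mB mC; rewrite product_measure2E.
Qed.

(** Here the horizontal slices are translated, hence the product measure is taken in the other order
    of integration. *)
Lemma borel_m2_shear1 t (A : set (rT * rT)) : measurable A ->
  borel_m2 R (shear1 t @^-1` A) = borel_m2 R A.
Proof.
move=> mA; rewrite !borel_m2E//; last first.
  by rewrite -[X in measurable X]setTI; exact: measurable_shear1.
rewrite /product_measure2; apply: eq_integral => y _ /=.
rewrite -(@lebesgue_translation (t * y) (ysection A y)); last exact: measurable_ysection.
congr leb; apply/seteqP; split => x /=; by rewrite /ysection/= !inE.
Qed.

Definition borel_preserving (f : R * R -> R * R) :=
  measurable_fun [set: rT * rT] (f : rT * rT -> rT * rT) /\
  forall A : set (rT * rT), measurable A -> borel_m2 R (f @^-1` A) = borel_m2 R A.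

Lemma borel_preserving_comp f g :
  borel_preserving f -> borel_preserving g -> borel_preserving (f \o g).
Proof.
move=> [mf fA] [mg gA]; split; first exact: measurableT_comp.
move=> A mA; rewrite comp_preimage gA ?fA//.
by rewrite -[X in measurable X]setTI; exact: mf.
Qed.

Definition rotation (c s : R) (p : R * R) : R * R :=
  (c * p.1 - s * p.2, s * p.1 + c * p.2).

Lemma rotationM c s c' s' : rotation c s \o rotation c' s' =
  rotation (c * c' - s * s') (s * c' + c * s').
Proof. by apply/funext => -[x y]; rewrite /rotation/=; congr pair; ring. Qed.

(* A rotation by an angle t, not an odd multiple of pi, is a product of three shears with
   parameters - tan (t / 2), sin t and - tan (t / 2). *)
Lemma borel_preserving_rotation_neqN1 c s : c ^+ 2 + s ^+ 2 = 1 -> c != -1 ->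
  borel_preserving (rotation c s).
Proof.
move=> cs1 cN1; have c10 : 1 + c != 0 by rewrite addrC addr_eq0.
have -> : rotation c s = shear1 (- s / (1 + c)) \o shear2 s \o shear1 (- s / (1 + c)).
  apply/funext => -[x y]; rewrite /rotation /shear1 /shear2/=.
  have s2 : s ^+ 2 = (1 - c) * (1 + c) by have := cs1; lra.
  have sE : s * (s / (1 + c)) = 1 - c by rewrite mulrA -expr2 s2 mulfK.
  congr pair.
    rewrite -[LHS]addr0.
    transitivity (x * (1 - s * (s / (1 + c))) - s / (1 + c) * y * (2 - s * (s / (1 + c)))); last by ring.
    rewrite sE; transitivity (c * x - s / (1 + c) * (1 + c) * y); first by rewrite divfK// addr0.
    ring.
  transitivity (s * x + y * (1 - s * (s / (1 + c)))); last by ring.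
  by rewrite sE; ring.
have S1 t : borel_preserving (shear1 t).
  by split; [exact: measurable_shear1|move=> A; exact: borel_m2_shear1].
have S2 t : borel_preserving (shear2 t).
  by split; [exact: measurable_shear2|move=> A; exact: borel_m2_shear2].
exact: (borel_preserving_comp (borel_preserving_comp (S1 _) (S2 _)) (S1 _)).
Qed.

(** The half turn, excluded from the decomposition into shears, is the square of a quarter turn. *)
Lemma borel_preserving_rotation c s : c ^+ 2 + s ^+ 2 = 1 -> borel_preserving (rotation c s).
Proof.
move=> cs1; have [c1|] := eqVneq c (-1); last exact: borel_preserving_rotation_neqN1.
have s0 : s = 0.
  by apply/eqP; rewrite -sqrf_eq0; apply/eqP; move: cs1; rewrite c1; lra.
have i1 : (0 : R) ^+ 2 + 1 ^+ 2 = 1 by rewrite expr0n expr1n add0r.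
have iN1 : (0 : R) != -1 by rewrite eq_sym oppr_eq0 oner_neq0.
have H := borel_preserving_rotation_neqN1 i1 iN1.
have := borel_preserving_comp H H; rewrite rotationM c1 s0.
by rewrite !mul0r mulr0 mulr1 sub0r addr0.
Qed.

Definition plane_rotation (c s : R) : plane R -> plane R := rotation c s.

Lemma rotationK c s : c ^+ 2 + s ^+ 2 = 1 -> cancel (rotation c s) (rotation c (- s)).
Proof.
move=> cs1 p; have /(congr1 (fun f => f p)) /= -> := rotationM c (- s) c s.
have -> : c * c - - s * s = 1 by rewrite -cs1; ring.
have -> : - s * c + c * s = 0 by ring.
by case: p => x y; rewrite /rotation /= !mul1r !mul0r subr0 add0r.
Qed.

(** A Borel cover of [X] pulls back to a Borel cover of the preimage, set by set with the same
    measure. *)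
Lemma le_mu_ext_preimage f (X : set (R * R)) : borel_preserving f ->
  ((mu_ext (borel_m2 R)) (f @^-1` X) <= (mu_ext (borel_m2 R)) X)%E.
Proof.
move=> [mf fA]; apply: le_ereal_inf_tmp => _ [A [mA XA] <-].
apply: ereal_inf_lbound; exists (fun k => f @^-1` A k).
  split=> [i|p /= /XA[k _ Ak]]; last by exists k.
  by rewrite -[X in measurable X]setTI; exact: mf.
by apply: eq_eseriesr => k _; exact: fA.
Qed.

Lemma mu_ext_rotation c s (X : set (R * R)) : c ^+ 2 + s ^+ 2 = 1 ->
  (mu_ext (borel_m2 R)) (rotation c s @^-1` X) = (mu_ext (borel_m2 R)) X.
Proof.
move=> cs1; have cs1' : c ^+ 2 + (- s) ^+ 2 = 1 by rewrite sqrrN.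
apply/eqP; rewrite eq_le le_mu_ext_preimage; last exact: borel_preserving_rotation.
rewrite -{1}[X](_ : rotation c (- s) @^-1` (rotation c s @^-1` X) = X).
  by rewrite le_mu_ext_preimage//; exact: borel_preserving_rotation.
by apply/seteqP; split => p /=; have := rotationK cs1' p; rewrite opprK => ->.
Qed.

(** The Caratheodory criterion for the preimage reduces to that for [A] by rotating the test set.
    Borel measurability of the map would not suffice, since the sigma-algebra is that of the
    Lebesgue measurable sets. *)
Lemma measurable_plane_rotation c s : c ^+ 2 + s ^+ 2 = 1 ->
  measurable_fun [set: plane R] (plane_rotation c s).
Proof.
move=> cs1 _ A mA; rewrite setTI.
have mA' : caratheodory_measurable (mu_ext (borel_m2 R)) A := mA.
suff H : caratheodory_measurable (mu_ext (borel_m2 R)) (rotation c s @^-1` A) by exact: H.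
move=> X.
have cs1' : c ^+ 2 + (- s) ^+ 2 = 1 by rewrite sqrrN.
have rK : rotation c (- s) @^-1` (rotation c s @^-1` A) = A.
  by apply/seteqP; split => p /=; have := rotationK cs1' p; rewrite opprK => ->.
rewrite -(mu_ext_rotation X cs1') (mA' (rotation c (- s) @^-1` X)).
rewrite -(mu_ext_rotation (X `&` _) cs1') -(mu_ext_rotation (X `&` ~` _) cs1').
have -> : rotation c (- s) @^-1` (X `&` rotation c s @^-1` A) = rotation c (- s) @^-1` X `&` A.
  by rewrite -[in RHS]rK.
have -> : rotation c (- s) @^-1` (X `&` ~` (rotation c s @^-1` A)) =
    rotation c (- s) @^-1` X `&` ~` A by rewrite -[in RHS]rK.
by [].
Qed.

Lemma m2_rotation c s (A : set (plane R)) : c ^+ 2 + s ^+ 2 = 1 ->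
  m2 R (plane_rotation c s @^-1` A) = m2 R A.
Proof. by move=> cs1; exact: (@mu_ext_rotation c s A cs1). Qed.

Lemma integral_rotation c s (f : plane R -> \bar R) : c ^+ 2 + s ^+ 2 = 1 ->
  measurable_fun setT f -> (forall p, 0 <= f p)%E ->
  (\int[m2 R]_p f (plane_rotation c s p) = \int[m2 R]_p f p)%E.
Proof.
move=> cs1 mf f0; have mr := measurable_plane_rotation cs1.
rewrite -[LHS](@ge0_integral_pushforward _ _ _ _ _ _ mr (m2 R) setT f)//.
apply: eq_measure_integral => A mA _; exact: m2_rotation.
Qed.

End rotation_invariance.

Lemma of_plane_rotation (R : realType) (w : R[i]) (p : plane R) :
  of_plane (plane_rotation (complex.Re w) (complex.Im w) p) = w * of_plane p.
Proof.
apply/eqP; rewrite eq_complex; apply/andP; rewrite Re_mul Im_mul /=.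
by split; apply/eqP; ring.
Qed.

Lemma integral_rotate (R : realType) (w : R[i]) (f : R[i] -> \bar R) : nc w = 1 ->
  measurable_fun [set: plane R] (fun p => f (of_plane p)) -> (forall z, 0 <= f z)%E ->
  (\int[m2 R]_p f (w * of_plane p)%R = \int[m2 R]_p f (of_plane p))%E.
Proof.
move=> w1 mf f0.
have cs1 : complex.Re w ^+ 2 + complex.Im w ^+ 2 = 1 by rewrite -sqr_nc w1 expr1n.
rewrite -(integral_rotation cs1 mf) => [|p]; last exact: f0.
by apply: eq_integral => p _; rewrite -of_plane_rotation.
Qed.
(** * Weighted means *)

Section limn_einf_bounds.
Variable R : realType.
Implicit Types (u : nat -> \bar R) (a : \bar R).
Local Open Scope ereal_scope.

Lemma limn_einf_ge u a : (\forall n \near \oo, a <= u n) -> a <= limn_einf u.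
Proof.
move=> [N _ HN]; rewrite limn_einf_lim; apply: lime_ge; first exact: is_cvg_einfs.
exists N => // m /= Nm; apply: le_ereal_inf_tmp => _ [n /= mn <-].
by apply: HN => /=; exact: leq_trans mn.
Qed.

Lemma limn_einf_le u a : (\forall n \near \oo, u n <= a) -> limn_einf u <= a.
Proof.
move=> [N _ HN]; rewrite limn_einf_lim; apply: lime_le; first exact: is_cvg_einfs.
apply: nearW => m; apply: (@le_trans _ _ (u (maxn m N))).
  by apply: ereal_inf_lbound; exists (maxn m N) => //=; exact: leq_maxl.
by apply: HN => /=; exact: leq_maxr.
Qed.

End limn_einf_bounds.

Section plane_integral.
Variable R : realType.
Implicit Types (f g h : R[i] -> R) (z : R[i]).

Definition meas h := measurable_fun [set: plane R] (fun xy => h (of_plane xy)).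

Definition plane_int h : \bar R := (\int[m2 R]_xy (h (of_plane xy))%:E)%E.

Lemma meas_cst (c : R) : meas (fun=> c). Proof. exact: measurable_cst. Qed.

Lemma measD f g : meas f -> meas g -> meas (fun z => f z + g z).
Proof. exact: measurable_funD. Qed.

Lemma measM f g : meas f -> meas g -> meas (fun z => f z * g z).
Proof. exact: measurable_funM. Qed.

Lemma measB f g : meas f -> meas g -> meas (fun z => f z - g z).
Proof. exact: measurable_funB. Qed.

Lemma meas_powR f r : meas f -> meas (fun z => f z `^ r).
Proof. by move=> mf; apply: measurableT_comp (@measurable_powR R r) mf. Qed.

Lemma meas_EFin f : meas f -> measurable_fun [set: plane R] (fun xy => (f (of_plane xy))%:E).
Proof. by move=> mf; apply/measurable_EFinP. Qed.

Lemma meas_sum (I : Type) (s : seq I) (f : I -> R[i] -> R) : (forall i, meas (f i)) ->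
  meas (fun z => \sum_(i <- s) f i z).
Proof.
move=> mf; elim: s => [|i s IH].
  have -> : (fun z => \sum_(i <- [::]) f i z) = (fun=> 0) by apply/funext => z; rewrite big_nil.
  exact: meas_cst.
have -> : (fun z => \sum_(j <- i :: s) f j z) = (fun z => f i z + \sum_(j <- s) f j z).
  by apply/funext => z; rewrite big_cons.
exact: measD.
Qed.

Lemma meas_cvg (f : nat -> R[i] -> R) g : (forall n, meas (f n)) ->
  (forall z, f n z @[n --> \oo] --> g z) -> meas g.
Proof.
move=> mf fg; apply: (@measurable_fun_cvg _ (plane R) R setT (fun n xy => f n (of_plane xy))) => [n|x _].
  exact: mf.
exact: fg.
Qed.

Lemma plane_int_ge0 f : (forall z, 0 <= f z) -> (0 <= plane_int f)%E.
Proof. by move=> f0; apply: integral_ge0 => x _; rewrite lee_fin. Qed.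

Lemma le_plane_int f g : meas f -> meas g -> (forall z, 0 <= f z <= g z) ->
  (plane_int f <= plane_int g)%E.
Proof.
move=> mf mg fg; apply: (ge0_le_integral _ measurableT _ (meas_EFin mf) (meas_EFin mg)).
- by move=> x _; rewrite lee_fin; case/andP: (fg (of_plane x)).
- by move=> x _; rewrite lee_fin; case/andP: (fg (of_plane x)).
Qed.

Lemma plane_intZ (c : R) f : 0 <= c -> (forall z, 0 <= f z) -> meas f ->
  plane_int (fun z => c * f z) = (c%:E * plane_int f)%E.
Proof.
move=> c0 f0 mf; have F0 (x : plane R) : setT x -> (0 <= (f (of_plane x))%:E)%E.
  by move=> _; rewrite lee_fin.
rewrite /plane_int -(ge0_integralZl_EFin (m2 R) measurableT F0 (meas_EFin mf) c0).
by apply: eq_integral => x _; rewrite EFinM.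
Qed.

Lemma plane_intD f g : (forall z, 0 <= f z) -> (forall z, 0 <= g z) -> meas f -> meas g ->
  plane_int (fun z => f z + g z) = (plane_int f + plane_int g)%E.
Proof.
move=> f0 g0 mf mg; have F0 (x : plane R) : setT x -> (0 <= (f (of_plane x))%:E)%E.
  by move=> _; rewrite lee_fin.
have G0 (x : plane R) : setT x -> (0 <= (g (of_plane x))%:E)%E.
  by move=> _; rewrite lee_fin.
rewrite /plane_int -(ge0_integralD (m2 R) measurableT F0 (meas_EFin mf) G0 (meas_EFin mg)).
by apply: eq_integral => x _; rewrite EFinD.
Qed.

Lemma plane_int_sum (I : Type) (s : seq I) (f : I -> R[i] -> R) :
  (forall i z, 0 <= f i z) -> (forall i, meas (f i)) ->
  plane_int (fun z => \sum_(i <- s) f i z) = (\sum_(i <- s) plane_int (f i))%E.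
Proof.
move=> f0 mf; elim: s => [|i s IH].
  rewrite big_nil /plane_int; under eq_integral do rewrite big_nil.
  exact: integral0.
rewrite big_cons -IH -plane_intD//; last 2 first.
- by move=> z; rewrite sumr_ge0.
- exact: meas_sum.
by apply: eq_integral => x _; rewrite big_cons.
Qed.

Lemma plane_int_rotate (w : R[i]) f : nc w = 1 -> meas f -> (forall z, 0 <= f z) ->
  plane_int (fun z => f (w * z)) = plane_int f.
Proof.
move=> w1 mf f0; apply: (@integral_rotate _ w (fun z => (f z)%:E) w1 (meas_EFin mf)) => z.
by rewrite lee_fin.
Qed.

Lemma meas_rotate (w : R[i]) f : nc w = 1 -> meas f -> meas (fun z => f (w * z)).
Proof.
move=> w1 mf.
have cs1 : complex.Re w ^+ 2 + complex.Im w ^+ 2 = 1 by rewrite -sqr_nc w1 expr1n.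
have := measurableT_comp mf (measurable_plane_rotation cs1).
by rewrite /meas; congr measurable_fun; apply/funext => x; rewrite /= of_plane_rotation.
Qed.

(* The minorants v need not be measurable. *)
Lemma plane_int_fatou (f : nat -> R[i] -> R) g (B : \bar R) :
  (forall n, meas (f n)) -> (forall n z, 0 <= f n z) -> meas g -> (forall z, 0 <= g z) ->
  (forall z, exists2 v : nat -> R, v @ \oo --> g z & \forall n \near \oo, v n <= f n z) ->
  (\forall n \near \oo, (plane_int (f n) <= B)%E) -> (plane_int g <= B)%E.
Proof.
move=> mf f0 mg g0 gf fB.
have F0 n (x : plane R) : setT x -> (0 <= (f n (of_plane x))%:E)%E.
  by move=> _; rewrite lee_fin.
have := fatou (m2 R) measurableT (fun n => meas_EFin (mf n)) F0.
set L := (X in (X <= _)%E) => H.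
have gL : (plane_int g <= L)%E.
  apply: (ge0_le_integral _ measurableT _ (meas_EFin mg)).
  - by move=> x _; rewrite lee_fin.
  - have mN n : measurable_fun [set: plane R] (fun x => - (f n (of_plane x))%:E)%E.
      refine (measurableT_comp (@oppe_measurable R setT) (meas_EFin (mf n))).
    have mL := measurable_fun_limn_esup mN.
    have := measurableT_comp (@oppe_measurable R setT) mL; exact.
  - move=> x _; have [v vg vf] := gf (of_plane x).
    apply/lee_subgt0Pr => e e0; apply: limn_einf_ge.
    move/cvgrPdist_lt : vg => /(_ e e0) vg; near=> n.
    rewrite -EFinB lee_fin (@le_trans _ _ (v n))//; last by near: n.
    have : `|g (of_plane x) - v n| < e by near: n.
    by rewrite ltr_norml => /andP[_]; rewrite ltrBlDr -ltrBlDl => /ltW.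
apply: (le_trans gL); apply: (le_trans H); exact: limn_einf_le.
Unshelve. all: by end_near. Qed.

End plane_integral.

(** * Weighted power integrals and convexity *)

Section weighted_power_integrals.
Variables (R : realType) (p : R) (W : R[i] -> R).
Hypothesis p1 : 1 < p.
Hypothesis W0 : forall z, 0 <= W z.
Implicit Types (f g h : R[i] -> R) (z : R[i]).

Hypothesis mW : meas W.

(** The p-th power of the weighted norm; the root is taken only when returning to [fock_norm]. *)
Definition pint h : \bar R :=
  plane_int (fun z => h z `^ p * W z).

Let p0 : 0 < p. Proof. exact: lt_trans p1. Qed.

(** The graph of [x^p] lies above its tangent at [m]. This is Young's inequality for [x] and
    [m^(p-1)] with conjugate exponents [p] and [p / (p - 1)]. *)
Lemma tangent_powR (x m : R) : 0 <= x -> 0 <= m ->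
  m `^ p + p * m `^ (p - 1) * (x - m) <= x `^ p.
Proof.
move=> x0 m0; have q0 : 0 < p / (p - 1) by rewrite divr_gt0// subr_gt0.
have pq : p^-1 + (p / (p - 1))^-1 = 1.
  by rewrite invf_div -{1}[p^-1]mul1r -mulrDl addrC subrK divff// gt_eqF.
have := conjugate_powR x0 (powR_ge0 m (p - 1)) p0 q0 pq.
rewrite -powRrM mulrC [(p - 1) * _]mulrC divfK ?gt_eqF ?subr_gt0// invf_div => H.
have mE : m * m `^ (p - 1) = m `^ p by rewrite mulr_powRB1.
have := H; rewrite -(ler_pM2l p0) => {}H.
rewrite mulrBr -!mulrA [m `^ _ * m]mulrC mE.
have h1 : p * (x `^ p / p) = x `^ p by rewrite mulrC divfK// gt_eqF.
have h2 : p * (m `^ p * ((p - 1) / p)) = (p - 1) * m `^ p by field; rewrite gt_eqF.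
by move: H; rewrite mulrDr h1 h2; lra.
Qed.

(** Sums the tangent inequality at the mean [m]; the linear terms cancel. *)
Lemma jensen_powR n (w x : 'I_n -> R) : (forall i, 0 <= w i) -> (forall i, 0 <= x i) ->
  \sum_i w i = 1 -> (\sum_i w i * x i) `^ p <= \sum_i w i * x i `^ p.
Proof.
move=> w0 x0 w1; set m := \sum_i w i * x i.
have m0 : 0 <= m by apply: sumr_ge0 => i _; rewrite mulr_ge0.
have -> : m `^ p = \sum_i w i * (m `^ p + p * m `^ (p - 1) * (x i - m)).
  under eq_bigr do rewrite mulrDr mulrCA mulrBr.
  rewrite big_split/= -mulr_suml w1 mul1r -mulr_sumr sumrB -mulr_suml w1 mul1r.
  by rewrite -/m subrr mulr0 addr0.
by apply: ler_sum => i _; rewrite ler_wpM2l// tangent_powR.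
Qed.

Lemma meas_pint h : meas h -> meas (fun z => h z `^ p * W z).
Proof. by move=> mh; apply: measM => //; exact: meas_powR. Qed.

Lemma pint_integrand_ge0 h z : 0 <= h z `^ p * W z.
Proof. by rewrite mulr_ge0// powR_ge0. Qed.

Lemma pint_ge0 h : (0 <= pint h)%E.
Proof. by apply: plane_int_ge0 => z; exact: pint_integrand_ge0. Qed.

Lemma le_pint f g : meas f -> meas g -> (forall z, 0 <= f z <= g z) -> (pint f <= pint g)%E.
Proof.
move=> mf mg fg; apply: le_plane_int; [exact: meas_pint|exact: meas_pint|move=> z].
rewrite pint_integrand_ge0 ler_wpM2r//; have /andP[f0 fgx] := fg z.
by rewrite ge0_ler_powR// ?nnegrE ?(ltW p0)// (le_trans f0).
Qed.

Lemma pintZ (c : R) f : 0 <= c -> (forall z, 0 <= f z) -> meas f ->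
  pint (fun z => c * f z) = ((c `^ p)%:E * pint f)%E.
Proof.
move=> c0 f0 mf; rewrite /pint -plane_intZ ?powR_ge0//; last 2 first.
- by move=> z; exact: pint_integrand_ge0.
- exact: meas_pint.
by congr plane_int; apply/funext => z; rewrite powRM// mulrA.
Qed.

Lemma powR_addr_le (x y : R) : 0 <= x -> 0 <= y ->
  (x + y) `^ p <= 2 `^ p * (x `^ p + y `^ p).
Proof.
wlog xy : x y / x <= y.
  by move=> H x0 y0; case: (leP x y) => [|/ltW] h; [exact: H|rewrite addrC [x `^ _ + _]addrC; exact: H].
move=> x0 y0; rewrite (@le_trans _ _ ((2 * y) `^ p))//.
  by rewrite ge0_ler_powR// ?nnegrE ?addr_ge0 ?mulr_ge0 ?(ltW p0)//; lra.
by rewrite powRM// ler_wpM2l ?powR_ge0// lerDr powR_ge0.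
Qed.

Lemma pintD f g : (forall z, 0 <= f z) -> (forall z, 0 <= g z) -> meas f -> meas g ->
  (pint (fun z => (f z + g z)%R) <= (2 `^ p)%:E * (pint f + pint g))%E.
Proof.
move=> f0 g0 mf mg; have [mf' mg'] := (meas_pint mf, meas_pint mg).
rewrite /pint -(plane_intD (pint_integrand_ge0 f) (pint_integrand_ge0 g) mf' mg').
have fg0 z : 0 <= f z `^ p * W z + g z `^ p * W z by rewrite addr_ge0 ?pint_integrand_ge0.
rewrite -(plane_intZ (powR_ge0 2 p) fg0 (measD mf' mg')).
apply: le_plane_int.
- exact: meas_pint (measD mf mg).
- by apply: measM (measD mf' mg'); exact: meas_cst.
- by move=> z; rewrite mulr_ge0 ?powR_ge0//= -mulrDl mulrA ler_wpM2r// powR_addr_le.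
Qed.

Definition Lp h := [/\ forall z, 0 <= h z, meas h & (pint h < +oo)%E].

Lemma LpD f g : Lp f -> Lp g -> Lp (fun z => f z + g z).
Proof.
move=> [f0 mf fi] [g0 mg gi]; split=> [z||]; first by rewrite addr_ge0.
  exact: measD.
rewrite (le_lt_trans (pintD _ _ _ _))// lte_mul_pinfty ?lee_fin ?powR_ge0//.
exact: lte_add_pinfty fi gi.
Qed.

Lemma LpZ (c : R) f : 0 <= c -> Lp f -> Lp (fun z => c * f z).
Proof.
move=> c0 [f0 mf fi]; split=> [z||]; first by rewrite mulr_ge0.
  by apply: measM => //; exact: meas_cst.
by rewrite pintZ// lte_mul_pinfty ?lee_fin ?powR_ge0.
Qed.

Lemma Lp_le f g : meas f -> (forall z, 0 <= f z <= g z) -> Lp g -> Lp f.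
Proof.
move=> mf fg [g0 mg gi]; split; [by move=> z; case/andP: (fg z)|exact: mf|].
exact: le_lt_trans (le_pint mf mg fg) gi.
Qed.

End weighted_power_integrals.

(** * Measurability of power series *)

Section complex_measurability.
Variable R : realType.
Implicit Types (F G : R[i] -> R[i]) (z : R[i]).

Lemma borel_measurable_plane (A : set (measurableTypeR R * measurableTypeR R)) :
  measurable A -> measurable (A : set (plane R)).
Proof. by move=> mA; apply: sub_caratheodory; exact: sub_sigma_algebra. Qed.

Lemma meas_Re : meas (fun z : R[i] => complex.Re z).
Proof.
move=> _ A mA; rewrite setTI; apply: borel_measurable_plane.
rewrite -[X in measurable X]setTI; exact: measurable_fst.
Qed.

Lemma meas_Im : meas (fun z : R[i] => complex.Im z).
Proof.
move=> _ A mA; rewrite setTI; apply: borel_measurable_plane.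
rewrite -[X in measurable X]setTI; exact: measurable_snd.
Qed.

Definition cmeas F := meas (fun z => complex.Re (F z)) /\ meas (fun z => complex.Im (F z)).

Lemma cmeas_id : cmeas id. Proof. by split; [exact: meas_Re|exact: meas_Im]. Qed.

Lemma cmeas_cst (c : R[i]) : cmeas (fun=> c). Proof. by split; exact: meas_cst. Qed.

Lemma cmeasD F G : cmeas F -> cmeas G -> cmeas (fun z => F z + G z).
Proof.
move=> [F1 F2] [G1 G2]; split.
  by have := measD F1 G1; congr meas; apply/funext => z; rewrite Re_add.
by have := measD F2 G2; congr meas; apply/funext => z; rewrite Im_add.
Qed.

Lemma cmeasM F G : cmeas F -> cmeas G -> cmeas (fun z => F z * G z).
Proof.
move=> [F1 F2] [G1 G2]; split.
  have := measB (measM F1 G1) (measM F2 G2).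
  by congr meas; apply/funext => z; rewrite Re_mul.
have := measD (measM F1 G2) (measM F2 G1).
by congr meas; apply/funext => z; rewrite Im_mul.
Qed.

Lemma cmeasX F n : cmeas F -> cmeas (fun z => F z ^+ n).
Proof.
move=> mF; elim: n => [|n IH].
  by under [X in cmeas X]eq_fun do rewrite expr0; exact: cmeas_cst.
by under [X in cmeas X]eq_fun do rewrite exprS; exact: cmeasM mF IH.
Qed.

Lemma cmeas_psum a n : cmeas (fun z => psum a z n).
Proof.
elim: n => [|n IH].
  by under [X in cmeas X]eq_fun do rewrite /psum big_ord0; exact: cmeas_cst.
under [X in cmeas X]eq_fun do rewrite /psum big_ord_recr/=.
exact: (cmeasD IH (cmeasM (cmeas_cst (a n)) (cmeasX n cmeas_id))).
Qed.

Lemma cmeas_expansion a F : expansion a F -> cmeas F.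
Proof.
move=> [_ aF]; split.
- apply: meas_cvg (fun n => (cmeas_psum a n).1) _ => z.
  apply/cvgrPdist_lt => e e0; have /cvg0P/(_ e e0)[N HN] := aF z.
  exists N => // n /= /HN; rewrite ger0_norm ?nc_ge0// -Re_sub.
  exact: le_lt_trans (ler_Re_nc _).
- apply: meas_cvg (fun n => (cmeas_psum a n).2) _ => z.
  apply/cvgrPdist_lt => e e0; have /cvg0P/(_ e e0)[N HN] := aF z.
  exists N => // n /= /HN; rewrite ger0_norm ?nc_ge0// -Im_sub.
  exact: le_lt_trans (ler_Im_nc _).
Qed.

Lemma meas_nc F : cmeas F -> meas (fun z => nc (F z)).
Proof.
move=> [mr mi].
have -> : (fun z => nc (F z)) =
    (fun z => (complex.Re (F z) * complex.Re (F z) + complex.Im (F z) * complex.Im (F z)) `^ 2^-1).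
  apply/funext => z; rewrite -!expr2 -sqr_nc powR12_sqrt ?sqr_ge0//.
  by rewrite sqrtr_sqr ger0_norm ?nc_ge0.
exact: meas_powR (measD (measM mr mr) (measM mi mi)).
Qed.

End complex_measurability.

Section expansion_bounds.
Variable R : realType.
Implicit Types (a : nat -> R[i]) (F : R[i] -> R[i]) (z : R[i]).

(** One null sequence controls both the high terms and the remainders, uniformly on the circle
    through [z], so that it survives averaging over rotations. It is geometric, of ratio
    [|z| / (|z| + 1)]. *)
Lemma expansion_circle a F z : expansion a F -> exists2 tau : nat -> R, tau @ \oo --> 0 &
  forall M, (forall n, (M <= n)%N -> nc (a n) * nc z ^+ n <= tau M) /\
    (forall u, nc u = nc z -> nc (F u - psum a u M) <= tau M).
Proof.
move=> aF; set r := nc z + 1; have r0 : 0 < r by rewrite ltr_wpDl ?nc_ge0.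
have zr : nc z < r by rewrite ltrDl.
have [C C0 HC] := expansion_coef r aF.
set q := nc z / r; have q0 : 0 <= q by rewrite divr_ge0 ?nc_ge0 ?ltW.
have q1 : q < 1 by rewrite ltr_pdivrMr// mul1r.
exists (fun M => C * r * q ^+ M).
  rewrite -(mulr0 (C * r)); apply: cvgM; first exact: cvg_cst.
  by apply: cvg_expr; rewrite ger0_norm.
have coef n : nc (a n) <= C / r ^+ n by rewrite ler_pdivlMr ?exprn_gt0.
move=> M; split => [n Mn|u uz].
  rewrite (@le_trans _ _ (C * q ^+ n))//.
    have -> : C * q ^+ n = C / r ^+ n * nc z ^+ n by rewrite /q expr_div_n mulrA mulrAC.
    by rewrite ler_wpM2r ?exprn_ge0 ?nc_ge0.
  rewrite (@le_trans _ _ (C * q ^+ M))//.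
    by rewrite ler_pM2l// ler_wiXn2l// ltW.
  rewrite ler_wpM2r ?exprn_ge0// ler_peMr ?(ltW C0)//.
  by rewrite /r lerDr nc_ge0.
have ur : nc u < r by rewrite uz.
rewrite (le_trans (@expansion_tail _ a F r (C / r ^+ M) u M aF ur _))//.
  by move=> k; rewrite ler_pdivlMr ?exprn_gt0// -mulrA -exprD addnC.
rewrite uz /q expr_div_n /r [nc z + 1 - nc z]addrC addKr divr1.
by rewrite [leLHS]mulrAC -!mulrA ler_pM2l// mulrC -mulrA ler_pM2l// mulrC.
Qed.

(** Averaging [F(om_j z)] with complex weights [u_j] multiplies the [k]-th coefficient by
    [sum_j u_j om_j^k]. The weights are left free: they can extract one coefficient or produce a
    Fejer mean. *)
Lemma average_bound a F z (tau : nat -> R) M K (u om : 'I_K -> R[i]) :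
  (forall v, nc v = nc z -> nc (F v - psum a v M) <= tau M) ->
  (forall j, nc (om j) = 1) -> \sum_j nc (u j) = 1 ->
  nc (\sum_(k < M) (\sum_j u j * om j ^+ k) * (a k * z ^+ k)) <=
    \sum_j nc (u j) * nc (F (om j * z)) + tau M.
Proof.
move=> Ftau om1 u1.
have -> : \sum_(k < M) (\sum_j u j * om j ^+ k) * (a k * z ^+ k) =
   \sum_j (u j * F (om j * z) - u j * (F (om j * z) - psum a (om j * z) M)).
  under eq_bigr do rewrite mulr_suml.
  rewrite exchange_big /=; apply: eq_bigr => j _.
  rewrite -mulrBr opprB addrC subrK /psum mulr_sumr; apply: eq_bigr => k _.
  by rewrite exprMn; ring.
rewrite (le_trans (nc_sum _ _ _))// -[tau M]mul1r -u1 mulr_suml -big_split/=.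
apply: ler_sum => j _; rewrite (le_trans (ncB _ _))// !ncM lerD// ler_wpM2l ?nc_ge0//.
by apply: Ftau; rewrite ncM om1 mul1r.
Qed.

End expansion_bounds.

Section roots_of_unity.
Variable R : realType.

Definition zeta K : R[i] := cis ((pi *+ 2) / K%:R).

Lemma nc_zeta K : nc (zeta K) = 1. Proof. exact: nc_cis. Qed.

Lemma zetaX K m : zeta K ^+ m = cis ((pi *+ 2) * m%:R / K%:R).
Proof. by rewrite /zeta -cisMn -[X in cis X = _]mulr_natr mulrAC. Qed.

Lemma zeta_primitive K : (0 < K)%N -> K.-primitive_root (zeta K).
Proof.
move=> K0; have KR : 0 < K%:R :> R by rewrite ltr0n.
have zK : zeta K ^+ K = 1 by rewrite zetaX mulfK ?gt_eqF// cis2pi.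
apply/andP; split=> //; apply/forallP => -[m mK] /=; rewrite unity_rootE.
have [->|mK'] := eqVneq m.+1 K; first by rewrite zK eqxx.
have {}mK : (m.+1 < K)%N by rewrite ltn_neqAle mK' mK.
apply/eqP/negbTE; rewrite zetaX; apply/eqP => h.
(* Half the angle: [cos (2 x) = 1] would force [sin x = 0], impossible for [0 < x < pi]. *)
set x := pi * m.+1%:R / K%:R : R.
have x0 : 0 < x < pi.
  rewrite divr_gt0 ?mulr_gt0 ?pi_gt0 ?ltr0n//= ltr_pdivrMr// ltr_pM2l ?pi_gt0//.
  by rewrite ltr_nat.
have xE : pi *+ 2 * m.+1%:R / K%:R = x *+ 2 :> R by rewrite /x !mulr2n; ring.
have : cos (x *+ 2) = 1 by have := congr1 (@complex.Re R) h; rewrite xE.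
have := sin_gt0_pi x0; have := cos2sin2 x; rewrite cos_mulr2n => -> s0.
by have := exprn_gt0 2 s0; rewrite -mulr_natr; lra.
Qed.

Lemma sum_zeta K m : (0 < K)%N ->
  \sum_(j < K) zeta K ^+ (j * m) = (if (K %| m)%N then K%:R else 0).
Proof.
move=> K0; have zp := zeta_primitive K0.
under eq_bigr do rewrite mulnC exprM.
case: ifPn => Km.
  have /eqP -> : zeta K ^+ m == 1 by rewrite -(prim_order_dvd zp).
  by under eq_bigr do rewrite expr1n; rewrite sumr_const card_ord.
have q1 : zeta K ^+ m - 1 != 0 by rewrite subr_eq0 -(prim_order_dvd zp).
apply: (mulfI q1); rewrite -subrX1 mulr0 -exprM mulnC exprM.
by rewrite (prim_expr_order zp) expr1n subrr.
Qed.

End roots_of_unity.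
(** * Averages over roots of unity *)

Definition max_term (R : realType) (a : nat -> R[i]) (z : R[i]) : R :=
  sup (range (fun n => nc (a n) * nc z ^+ n)).

Section max_term.
Variables (R : realType) (a : nat -> R[i]) (F : R[i] -> R[i]).
Hypothesis aF : expansion a F.

Lemma has_ubound_terms z : has_ubound (range (fun n => nc (a n) * nc z ^+ n)).
Proof. by have [C _ HC] := expansion_coef (nc z) aF; exists C => _ [n _ <-]. Qed.

Lemma max_term_ge n z : nc (a n) * nc z ^+ n <= max_term a z.
Proof. by apply: ub_le_sup; [exact: has_ubound_terms|exists n]. Qed.

Lemma max_term_le z C : (forall n, nc (a n) * nc z ^+ n <= C) -> max_term a z <= C.
Proof.
move=> HC; apply: ge_sup; first by exists (nc (a 0%N) * nc z ^+ 0), 0%N.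
by move=> _ [n _ <-].
Qed.

Lemma max_term_ge0 z : 0 <= max_term a z.
Proof. by rewrite (le_trans _ (max_term_ge 0 z))// mulr_ge0 ?exprn_ge0 ?nc_ge0. Qed.

Lemma meas_max_term : meas (max_term a).
Proof.
have mterm n : measurable_fun [set: plane R]
    (fun xy => nc (a n) * nc (of_plane xy) ^+ n).
  have := meas_nc (cmeasM (cmeas_cst (a n)) (cmeasX n (@cmeas_id R))).
  by rewrite /meas; congr measurable_fun; apply/funext => x; rewrite ncM ncX.
have := @measurable_fun_sups _ (plane R) R setT
  (fun n xy => nc (a n) * nc (of_plane xy) ^+ n) 0%N (fun t _ => has_ubound_terms (of_plane t)) mterm.
rewrite /meas; congr measurable_fun; apply/funext => x.
rewrite /sups /max_term; congr sup; apply/seteqP; split => y [n _ <-]; by exists n.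
Qed.

End max_term.

Section averages.
Variables (R : realType) (p : R) (W : R[i] -> R).
Hypothesis p1 : 1 < p.
Hypothesis W0 : forall z, 0 <= W z.
Hypothesis mW : meas W.
Hypothesis radW : forall w z, nc w = 1 -> W (w * z) = W z.
Implicit Types (f g h : R[i] -> R) (z : R[i]).
Local Notation pint := (pint p W).
Local Notation Lp := (Lp p W).

Let p0 : 0 < p. Proof. exact: lt_trans p1. Qed.

(** Jensen at each point, then each rotated integral equals the original one because [W] and the
    measure are rotation invariant. *)
Lemma pint_average K (u : 'I_K -> R) (om : 'I_K -> R[i]) h :
  (forall j, 0 <= u j) -> \sum_j u j = 1 -> (forall j, nc (om j) = 1) ->
  (forall z, 0 <= h z) -> meas h ->
  (pint (fun z => (\sum_j u j * h (om j * z))%R) <= pint h)%E.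
Proof.
move=> u0 u1 om1 h0 mh.
have mh' j : meas (fun z => h (om j * z)) by exact: meas_rotate.
have mhW := meas_pint p mW mh.
have hW0 z : 0 <= h z `^ p * W z by rewrite mulr_ge0 ?powR_ge0.
have ms : meas (fun z => \sum_j u j * h (om j * z)).
  by apply: meas_sum => j; exact: measM (meas_cst (u j)) (mh' j).
have mt j : meas (fun z => u j * (h (om j * z) `^ p * W (om j * z))).
  exact: measM (meas_cst (u j)) (meas_rotate (om1 j) mhW).
apply: (@le_trans _ _ (plane_int (fun z => \sum_j u j * (h (om j * z) `^ p * W (om j * z))))).
  apply: le_plane_int; [exact: meas_pint|exact: meas_sum|].
  move=> z; rewrite mulr_ge0 ?powR_ge0//=.
  have -> : \sum_j u j * (h (om j * z) `^ p * W (om j * z)) =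
      (\sum_j u j * h (om j * z) `^ p) * W z.
    by rewrite mulr_suml; apply: eq_bigr => j _; rewrite radW// mulrA.
  by rewrite ler_wpM2r// jensen_powR.
rewrite (plane_int_sum _ _ mt); last by move=> j z; rewrite mulr_ge0.
have E j : plane_int (fun z => u j * (h (om j * z) `^ p * W (om j * z))) = ((u j)%:E * pint h)%E.
  rewrite (plane_intZ (f := fun z => h (om j * z) `^ p * W (om j * z)))//; last exact: (meas_rotate (om1 j) mhW).
  by rewrite (plane_int_rotate (f := fun z => h z `^ p * W z)).
under eq_bigr do rewrite E.
by rewrite -ge0_sume_distrl ?sumEFin ?u1 ?mul1e// => j _; rewrite lee_fin.
Qed.

(** The tangent inequality at [g] turns [A_n >= g - tau_n] into [A_n^p >= g^p - p g^(p-1) tau_n], a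
    minorant that tends to [g^p]; Fatou concludes. *)
Lemma pint_limit (A : nat -> R[i] -> R) g (B : \bar R) :
  (forall n, meas (A n)) -> (forall n z, 0 <= A n z) -> meas g -> (forall z, 0 <= g z) ->
  (forall z, exists2 tau : nat -> R, tau @ \oo --> 0 & \forall n \near \oo, g z <= A n z + tau n) ->
  (\forall n \near \oo, (pint (A n) <= B)%E) -> (pint g <= B)%E.
Proof.
move=> mA A0 mg g0 gA AB.
apply: (plane_int_fatou (f := fun n z => A n z `^ p * W z)) AB => [n|n z||z|z].
- exact: meas_pint.
- by rewrite mulr_ge0 ?powR_ge0.
- exact: meas_pint.
- by rewrite mulr_ge0 ?powR_ge0.
have [tau tau0 Htau] := gA z.
exists (fun n => (g z `^ p - p * g z `^ (p - 1) * tau n) * W z).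
  rewrite (_ : g z `^ p * W z = (g z `^ p - p * g z `^ (p - 1) * 0) * W z); last first.
    by rewrite mulr0 subr0.
  apply: cvgM; last exact: cvg_cst.
  by apply: cvgB; [exact: cvg_cst|apply: cvgM => //; exact: cvg_cst].
near=> n; rewrite ler_wpM2r//.
have h : g z <= A n z + tau n by near: n.
rewrite (le_trans _ (tangent_powR p1 (A0 n z) (g0 z)))// lerD2l -mulrN.
by rewrite ler_wpM2l ?mulr_ge0 ?powR_ge0 ?(ltW p0)//; lra.
Unshelve. all: by end_near. Qed.

(** The weights [zeta^(j (K - n)) / K] annihilate every coefficient of index below [K] except the
    [n]-th; [K - n] plays the role of the exponent [- n]. *)
Lemma zeta_average_coef a z (F : R[i] -> R[i]) (tau : nat -> R) K n : (n < K)%N ->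
  (forall v, nc v = nc z -> nc (F v - psum a v K) <= tau K) ->
  nc (a n) * nc z ^+ n <= \sum_(j < K) K%:R^-1 * nc (F (zeta R K ^+ j * z)) + tau K.
Proof.
move=> nK Htau; have K0 : (0 < K)%N by exact: leq_ltn_trans nK.
have KR : 0 < K%:R :> R by rewrite ltr0n.
have ncK : nc (K%:R^-1 : R[i]) = K%:R^-1.
  by rewrite ncV -(rmorph_nat (real_complex R)) ncR_ge0// ltW.
pose u (j : 'I_K) := K%:R^-1 * zeta R K ^+ (j * (K - n)) : R[i].
have ncu j : nc (u j) = K%:R^-1 by rewrite ncM ncX nc_zeta expr1n mulr1 ncK.
have om1 (j : 'I_K) : nc (zeta R K ^+ j) = 1 by rewrite ncX nc_zeta expr1n.
have su : \sum_j nc (u j) = 1.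
  under eq_bigr do rewrite ncu.
  by rewrite sumr_const card_ord -[RHS](mulVf (lt0r_neq0 KR)) mulr_natr.
have := average_bound (u := u) Htau om1 su.
under [X in _ <= X + _]eq_bigr do rewrite ncu.
have -> : \sum_(k < K) (\sum_j u j * (zeta R K ^+ j) ^+ k) * (a k * z ^+ k) = a n * z ^+ n.
  have E (k : 'I_K) : \sum_j u j * (zeta R K ^+ j) ^+ k = (k == Ordinal nK)%:R.
    transitivity (K%:R^-1 * \sum_(j < K) zeta R K ^+ (j * (K - n + k)) : R[i]).
      by rewrite mulr_sumr; apply: eq_bigr => j _; rewrite /u -mulrA -exprM -exprD -mulnDr.
    (* The exponent lies strictly between 0 and [2 K], so it can only be [K]. *)
    rewrite sum_zeta//; have -> : (K %| K - n + k)%N = (k == Ordinal nK).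
      rewrite -val_eqE /=; have kK := ltn_ord k; apply/idP/eqP => [/dvdnP[q]|->]; last by rewrite subnK// ltnW.
      case: q => [|[|q]]; nia.
    case: eqP => _; last by rewrite mulr0.
    by rewrite mulVf// pnatr_eq0 -lt0n.
  rewrite (bigD1 (Ordinal nK))// E eqxx mul1r big1 => [|k kn]; first by rewrite /= addr0.
  by rewrite E (negbTE kn) mul0r.
by rewrite ncM ncX.
Qed.

(** One average [A K] dominates all terms of index below [K] at once, up to [tau K], and the other
    terms are below [tau K]; hence it dominates their supremum. *)
Lemma Lp_max_term a F : expansion a F -> Lp (fun z => nc (F z)) -> Lp (max_term a).
Proof.
move=> aF [F0 mF Fi]; split; [exact: max_term_ge0 aF|exact: meas_max_term aF|].
apply: le_lt_trans Fi.
pose A K z : R := \sum_(j < K) K%:R^-1 * nc (F (zeta R K ^+ j * z)).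
have om1 K (j : 'I_K) : nc (zeta R K ^+ j) = 1 by rewrite ncX nc_zeta expr1n.
apply: (@pint_limit A).
- move=> K; apply: meas_sum => j; apply: measM (meas_cst _) _.
  exact: (meas_rotate (om1 K j) mF).
- by move=> K z; apply: sumr_ge0 => j _; rewrite mulr_ge0 ?invr_ge0 ?ler0n ?nc_ge0.
- exact: meas_max_term aF.
- exact: max_term_ge0 aF.
- move=> z; have [tau tau0 Htau] := expansion_circle z aF.
  exists tau => //; near=> K.
  have A0 : 0 <= A K z by apply: sumr_ge0 => j _; rewrite mulr_ge0 ?invr_ge0 ?ler0n ?nc_ge0.
  apply: max_term_le => n; have [nK|Kn] := ltnP n K.
    by apply: zeta_average_coef nK _; exact: (Htau K).2.
  by rewrite (le_trans ((Htau K).1 n Kn))// lerDr.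
- exists 1%N; first by [].
  move=> K /= K0; apply: (pint_average _ _ (om1 K) F0 mF) => [j|]; first by rewrite invr_ge0.
  by rewrite sumr_const card_ord -[RHS](mulVf (_ : K%:R != 0)) ?mulr_natr// pnatr_eq0 -lt0n.
Unshelve. all: by end_near. Qed.

End averages.
(** * Quotients of iterated shifts *)

Section gaps.
Variable R : realType.

(** Otherwise every [rho (j+1)] with [j >= m] is less than [rho i + 2^-i] for some [i <= j], and
    then all [rho k] stay below [rho m + 2]. *)
Lemma gap_index (rho : nat -> R) (m : nat) :
  (forall i, rho i <= rho i.+1) -> (forall x, exists i, x <= rho i) ->
  exists2 j, (m <= j)%N & forall i, (i <= j)%N -> 2^-1 ^+ i <= rho j.+1 - rho i.
Proof.
move=> rhoS rhoy; apply: contrapT => no.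
have ndr : {homo rho : i j / (i <= j)%N >-> i <= j}.
  by apply: homo_leq => // ? ? ?; exact: le_trans.
have H j : (m <= j)%N -> exists2 i, (i <= j)%N & rho j.+1 < rho i + 2^-1 ^+ i.
  move=> mj; apply: contrapT => no'; apply: no; exists j => // i ij.
  by rewrite leNgt; apply/negP => lt; apply: no'; exists i => //; rewrite -ltrBlDl.
(* Strong induction, since [i] may be far below [j]: the bound for [rho i] uses only the terms
   before [2^-i], which is then added. *)
have bnd k : rho k <= rho m + \sum_(0 <= i < k) 2^-1 ^+ i.
  elim/ltn_ind: k => k IH; have [km|mk] := leqP k m.
    by rewrite (le_trans (ndr _ _ km))// lerDl sumr_ge0// => i _; rewrite exprn_ge0.
  case: k mk IH => // j mj IH; have [i ij /ltW lt] := H j mj.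
  rewrite (le_trans lt)// (le_trans (lerD (IH i ij) (lexx _)))//.
  rewrite -addrA lerD2l -big_nat_recr//= [leRHS](big_cat_nat _ (n := i.+1))//=.
  by rewrite lerDl sumr_ge0// => l _; rewrite exprn_ge0.
have [k] := rhoy (rho m + 2 + 1); apply/negP; rewrite -ltNge.
rewrite (le_lt_trans (bnd k))// -addrA ltrD2l big_mkord.
have h : 0 <= (2^-1 : R) < 1 by lra.
rewrite (le_lt_trans (geometric_le k h))//.
have -> : 1 - 2^-1 = 2^-1 :> R by lra.
by rewrite invrK; lra.
Qed.

(** [rho] is the supremum of the radii at which no term exceeds [c]. Adjoining 0 covers a constant
    term already larger than [c]: then [rho = 0] and the first bound is vacuous. *)
Lemma threshold (b : nat -> R) (c : R) : (forall n, 0 <= b n) -> 0 < c ->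
  (exists2 n, (0 < n)%N & 0 < b n) ->
  exists rho, [/\ 0 <= rho, forall r, 0 <= r < rho -> forall n, b n * r ^+ n <= c &
    forall r, rho < r -> exists n, c < b n * r ^+ n].
Proof.
move=> b0 c0 [N N0 bN].
pose E := [set r | r = 0 \/ 0 <= r /\ forall n, b n * r ^+ n <= c].
have E0 : E 0 by left.
have ubE : has_ubound E.
  exists (1 + c / b N) => r; have ge0 : 0 <= c / b N by rewrite divr_ge0 ?ltW.
  case=> [->|[r0 Hr]]; first by rewrite addr_ge0.
  have [r1|/ltW r1] := leP r 1; first by rewrite (le_trans r1)// lerDl.
  rewrite (@le_trans _ _ (c / b N))// ?lerDr// ler_pdivlMr// mulrC.
  rewrite (le_trans _ (Hr N))// ler_wpM2l ?b0//.
  by rewrite -[leLHS]expr1 ler_weXn2l.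
exists (sup E); split; first exact: ub_le_sup.
- move=> r /andP[r0 /(sup_gt _)]; case; first by exists 0.
  move=> s [->|[s0 Hs]] rs n; first by move: rs; rewrite ltNge r0.
  by rewrite (le_trans _ (Hs n))// ler_wpM2l ?b0// lerXn2r ?nnegrE// ltW.
- move=> r Er; apply: contrapT => /forallNP no.
  have : E r.
    right; split=> [|n]; last by rewrite leNgt; apply/negP; exact: no.
    by rewrite (le_trans _ (ltW Er))//; exact: ub_le_sup.
  by move=> /(ub_le_sup ubE); rewrite leNgt Er.
Qed.

End gaps.

Lemma plane_int_dominated (R : realType) (f : nat -> R[i] -> R) (g : R[i] -> R) (e : R) :
  (forall n, meas (f n)) -> meas g -> (forall n z, 0 <= f n z <= g z) ->
  (plane_int g < +oo)%E -> (forall z, f n z @[n --> \oo] --> 0) -> 0 < e ->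
  exists n, (plane_int (f n) < e%:E)%E.
Proof.
move=> mf mg fg gi fc e0.
have ig : (m2 R).-integrable setT (fun x : plane R => (g (of_plane x))%:E).
  apply/integrableP; split; first exact: meas_EFin.
  apply: le_lt_trans gi; rewrite le_eqVlt; apply/orP; left; apply/eqP.
  apply: eq_integral => x _; rewrite abse_EFin ger0_norm//.
  by have /andP[h1 h2] := fg 0%N (of_plane x); exact: le_trans h2.
have f0 : {ae m2 R, forall x : plane R, setT x ->
    (f n (of_plane x))%:E @[n --> \oo] --> 0%:E}.
  by apply: aeW => x _; apply: cvg_EFin; [exact: nearW|exact: fc].
have fle : {ae m2 R, forall (x : plane R) n, setT x ->
    (`|(f n (of_plane x))%:E| <= (g (of_plane x))%:E)%E}.
  apply: aeW => x n _; have /andP[h1 h2] := fg n (of_plane x).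
  by rewrite abse_EFin lee_fin ger0_norm.
have [_ _ ] := dominated_convergence measurableT (fun n => meas_EFin (mf n))
  (@measurable_cst _ _ _ _ setT (0%:E : \bar R)) f0 ig fle.
rewrite integral0 => /fine_cvgP[[N1 _ fin]].
move=> /cvgrPdist_lt/(_ e e0)[N2 _ H]; exists (maxn N1 N2).
have := fin _ (leq_maxl N1 N2); have := H _ (leq_maxr N1 N2) => /=.
rewrite sub0r normrN -/(plane_int (f (maxn N1 N2))) => h fn.
by rewrite -(fineK fn) lte_fin (le_lt_trans (ler_norm _)).
Qed.
Section quotient_estimates.
Variables (R : realType) (a : nat -> R[i]) (F : R[i] -> R[i]) (G : nat -> R[i] -> R[i]).
Hypothesis aF : expansion a F.
Hypothesis aG : forall n, expansion (coef_shift n a) (G n).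
Hypothesis GF : forall n z, G n z * z ^+ n = F z - psum a z n.
Local Notation b n := (nc (a n)).

(* r < s lie in an interval on which the maximal term is between c and 4c, and n is nearly the
   index of the maximal term at r. *)
Variables (r s c : R) (n : nat).
Hypotheses (r0 : 0 < r) (rs : r < s) (c1 : 1 <= c).
Hypothesis bs : forall k, b k * s ^+ k <= 4 * c.
Hypothesis br : forall k, b k * r ^+ k <= 2 * (b n * r ^+ n).
Hypothesis bn : c / 2 <= b n * r ^+ n.

Let c0 : 0 < c. Proof. exact: lt_le_trans c1. Qed.
Let s0 : 0 < s. Proof. exact: lt_trans rs. Qed.

Lemma index_coef_gt0 : 0 < b n.
Proof.
by rewrite -(pmulr_lgt0 _ (exprn_gt0 n r0)) (lt_le_trans _ bn)// divr_gt0.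
Qed.

Let bn0 := index_coef_gt0.

(** [G_n / a_n] has constant term 1. Its further coefficients are at most [8 s^-k], because the
    terms at [s] are at most [4 c] while [|a_n| s^n >= c / 2]. *)
Lemma quotient_near z : nc z < s -> nc (G n z / a n - 1) <= 8 * nc z / (s - nc z).
Proof.
move=> zs; have an0 : a n != 0 by rewrite -nc_gt0.
have H k : nc (coef_shift n a (1 + k)) * s ^+ k <= 8 * b n / s.
  have h1 := bs (n + (1 + k)).
  rewrite ler_pdivlMr// -mulrA -exprSr.
  rewrite -(ler_pM2r (exprn_gt0 n s0)).
  have -> : nc (coef_shift n a (1 + k)) * s ^+ k.+1 * s ^+ n = b (n + (1 + k)) * s ^+ (n + (1 + k)).
    by rewrite -mulrA -exprD [(k.+1 + n)%N]addnC.
  rewrite (le_trans h1)//.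
  have : b n * r ^+ n <= b n * s ^+ n.
    by rewrite ler_wpM2l ?nc_ge0// lerXn2r ?nnegrE ?(ltW r0) ?(ltW s0)// ltW.
  by move: bn; lra.
have := expansion_tail (aG n) zs H.
rewrite /psum big_ord1 expr0 mulr1 /coef_shift addn0 expr1 => h.
have -> : G n z / a n - 1 = (G n z - a n) / a n by rewrite mulrBl divff.
rewrite ncf ler_pdivrMr// (le_trans h)// le_eqVlt; apply/orP; left; apply/eqP.
have : s - nc z != 0 by rewrite subr_eq0 gt_eqF.
have : s != 0 by rewrite gt_eqF.
by move=> ? ?; field; apply/andP.
Qed.

(** Divides [F - psum a z n] by [a_n z^n], of modulus at least [c / 2 >= 1 / 2]. The terms of index
    [k < n], compared with the [n]-th one at [r], are at most [2 (r / |z|)^(n-k)] after the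
    division. *)
Lemma quotient_far z : r < nc z ->
  nc (G n z / a n - 1) <= 1 + 2 * nc (F z) + 2 * r / (nc z - r).
Proof.
move=> rz; have an0 : a n != 0 by rewrite -nc_gt0.
have z0 : 0 < nc z by exact: lt_trans rz.
have z0' : z != 0 by rewrite -nc_gt0.
have bz : b n * r ^+ n <= b n * nc z ^+ n.
  by rewrite ler_wpM2l ?nc_ge0// lerXn2r ?nnegrE ?(ltW r0) ?(ltW z0)// ltW.
have bz0 : 0 < b n * nc z ^+ n by rewrite mulr_gt0// exprn_gt0.
have -> : G n z / a n = F z / (a n * z ^+ n) - psum a z n / (a n * z ^+ n).
  by rewrite -mulrBl -GF; field; rewrite an0 expf_neq0.
rewrite (le_trans (ncB _ _))// nc1 addrC -addrA lerD2l (le_trans (ncB _ _))// lerD//.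
  rewrite ncf ncM ncX ler_pdivrMr// mulrAC ler_peMl ?nc_ge0//.
  by move: bn c1; lra.
rewrite ncf ncM ncX ler_pdivrMr//.
set q := r / nc z; have q0 : 0 <= q by rewrite divr_ge0 ?(ltW r0) ?(ltW z0).
have q1 : q < 1 by rewrite ltr_pdivrMr// mul1r.
rewrite (le_trans (nc_sum _ _ _))//.
have term (k : 'I_n) : nc (a k * z ^+ k) <= 2 * q * (b n * nc z ^+ n) * q ^+ (n - k.+1).
  have kn := ltn_ord k.
  rewrite ncM ncX.
  have -> : 2 * q * (b n * nc z ^+ n) * q ^+ (n - k.+1) = 2 * (b n * (nc z ^+ n * q ^+ (n - k))).
    by rewrite -(subnSK kn) exprS; ring.
  have -> : nc z ^+ n * q ^+ (n - k) = r ^+ (n - k) * nc z ^+ k.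
    rewrite -{1}(subnK (ltnW kn)) exprD /q expr_div_n.
    have : nc z ^+ (n - k) != 0 by rewrite expf_neq0// gt_eqF.
    by move: (nc z ^+ (n - k)) (nc z ^+ k) (r ^+ (n - k)) => Z Y X Z0; field.
  rewrite !mulrA ler_wpM2r ?exprn_ge0 ?(ltW z0)// -mulrA.
  rewrite -(ler_pM2r (exprn_gt0 k r0)) (le_trans (br k))//.
  by rewrite -!mulrA -exprD subnK// ltnW.
rewrite (le_trans (ler_sum _ (fun k _ => term k)))// -mulr_sumr.
have -> : \sum_(k < n) q ^+ (n - k.+1) = \sum_(k < n) q ^+ k.
  by rewrite [RHS](reindex_inj rev_ord_inj).
have h : 0 <= q < 1 by rewrite q0.
rewrite mulrAC ler_wpM2r ?(ltW bz0)//.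
rewrite (@le_trans _ _ (2 * q * (1 - q)^-1))//.
  by rewrite ler_wpM2l ?geometric_le// mulr_ge0.
rewrite le_eqVlt; apply/orP; left; apply/eqP; rewrite /q.
have : nc z - r != 0 by rewrite subr_eq0 gt_eqF.
have : nc z != 0 by rewrite gt_eqF.
by move=> Z0 Zr; field; rewrite ?Z0 ?Zr.
Qed.

End quotient_estimates.

Section key_lemma.
Variables (R : realType) (a : nat -> R[i]) (F : R[i] -> R[i]) (G : nat -> R[i] -> R[i]).
Hypothesis aF : expansion a F.
Hypothesis aG : forall n, expansion (coef_shift n a) (G n).
Hypothesis GF : forall n z, G n z * z ^+ n = F z - psum a z n.
Hypothesis anz : forall N, exists2 n, (N <= n)%N & a n != 0.
Local Notation b n := (nc (a n)).
Local Notation mu := (max_term a).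

(** The first bound is the majorant, the same for all [X]; the second gives convergence to 0 at each
    [z] as [X] grows. Beyond the middle of the gap after [rho j] the far estimate is used, below it
    the near one. *)
Lemma quotient_bound X : 0 <= X -> exists n, [/\ a n != 0,
  forall z, nc (G n z / a n - 1) <= 32 + 2 * nc (F z) + 128 * mu z + 32 * nc z ^+ 2 &
  forall z, nc z < X -> nc (G n z / a n - 1) <= 8 * nc z / (X - nc z)].
Proof.
move=> X0.
have bpos : exists2 n, (0 < n)%N & 0 < b n.
  by have [n n0 an] := anz 1; exists n => //; rewrite nc_gt0.
have [rho Hrho] : exists rho : nat -> R, forall i, [/\ 0 <= rho i,
    forall r, 0 <= r < rho i -> forall n, b n * r ^+ n <= 4 ^+ i &
    forall r, rho i < r -> exists n, 4 ^+ i < b n * r ^+ n].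
  have H i := @threshold R (fun n => b n) (4 ^+ i) (fun n => nc_ge0 _) (exprn_gt0 i (ltr0Sn R 3)) bpos.
  by exists (fun i => projT1 (cid (H i))) => i; case: cid.
have rho0 i : 0 <= rho i by case: (Hrho i).
have below i x k : 0 <= x < rho i -> b k * x ^+ k <= 4 ^+ i.
  by move=> h; case: (Hrho i) => _ H _; exact: H.
have above i x : rho i < x -> exists k, 4 ^+ i < b k * x ^+ k.
  by case: (Hrho i) => _ _; exact.
have p4 i : 0 < 4 ^+ i :> R by rewrite exprn_gt0.
have rhoS i : rho i <= rho i.+1.
  rewrite leNgt; apply/negP => lt; set x := (rho i + rho i.+1) / 2.
  have x0 : 0 <= x < rho i by rewrite divr_ge0 ?addr_ge0//= /x; lra.
  have [k] := @above i.+1 x ltac:(rewrite /x; lra).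
  apply/negP; rewrite -leNgt (le_trans (below i x k x0))//.
  by rewrite ler_weXn2l// ler1n.
have rhoy x : exists i, x <= rho i.
  have [x0|x0] := leP x 0; first by exists 0%N; rewrite (le_trans x0).
  have [C C0 HC] := expansion_coef x aF.
  have [i Ci] : exists i, C <= 4 ^+ i.
    exists (Num.bound C); rewrite (le_trans (ltW (archi_boundP (ltW C0))))//.
    by rewrite -natrX ler_nat ltnW// ltn_expl.
  exists i; rewrite leNgt; apply/negP => /above[k].
  by apply/negP; rewrite -leNgt (le_trans (HC k)).
have ndr : {homo rho : i j / (i <= j)%N >-> i <= j}.
  by apply: homo_leq => // ? ? ?; exact: le_trans.
have [m Xm] := rhoy X.
have [j mj gap] := gap_index m rhoS rhoy.
set d := rho j.+1 - rho j.
have dj : 2^-1 ^+ j <= d by exact: gap.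
have h2 i : 0 < 2^-1 ^+ i :> R by rewrite exprn_gt0// invr_gt0.
have d0 : 0 < d by exact: lt_le_trans dj.
(* The quarter points of the gap leave [d / 4] between its middle and each of [r] and [s]. *)
set r := rho j + d / 4; set s := rho j + 3 * d / 4.
have r0 : 0 < r by rewrite /r; have := rho0 j; lra.
have rs : r < s by rewrite /r /s; lra.
have c1 : 1 <= 4 ^+ j :> R by rewrite exprn_ege1// ler1n.
have bs k : b k * s ^+ k <= 4 * 4 ^+ j.
  rewrite -exprS; apply: below; rewrite (ltW (lt_trans r0 rs))/= /s.
  have : rho j.+1 = rho j + d by rewrite /d; ring.
  by move: d0; lra.
pose mr := mu r%:C%C.
have ncr : nc r%:C%C = r by rewrite ncR_ge0// ltW.
have mr_ge k : b k * r ^+ k <= mr by have := max_term_ge aF k r%:C%C; rewrite ncr.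
have [k0 Hk0] : exists k, 4 ^+ j < b k * r ^+ k by apply: above; rewrite /r; lra.
have mr0 : 4 ^+ j < mr by exact: lt_le_trans (mr_ge k0).
(* Half of the supremum is enough, so its attainment need not be shown. *)
have [n Hn] : exists n, mr / 2 < b n * r ^+ n.
  apply: contrapT => /forallNP no.
  have : mr <= mr / 2.
    by apply: max_term_le => k; rewrite ncr leNgt; apply/negP; exact: no.
  by have := p4 j; lra.
have br k : b k * r ^+ k <= 2 * (b n * r ^+ n) by have := mr_ge k; lra.
have bn : 4 ^+ j / 2 <= b n * r ^+ n by lra.
have an0 : a n != 0 by rewrite -nc_gt0; exact: index_coef_gt0 r0 c1 bn.
have near := quotient_near aG r0 rs c1 bs bn.
have far := quotient_far GF r0 c1 br bn.
have mu_gt i z : rho i < nc z -> 4 ^+ i < mu z.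
  by move=> /above[k Hk]; exact: lt_le_trans Hk (max_term_ge aF k z).
(* This inequality fixes the thresholds as the squares of the inverse gap lengths. *)
have sqle i (x : R) : 2 ^+ i * x <= 4 ^+ i + x ^+ 2.
  have -> : 4 ^+ i = (2 ^+ i) ^+ 2 :> R by rewrite exprAC; congr (_ ^+ _); rewrite expr2; lra.
  move: (2 ^+ i) => y; have := sqr_ge0 (y - x); have := sqr_ge0 y; have := sqr_ge0 x.
  by rewrite sqrrB -mulr_natr !expr2; lra.
have inv2 i (x y : R) : 0 <= x -> 2^-1 ^+ i / 4 <= y -> x / y <= 4 * (2 ^+ i * x).
  move=> x0 xy; have p2 : 0 < 2 ^+ i :> R by rewrite exprn_gt0.
  rewrite ler_pdivrMr; last by rewrite (lt_le_trans _ xy)// divr_gt0.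
  have : 2 ^+ i * (2^-1 ^+ i / 4) <= 2 ^+ i * y by rewrite ler_pM2l.
  rewrite mulrA -exprMn divff// expr1n => /(ler_wpM2l x0).
  by move: (2 ^+ i) => u; lra.
exists n; split=> // z; last first.
  move=> zX; have zs : X <= s.
    by rewrite (le_trans Xm)// (le_trans (ndr _ _ mj))// /s; lra.
  rewrite (le_trans (near z _))//; first exact: lt_le_trans zX zs.
  rewrite ler_wpM2l ?mulr_ge0 ?nc_ge0// lef_pV2 ?posrE ?subr_gt0//; last exact: lt_le_trans zX zs.
  by rewrite lerD2r.
have mu0 := max_term_ge0 aF z; have F0 := nc_ge0 (F z); have z0 := nc_ge0 z.
have zz0 := sqr_ge0 (nc z).
have [zT|zT] := leP (nc z) (rho j + d / 2); last first.
  have zr : r < nc z by rewrite (lt_trans _ zT)// /r; lra.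
  rewrite (le_trans (far z zr))//.
  have muz : 4 ^+ j < mu z by apply: mu_gt; rewrite (lt_trans _ zT)//; lra.
  have : r / (nc z - r) <= 4 * (2 ^+ j * r).
    by apply: inv2; [exact: ltW|rewrite /r; lra].
  have : 2 ^+ j * r <= 2 ^+ j * nc z by rewrite ler_pM2l ?exprn_gt0// ltW.
  by have := sqle j (nc z); rewrite -[2 * r / _]mulrA; lra.
(* [i] is the first index with [|z| <= rho i], or [j + 1] inside the gap: [4^i] is controlled by the
   maximal term through [rho (i-1) < |z|], and [s - |z|] by the gap condition at [i]. *)
have [i [Hi Hs]] : exists i, 4 ^+ i <= 1 + 4 * mu z /\ 2^-1 ^+ i / 4 <= s - nc z.
  have [zj|zj] := ltP (rho j) (nc z).
    exists j.+1; split; first by rewrite exprS; have := mu_gt _ _ zj; lra.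
    by rewrite exprS /s; have := h2 j; lra.
  have exi : exists i, nc z <= rho i by exists j.
  have [i zi mini] := ex_minnP exi.
  have ij : (i <= j)%N by exact: mini.
  exists i; split.
    case: i mini {zi ij} => [|i] mini; first by rewrite expr0; lra.
    have : rho i < nc z by rewrite ltNge; apply/negP => /mini; rewrite ltnn.
    by move=> /mu_gt; rewrite exprS; lra.
  have := gap i ij; have := ndr _ _ ij; have := h2 i.
  have -> : rho j.+1 = rho j + d by rewrite /d; ring.
  by rewrite /s; lra.
have zs : nc z < s by have := h2 i; lra.
rewrite (le_trans (near z zs))// -mulrA.
have := inv2 i (nc z) _ z0 Hs; have := sqle i (nc z); lra.
Qed.

End key_lemma.

(** * Convergence in mean from pointwise convergence *)

Section convergence_in_mean.
Variables (R : realType) (p : R) (W : R[i] -> R).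
Hypothesis p1 : 1 < p.
Hypothesis W0 : forall z, 0 <= W z.
Hypothesis mW : meas W.
Implicit Types (F G : R[i] -> R[i]) (z : R[i]).
Local Notation pint := (pint p W).
Local Notation Lp := (Lp p W).

Let p0 : 0 < p. Proof. exact: lt_trans p1. Qed.

Lemma powR_cvg_0 (u : nat -> R) : (forall n, 0 <= u n) -> u @ \oo --> 0 ->
  u n `^ p @[n --> \oo] --> 0.
Proof.
move=> u0 /cvg0P uc; apply/cvg0P => e e0.
have m0 : 0 < Num.min 1 e by rewrite lt_min ltr01.
have [N HN] := uc _ m0; exists N => n /HN; rewrite !ger0_norm ?powR_ge0//.
rewrite lt_min => /andP[/ltW un1 une]; apply: le_lt_trans une.
have [->|un0] := eqVneq (u n) 0; first by rewrite powR0// gt_eqF.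
by rewrite ge1r_powR ?(ltW p1)// lt0r un0 u0.
Qed.

(** Fatou for [2^p (|s_n|^p + |F|^p) - |s_n - F|^p], which is nonnegative and tends to
    [2^(p+1) |F|^p]. If the distances all stayed above [e], the norm bound would make the limit
    integral smaller than itself by [e]. *)
Lemma scheffe (s : nat -> R[i] -> R[i]) F (e : R) : (forall n, cmeas (s n)) -> cmeas F ->
  Lp (fun z => nc (F z)) -> (forall n, (pint (fun z => nc (s n z)) <= pint (fun z => nc (F z)))%E) ->
  (forall z, nc (s n z - F z) @[n --> \oo] --> 0) -> 0 < e ->
  exists n, (pint (fun z => nc (s n z - F z)%R) < e%:E)%E.
Proof.
move=> ms mF [F0 mnF FL] sF sc e0; apply: contrapT => /forallNP no.
have mns n := meas_nc (ms n).
have mB n : cmeas (fun z => s n z - F z).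
  have := cmeasD (ms n) (cmeasM (cmeas_cst (-1)) mF); congr cmeas.
  by apply/funext => z; rewrite mulN1r.
have mnB n := meas_nc (mB n).
pose c : R := 2 `^ p.
have c0 : 0 <= c by exact: powR_ge0.
pose f n z := (c * (nc (s n z) `^ p + nc (F z) `^ p) - nc (s n z - F z) `^ p) * W z.
pose g z := c * 2 * (nc (F z) `^ p * W z).
have dle n z : nc (s n z - F z) `^ p <= c * (nc (s n z) `^ p + nc (F z) `^ p).
  rewrite (le_trans _ (powR_addr_le p1 (nc_ge0 _) (nc_ge0 _)))//.
  by rewrite ge0_ler_powR ?nnegrE ?addr_ge0 ?nc_ge0 ?(ltW p0)// ncB.
have f0 n z : 0 <= f n z by rewrite mulr_ge0// subr_ge0.
have mf n : meas (f n).
  apply: measM mW; apply: measB (meas_powR p (mnB n)).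
  exact: measM (meas_cst c) (measD (meas_powR p (mns n)) (meas_powR p mnF)).
have mFW := meas_pint p mW mnF.
have mg : meas g := measM (meas_cst (c * 2)) mFW.
have FW0 z : 0 <= nc (F z) `^ p * W z by rewrite mulr_ge0// powR_ge0.
have g0 z : 0 <= g z by rewrite mulr_ge0// mulr_ge0.
set I := pint (fun z => nc (F z)) in sF FL.
have I0 : (0 <= I)%E by exact: pint_ge0.
have Ifin : I \is a fin_num by rewrite ge0_fin_numE.
have gI : plane_int g = ((c * 2)%:E * I)%E by rewrite /g plane_intZ// mulr_ge0.
have fI n : (plane_int (f n) <= (c * 2 * fine I - e)%:E)%E.
  have E : (plane_int (f n) + pint (fun z => nc (s n z - F z)%R) =
      c%:E * (pint (fun z => nc (s n z)) + I))%E.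
    rewrite /I /pint -plane_intD//; first last.
    - exact: meas_pint.
    - by move=> z; rewrite mulr_ge0// powR_ge0.
    rewrite -plane_intD//; first last.
    - exact: meas_pint.
    - by move=> z; rewrite mulr_ge0// powR_ge0.
    rewrite -plane_intZ//; first last.
    - exact: measD (meas_pint p mW (mns n)) mFW.
    - by move=> z; rewrite addr_ge0 ?mulr_ge0 ?powR_ge0.
    by congr plane_int; apply/funext => z; rewrite /f; ring.
  have ed : (e%:E <= pint (fun z => nc (s n z - F z)%R))%E.
    by rewrite leNgt; apply/negP => lt; exact: (no n).
  have Ec : (plane_int (f n) + pint (fun z => nc (s n z - F z)%R) <= (c * 2 * fine I)%:E)%E.
    rewrite E -mulrA EFinM lee_pmul2l ?lte_fin ?powR_gt0//.
    rewrite (le_trans (leeD2r _ (sF n)))// -[in leLHS](fineK Ifin) -EFinD lee_fin.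
    lra.
  rewrite EFinB leeBrDr//; exact: le_trans (leeD2l _ ed) Ec.
have : (plane_int g <= (c * 2 * fine I - e)%:E)%E.
  apply: (plane_int_fatou mf f0 mg g0) => [z|]; last exact: nearW.
  (* [|s_n|^p] is bounded below by the tangent at [|F|], with [|s_n| - |F| >= - |s_n - F|]. *)
  exists (fun n => (c * ((nc (F z) `^ p - p * nc (F z) `^ (p - 1) * nc (s n z - F z)) + nc (F z) `^ p)
     - nc (s n z - F z) `^ p) * W z).
    have -> : g z = (c * ((nc (F z) `^ p - p * nc (F z) `^ (p - 1) * 0) + nc (F z) `^ p) - 0) * W z.
      by rewrite /g; ring.
    apply: cvgM; last exact: cvg_cst.
    apply: cvgB; last by apply: powR_cvg_0 => // n; exact: nc_ge0.
    apply: cvgM; first exact: cvg_cst.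
    apply: cvgD; last exact: cvg_cst.
    by apply: cvgB; [exact: cvg_cst|apply: cvgM => //; exact: cvg_cst].
  apply: nearW => n; rewrite /f ler_wpM2r// lerD2r ler_wpM2l// lerD2r.
  rewrite (le_trans _ (tangent_powR p1 (nc_ge0 (s n z)) (nc_ge0 (F z))))// lerD2l -mulrN.
  rewrite ler_wpM2l ?mulr_ge0 ?powR_ge0 ?(ltW p0)//.
  have := ncD (F z - s n z) (s n z); rewrite subrK nc_distC; lra.
rewrite gI -(fineK Ifin) -EFinM lee_fin; lra.
Qed.

End convergence_in_mean.

Section quotient_mean.
Variables (R : realType) (p : R) (W : R[i] -> R).
Hypothesis p1 : 1 < p.
Hypothesis W0 : forall z, 0 <= W z.
Hypothesis mW : meas W.
Hypothesis radW : forall w z, nc w = 1 -> W (w * z) = W z.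
Variables (a : nat -> R[i]) (F : R[i] -> R[i]) (G : nat -> R[i] -> R[i]).
Hypothesis aF : expansion a F.
Hypothesis aG : forall n, expansion (coef_shift n a) (G n).
Hypothesis GF : forall n z, G n z * z ^+ n = F z - psum a z n.
Hypothesis anz : forall N, exists2 n, (N <= n)%N & a n != 0.

Lemma quotient_mean (e : R) : Lp p W (fun z => nc (F z)) -> Lp p W (fun=> 1) ->
  Lp p W (fun z => nc z ^+ 2) -> 0 < e ->
  exists2 n, a n != 0 & (pint p W (fun z => nc (G n z / a n - 1)%R) < e%:E)%E.
Proof.
move=> LF L1 L2 e0.
pose D z : R := 32 * 1 + 2 * nc (F z) + 128 * max_term a z + 32 * nc z ^+ 2.
have [D0 mD LD] : Lp p W D.
  have Lmu := Lp_max_term p1 W0 mW radW aF LF.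
  have LZ (c : R) (h : R[i] -> R) : 0 <= c -> Lp p W h -> Lp p W (fun z => c * h z).
    by move=> c0; apply: LpZ.
  have LD f g : Lp p W f -> Lp p W g -> Lp p W (fun z => f z + g z) by exact: LpD.
  exact: LD (LD _ _ (LD _ _ (LZ _ _ (ler0n _ 32) L1) (LZ _ _ (ler0n _ 2) LF))
    (LZ _ _ (ler0n _ 128) Lmu)) (LZ _ _ (ler0n _ 32) L2).
have H m := quotient_bound aF aG GF anz (ler0n R m).
pose n_ m := projT1 (cid (H m)).
have n_P m : [/\ a (n_ m) != 0, forall z, nc (G (n_ m) z / a (n_ m) - 1) <= D z &
    forall z, nc z < m%:R -> nc (G (n_ m) z / a (n_ m) - 1) <= 8 * nc z / (m%:R - nc z)].
  rewrite /n_; case: cid => n /= [h1 h2 h3]; split=> // z.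
  by rewrite /D mulr1.
have mG m : cmeas (fun z => G (n_ m) z / a (n_ m) - 1).
  exact: cmeasD (cmeasM (cmeas_expansion (aG (n_ m))) (cmeas_cst _)) (cmeas_cst _).
have [m Hm] : exists m, (plane_int (fun z => (nc (G (n_ m) z / a (n_ m) - 1) `^ p * W z)%R) < e%:E)%E.
  apply: (plane_int_dominated (g := fun z => D z `^ p * W z)) e0.
  - by move=> m; exact: meas_pint (meas_nc (mG m)).
  - exact: meas_pint.
  - move=> m z; rewrite mulr_ge0 ?powR_ge0//= ler_wpM2r// ge0_ler_powR ?nnegrE ?nc_ge0//.
      by rewrite (le_trans ler01)// ltW.
    by have [_ ? _] := n_P m.
  - exact: LD.
  - move=> z; rewrite -(mul0r (W z)); apply: cvgM; last exact: cvg_cst.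
    apply: (powR_cvg_0 p1) => [n|]; first exact: nc_ge0.
    (* Beyond this index [m - |z| > 8 |z| / d], so the pointwise bound is below [d]. *)
    apply/cvg0P => d d0; exists (Num.bound (nc z + 8 * nc z / d + 1)) => m Nm.
    rewrite ger0_norm ?nc_ge0//.
    have x0 : 0 <= 8 * nc z / d by rewrite divr_ge0 ?mulr_ge0 ?nc_ge0 ?(ltW d0).
    have h : nc z + 8 * nc z / d + 1 < m%:R.
      apply: (lt_le_trans (archi_boundP _)); last by rewrite ler_nat.
      by rewrite !addr_ge0 ?nc_ge0.
    have [_ _ Hz] := n_P m; rewrite (le_lt_trans (Hz z _))//; first by move: x0 h; lra.
    rewrite ltr_pdivrMr; last by move: x0 h; lra.
    rewrite [ltRHS]mulrC -ltr_pdivrMr//; by move: h; lra.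
by exists (n_ m) => //; have [] := n_P m.
Qed.

End quotient_mean.
(** * Fejer means *)

Section fejer.
Variable R : realType.
Implicit Types (a : nat -> R[i]) (F : R[i] -> R[i]) (z : R[i]).

(** Equal to [(N - k) / N] for [k <= N] and to 0 beyond. It is written as a count of pairs at
    distance [k], the form in which it comes out of a squared modulus. *)
Definition fejer_coef N k : R := (\sum_(i < N) (i + k < N)%N)%:R / N%:R.

Definition fejer_mean a N z : R[i] := psum (fun k => (fejer_coef N k)%:C%C * a k) z N.

Lemma fejer_coefE N k : (k <= N)%N -> fejer_coef N k = (N - k)%:R / N%:R.
Proof.
move=> kN; rewrite /fejer_coef -(big_mkord xpredT (fun i => nat_of_bool (i + k < N)%N)).
rewrite (big_cat_nat (leq0n (N - k)) (leq_subr k N))/=.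
rewrite (eq_big_nat _ _ (F2 := fun=> 1%N)); last by move=> i /andP[_]; rewrite ltn_subRL addnC => ->.
rewrite [X in (_ + X)%N](eq_big_nat _ _ (F2 := fun=> 0%N)); last first.
  by move=> i /andP[]; rewrite leq_subLR addnC => h _; rewrite ltnNge h.
by rewrite !sum_nat_const_nat muln0 addn0 muln1 subn0.
Qed.

Lemma fejer_coef0 N k : (N <= k)%N -> fejer_coef N k = 0.
Proof.
move=> Nk; rewrite /fejer_coef big1 ?mul0r// => i _.
by rewrite ltnNge (leq_trans Nk)// leq_addl.
Qed.

Lemma nc1_conj (w : R[i]) : nc w = 1 -> (w^*)%C = w^-1.
Proof.
move=> w1; have w0 : w != 0 by rewrite -nc_eq0 w1 oner_neq0.
by apply: (mulfI w0); rewrite -sqr_normc normE w1 divff// expr1n.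
Qed.

(* The weights of the Fejer kernel at the K-th roots of unity; they are nonnegative since they
   are squared moduli. *)
Definition fejer_weight N K (j : 'I_K) : R :=
  nc (\sum_(i < N) zeta R K ^+ (j * i)) ^+ 2 / (N * K)%:R.

Lemma fejer_weight_ge0 N K (j : 'I_K) : 0 <= fejer_weight N j.
Proof. by rewrite divr_ge0// exprn_ge0// nc_ge0. Qed.

(** The conjugate of [zeta^(j l)] is written [zeta^(j (K - l))], which keeps the exponents
    natural. *)
Lemma fejer_weightE N K (j : 'I_K) : (N <= K)%N ->
  (fejer_weight N j)%:C%C =
  (\sum_(i < N) \sum_(l < N) zeta R K ^+ (j * (i + (K - l)))) / (N * K)%:R :> R[i].
Proof.
move=> NK; have K0 : (0 < K)%N by exact: leq_ltn_trans (ltn_ord j).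
rewrite /fejer_weight rmorphM fmorphV rmorph_nat; congr (_ / _).
rewrite rmorphXn /= -normE sqr_normc rmorph_sum mulr_suml; apply: eq_bigr => i _.
rewrite mulr_sumr; apply: eq_bigr => l _.
have lK : (l < K)%N by exact: leq_trans NK.
rewrite mulnDr exprD; congr (_ * _); rewrite -[LHS]/((zeta R K ^+ (j * l))^*)%C.
rewrite nc1_conj ?ncX ?nc_zeta ?expr1n//.
have z0 : zeta R K ^+ (j * l) != 0 by rewrite -nc_eq0 ncX nc_zeta expr1n oner_neq0.
apply: (mulfI z0); rewrite divff// -exprD -mulnDr subnKC ?(ltnW lK)//.
by rewrite mulnC exprM (prim_expr_order (zeta_primitive R K0)) expr1n.
Qed.

(** Orthogonality selects the pairs with [l = i + k]; the room [k + N < K] excludes coincidences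
    modulo [K]. *)
Lemma fejer_weight_sum N K k : (0 < N)%N -> (k + N < K)%N ->
  \sum_(j < K) (fejer_weight N j)%:C%C * (zeta R K ^+ j) ^+ k = (fejer_coef N k)%:C%C.
Proof.
move=> N0 kNK; have NK : (N <= K)%N by rewrite (leq_trans _ (ltnW kNK))// leq_addl.
have K0 : (0 < K)%N by exact: leq_trans NK.
have NR : N%:R != 0 :> R[i] by rewrite pnatr_eq0 -lt0n.
have KR : K%:R != 0 :> R[i] by rewrite pnatr_eq0 -lt0n.
have E (i l : 'I_N) : \sum_(j < K) zeta R K ^+ (j * (i + (K - l) + k)) =
    K%:R * ((l == i + k :> nat)%N)%:R :> R[i].
  rewrite sum_zeta//; have iN := ltn_ord i; have lN := ltn_ord l.
  have -> : (K %| i + (K - l) + k)%N = (l == i + k :> nat)%N.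
    apply/idP/eqP => [/dvdnP[[|[|q]]]|lik]; [nia|nia|nia|].
    have -> : (i + (K - l) + k = K)%N by lia.
    exact: dvdnn.
  by case: eqP => _; rewrite ?mulr1 ?mulr0.
transitivity ((\sum_(i < N) \sum_(l < N) K%:R * ((l == i + k :> nat)%N)%:R) / (N * K)%:R : R[i]).
  under eq_bigr do rewrite fejer_weightE// mulrAC mulr_suml.
  rewrite -mulr_suml exchange_big; congr (_ / _); apply: eq_bigr => i _.
  under eq_bigr do rewrite mulr_suml.
  rewrite exchange_big; apply: eq_bigr => l _; rewrite -E; apply: eq_bigr => j _.
  by rewrite -exprM -exprD -mulnDr.
have -> : (fejer_coef N k)%:C%C = (\sum_(i < N) (i + k < N)%N)%:R / N%:R :> R[i].
  by rewrite /fejer_coef rmorphM fmorphV !rmorph_nat.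
rewrite natr_sum natrM invfM mulrA mulrAC; congr (_ / _).
rewrite mulr_suml; apply: eq_bigr => i _.
rewrite -mulr_sumr mulrAC divff// mul1r -natr_sum; congr (_%:R).
have [ik|ik] := ltnP (i + k) N.
  rewrite (bigD1 (Ordinal ik))//= eqxx big1// => l; rewrite -val_eqE/= => /negbTE ->.
  by [].
rewrite big1// => l _; case: eqP => // le; have := ltn_ord l; lia.
Qed.

Lemma fejer_weight_total N K : (0 < N < K)%N -> \sum_(j < K) fejer_weight N j = 1.
Proof.
move=> /andP[N0 NK]; apply: complexI; rewrite rmorph_sum.
transitivity ((fejer_coef N 0)%:C%C : R[i]).
  by rewrite -(@fejer_weight_sum N K 0 N0 NK); apply: eq_bigr => j _; rewrite expr0 mulr1.
by rewrite fejer_coefE// subn0 divff// pnatr_eq0 -lt0n.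
Qed.

(** Truncation at [K - N] keeps every index in the range where the weights give exact Fejer
    coefficients; those of index at least [N] vanish, so the truncated sum is the whole mean. *)
Lemma fejer_average a F z (tau : nat -> R) N K : (0 < N)%N -> (N + N < K)%N ->
  (forall v, nc v = nc z -> nc (F v - psum a v (K - N)) <= tau (K - N)%N) ->
  nc (fejer_mean a N z) <=
    \sum_(j < K) fejer_weight N j * nc (F (zeta R K ^+ j * z)) + tau (K - N)%N.
Proof.
move=> N0 NNK Htau.
have om1 (j : 'I_K) : nc (zeta R K ^+ j) = 1 by rewrite ncX nc_zeta expr1n.
have ncw (j : 'I_K) : nc ((fejer_weight N j)%:C%C : R[i]) = fejer_weight N j.
  by rewrite ncR_ge0// fejer_weight_ge0.
have su : \sum_(j < K) nc ((fejer_weight N j)%:C%C : R[i]) = 1.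
  by under eq_bigr do rewrite ncw; apply: fejer_weight_total; lia.
have := average_bound (u := fun j => (fejer_weight N j)%:C%C) Htau om1 su.
under [X in _ <= X + _]eq_bigr do rewrite ncw.
suff -> : \sum_(k < K - N) (\sum_(j < K) (fejer_weight N j)%:C%C * (zeta R K ^+ j) ^+ k) * (a k * z ^+ k)
  = fejer_mean a N z by [].
transitivity (\sum_(k < K - N) (fejer_coef N k)%:C%C * a k * z ^+ k).
  by apply: eq_bigr => k _; rewrite fejer_weight_sum ?mulrA//; have := ltn_ord k; lia.
have NKN : (N <= K - N)%N by lia.
rewrite /fejer_mean /psum -!(big_mkord xpredT (fun k => (fejer_coef N k)%:C%C * a k * z ^+ k)).
rewrite (big_cat_nat (leq0n N) NKN)/= [X in _ + X]big_nat_cond [X in _ + X]big1 ?addr0//.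
by move=> k /andP[/andP[Nk _] _]; rewrite fejer_coef0// !mul0r.
Qed.

Lemma fejer_mean_cvg a F z : expansion a F ->
  nc (fejer_mean a N.+1 z - F z) @[N --> \oo] --> 0.
Proof.
(* At radius [4 |z|], one factor [2^k] absorbs [k] and the other leaves a summable [2^-k]; the Fejer
   mean then differs from the partial sum by [O(1 / N)]. *)
move=> aF; have [C C0 HC] := expansion_coef (4 * nc z) aF.
have term k : k%:R * (nc (a k) * nc z ^+ k) <= C * 2^-1 ^+ k.
  have kp : k%:R <= 2 ^+ k :> R by rewrite -natrX ler_nat ltnW// ltn_expl.
  have h := HC k; rewrite (@le_trans _ _ (2 ^+ k * (nc (a k) * nc z ^+ k)))//.
    by rewrite ler_wpM2r// mulr_ge0 ?exprn_ge0 ?nc_ge0.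
  have p2 : 0 < 2 ^+ k :> R by rewrite exprn_gt0.
  rewrite exprVn ler_pdivlMr// (le_trans _ h)// exprMn.
  have -> : 4 ^+ k = 2 ^+ k * 2 ^+ k :> R by rewrite -exprMn; congr (_ ^+ _); lra.
  by rewrite le_eqVlt; apply/orP; left; apply/eqP; ring.
have bound N : nc (fejer_mean a N.+1 z - F z) <= nc (F z - psum a z N.+1) + C * 2 / N.+1%:R.
  have -> : fejer_mean a N.+1 z - F z = - (F z - psum a z N.+1) + (fejer_mean a N.+1 z - psum a z N.+1).
    by ring.
  rewrite (le_trans (ncD _ _))// ncN lerD2l.
  have -> : fejer_mean a N.+1 z - psum a z N.+1 =
      \sum_(k < N.+1) - ((k%:R / N.+1%:R)%:C%C * (a k * z ^+ k)).
    rewrite /fejer_mean /psum -sumrB; apply: eq_bigr => k _.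
    rewrite fejer_coefE; last exact: ltnW.
    rewrite natrB; last exact: ltnW.
    rewrite mulrBl divff ?pnatr_eq0// rmorphB rmorph1; ring.
  rewrite (le_trans (nc_sum _ _ _))//.
  rewrite (@le_trans _ _ (\sum_(k < N.+1) C * 2^-1 ^+ k / N.+1%:R))//.
    apply: ler_sum => k _; rewrite ncN !ncM ncX ncR_ge0 ?divr_ge0//.
    by rewrite mulrAC ler_wpM2r ?invr_ge0//; exact: term.
  rewrite -mulr_suml -mulr_sumr ler_wpM2r ?invr_ge0// ler_pM2l//.
  have h : 0 <= (2^-1 : R) < 1 by lra.
  rewrite (le_trans (geometric_le _ h))//.
  have -> : 1 - 2^-1 = 2^-1 :> R by lra.
  by rewrite invrK.
have hc : (fun N => C * 2 * (N.+1%:R : R)^-1) @ \oo --> 0.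
  by rewrite -(mulr0 (C * 2)); apply: cvgM; [exact: cvg_cst|exact: cvg_harmonic].
have [_ /(_ z) aFz] := aF.
have aFz' : (fun N => nc (F z - psum a z N.+1)) @ \oo --> 0.
  by rewrite (cvg_shiftS (fun n => nc (F z - psum a z n))).
have hcc : (fun N => nc (F z - psum a z N.+1) + C * 2 / N.+1%:R) @ \oo --> 0.
  by rewrite -[X in _ --> X]addr0; exact: cvgD aFz' hc.
apply: (squeeze_cvgr _ (cvg_cst 0) hcc); near=> N.
by rewrite nc_ge0; exact: bound.
Unshelve. all: by end_near. Qed.

End fejer.

(** * Density of polynomials *)

Section density.
Variables (R : realType) (p : R) (W : R[i] -> R).
Hypothesis p1 : 1 < p.
Hypothesis W0 : forall z, 0 <= W z.
Hypothesis mW : meas W.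
Hypothesis radW : forall w z, nc w = 1 -> W (w * z) = W z.

(** Averages over the [K]-th roots of unity with Fejer weights do not increase the integral, and
    they bound the Fejer mean up to an error that vanishes as [K] grows. *)
Lemma pint_fejer_mean a F N : expansion a F -> Lp p W (fun z => nc (F z)) -> (0 < N)%N ->
  (pint p W (fun z => nc (fejer_mean a N z)) <= pint p W (fun z => nc (F z)))%E.
Proof.
move=> aF [F0 mF _] N0.
have om1 K (j : 'I_K) : nc (zeta R K ^+ j) = 1 by rewrite ncX nc_zeta expr1n.
have ms : meas (fun z => nc (fejer_mean a N z)) by exact: meas_nc (cmeas_psum _ _).
apply: (pint_limit p1 W0 mW (A := fun K z => \sum_(j < K) fejer_weight R N j * nc (F (zeta R K ^+ j * z)))).
- move=> K; apply: meas_sum => j; apply: measM (meas_cst _) _.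
  exact: (meas_rotate (om1 K j) mF).
- by move=> K z; apply: sumr_ge0 => j _; rewrite mulr_ge0 ?nc_ge0 ?fejer_weight_ge0.
- exact: ms.
- by move=> z; exact: nc_ge0.
- move=> z; have [tau tau0 Htau] := expansion_circle z aF.
  exists (fun K => tau (K - N)%N).
    apply/cvg0P => e e0; have /cvg0P/(_ e e0)[M HM] := tau0.
    by exists (M + N)%N => n Mn; apply: HM; lia.
  exists (N + N).+1 => // K /= NK; apply: fejer_average => //; exact: (Htau _).2.
- exists (N + N).+1; first by [].
  move=> K /= NK; apply: (pint_average p1 W0 mW radW _ _ (om1 K) F0 mF) => [j|].
    exact: fejer_weight_ge0.
  by apply: fejer_weight_total; lia.
Qed.

Lemma fejer_mean_dense a F (e : R) : expansion a F -> Lp p W (fun z => nc (F z)) -> 0 < e ->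
  exists N, (pint p W (fun z => nc (fejer_mean a N z - F z)%R) < e%:E)%E.
Proof.
move=> aF LF e0.
have [N HN] := scheffe p1 W0 mW (s := fun N => fejer_mean a N.+1)
  (fun N => cmeas_psum _ _) (cmeas_expansion aF) LF
  (fun N => pint_fejer_mean aF LF (ltn0Sn N)) (fun z => fejer_mean_cvg z aF) e0.
by exists N.+1.
Qed.

End density.
(** * Invariant subspaces *)

Lemma expansion_finite (R : realType) (a : nat -> R[i]) (F : R[i] -> R[i]) N z :
  expansion a F -> (forall n, (N <= n)%N -> a n = 0) -> F z = psum a z N.
Proof.
move=> [_ /(_ z) aF] aN; apply/eqP; rewrite -subr_eq0 -nc_eq0 eq_le nc_ge0 andbT.
apply/ler_addgt0Pr => e e0; rewrite add0r.
have /cvg0P/(_ e e0)[m Hm] := aF; have := Hm (N + m)%N (leq_addl _ _).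
rewrite ger0_norm ?nc_ge0// => /ltW; rewrite -[psum a z (N + m)](subrK (psum a z N)) psumB.
suff -> : psum (coef_shift N a) z m = 0 by rewrite mulr0 add0r.
by rewrite /psum big1// => i _; rewrite /coef_shift aN ?mul0r// leq_addr.
Qed.

Lemma psum_horner (R : realType) (a : nat -> R[i]) n :
  (fun z => psum a z n) = horner (\poly_(i < n) a i).
Proof. by apply/funext => z; rewrite horner_poly. Qed.

Section fock_space.
Variables (R : realType) (p : R) (W : R[i]^o -> R).
Hypothesis p1 : 1 < p.
Hypothesis wW : weight W.
Hypothesis rW : radial W.
Hypothesis polyW : @polynomials R `<=` fock p W.
Local Notation L := (@backward_shift R).

Let p0 : 0 < p. Proof. exact: lt_trans p1. Qed.

Let W0 (z : R[i]) : 0 <= W z. Proof. by have [+ _ _] := wW; move=> /(_ z) /ltW. Qed.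

Let mW : meas (W : R[i] -> R). Proof. by have [_ + _] := wW. Qed.

Let radW (w z : R[i]) : nc w = 1 -> W (w * z) = W z.
Proof.
move=> w1; rewrite (rW (w * z : R[i]^o)) (rW (z : R[i]^o)); congr W.
by rewrite !normE ncM w1 mul1r.
Qed.

Lemma fock_expansion f : fock p W f ->
  exists2 a, expansion a f & Lp p W (fun z => nc (f z)).
Proof.
move=> [ef nf]; have [a af] := entire_expansion ef; exists a => //.
split; [by move=> z; exact: nc_ge0|exact: meas_nc (cmeas_expansion af)|].
by apply: lty_poweRy nf; rewrite invr_neq0// gt_eqF.
Qed.

Lemma fock_norm_lt (f g : R[i]^o -> R[i]^o) (e : R) : 0 < e ->
  (pint p W (fun z => nc (f z - g z)%R) < (e `^ p)%:E)%E -> (fock_norm p W (f - g)%R < e%:E)%E.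
Proof.
move=> e0; rewrite /fock_norm; set I := pint _ _ _ => Ie.
have I0 : (0 <= I)%E by exact: pint_ge0.
have Ifin : I \is a fin_num by rewrite ge0_fin_numE// (lt_trans Ie)// ltry.
have -> : (\int[m2 R]_xy (nc ((f - g)%R (of_plane xy)) `^ p * W (of_plane xy))%:E)%E = I by [].
rewrite -(fineK Ifin) poweR_EFin lte_fin.
have -> : e = (e `^ p) `^ p^-1 by rewrite -powRrM divff ?gt_eqF// powRr1// ltW.
rewrite gt0_ltr_powR ?invr_gt0// ?nnegrE ?fine_ge0 ?powR_ge0//.
by rewrite -lte_fin fineK.
Qed.

Lemma fock_monomial k : fock p W (fun z : R[i]^o => z ^+ k).
Proof.
by apply: polyW; exists 'X^k; apply/funext => z; rewrite hornerXn.
Qed.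

Lemma Lp_monomial k : Lp p W (fun z => nc z ^+ k).
Proof.
have [a _] := fock_expansion (fock_monomial k); congr Lp.
by apply/funext => z; rewrite ncX.
Qed.

Variable M : set (R[i]^o -> R[i]^o).
Hypothesis invM : invariant_subspace p W L M.

Let subM f : M f -> fock p W f. Proof. by have [[+ _ _] _ _] := invM; exact. Qed.

Let M0 : M 0. Proof. by have [[_ + _] _ _] := invM. Qed.

Let linM (c : R[i]) (f g : R[i]^o -> R[i]^o) : M f -> M g -> M (fun z => c * f z + g z).
Proof. by have [[_ _ H] _ _] := invM; exact: H. Qed.

Let closedM f : fock p W f ->
  (forall e : R, 0 < e -> exists2 g, M g &
    (pint p W (fun z => nc (f z - g z)%R) < e%:E)%E) -> M f.
Proof.
move=> Ff H; have [_ + _] := invM; apply => // e e0.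
have [g Mg fg] := H (e `^ p) (powR_gt0 _ e0); exists g => //.
exact: fock_norm_lt.
Qed.

Let iterM n f : M f -> M (iter n L f).
Proof. by have [_ _ LM] := invM; move=> Mf; elim: n => //= n; exact: LM. Qed.

Let entM n f : M f -> entire (iter n L f).
Proof. by move=> Mf; have [] := subM (iterM n Mf). Qed.

Let psumM a n : (forall i, (i < n)%N -> M (fun z => z ^+ i)) -> M (fun z => psum a z n).
Proof.
elim: n => [|n IH] H.
  by have := M0; congr M; apply/funext => z; rewrite /psum big_ord0.
have Mn := IH (fun i (h : (i < n)%N) => H i (ltnW h)).
have := linM (a n) (H n (ltnSn n)) Mn; congr M; apply/funext => z.
by rewrite /psum big_ord_recr/= addrC.
Qed.

(** Induction on [k]. With [c = a_(n+k)], the product of [z^k] and [L^(n+k) f / c] is [L^n f / c]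
    minus a polynomial of degree below [k], so it lies in [M]; its distance to [z^k] in weight [W]
    is that of [L^(n+k) f / c] to 1 in weight [|z|^(k p) W]. *)
Lemma monomial_of_nonpolynomial a f : M f -> expansion a f ->
  (forall N, exists2 n, (N <= n)%N & a n != 0) -> forall k, M (fun z => z ^+ k).
Proof.
move=> Mf af anz; elim/ltn_ind => k IH; apply: closedM => [|e e0]; first exact: fock_monomial.
pose V z := (nc z ^+ k) `^ p * W z.
have V0 z : 0 <= V z by rewrite mulr_ge0 ?powR_ge0.
have mzk : meas (fun z : R[i] => nc z ^+ k).
  by have := meas_nc (cmeasX k (@cmeas_id R)); congr meas; apply/funext => z; rewrite ncX.
have mV : meas V by exact: meas_pint.
have radV w z : nc w = 1 -> V (w * z) = V z.
  by move=> w1; rewrite /V (radW _ w1) ncM w1 mul1r.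
have pintV h : (forall z, 0 <= h z) -> pint p V h = pint p W (fun z => h z * nc z ^+ k).
  move=> h0; congr plane_int; apply/funext => z.
  by rewrite /V powRM ?exprn_ge0 ?nc_ge0// mulrA.
have LV h : (forall z, 0 <= h z) -> meas h -> Lp p W (fun z => h z * nc z ^+ k) -> Lp p V h.
  by move=> h0 mh [_ _ hi]; split; [exact: h0|exact: mh|rewrite pintV].
have af' n : expansion (coef_shift n a) (iter n L f) by exact: (expansion_iter n (fun i => @entM i _ Mf) af).
have [_ _ Lf] := fock_expansion (subM Mf).
have aG n : expansion (coef_shift n (coef_shift k a)) (iter n L (iter k L f)).
  by apply: expansion_iter => // i; exact: entM (iterM k Mf).
have GF n z : iter n L (iter k L f) z * z ^+ n = iter k L f z - psum (coef_shift k a) z n.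
  by apply: iter_backward_shiftM => // i; exact: entM (iterM k Mf).
have anz' N : exists2 n, (N <= n)%N & coef_shift k a n != 0.
  have [n Nn an] := anz (k + N)%N; exists (n - k)%N; first lia.
  by rewrite /coef_shift subnKC//; lia.
(* In the new weight [L^k f] has the norm of [f] minus a polynomial, which is finite. *)
have LF' : Lp p V (fun z => nc (iter k L f z)).
  have mF := cmeas_expansion (af' k).
  apply: LV => [z||]; [exact: nc_ge0|exact: meas_nc|].
  have E z : nc (iter k L f z) * nc z ^+ k = nc (f z - psum a z k).
    by rewrite -ncX -ncM (iter_backward_shiftM k z (fun i => @entM i _ Mf) af).
  have [b _ Lpsum] : exists2 b, expansion b (fun z => psum a z k) & Lp p W (fun z => nc (psum a z k)).
    by apply: fock_expansion; apply: polyW; exists (\poly_(i < k) a i); exact: psum_horner.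
  apply: (Lp_le p1 W0 mW _ _ (LpD p1 W0 mW Lf Lpsum)).
  - by apply: measM mzk; exact: meas_nc.
  - by move=> z; rewrite E nc_ge0 ncB.
have L1 : Lp p V (fun=> 1).
  apply: LV => [z||]; [exact: ler01|exact: meas_cst|].
  by have := Lp_monomial k; congr Lp; apply/funext => z; rewrite mul1r.
have L2 : Lp p V (fun z => nc z ^+ 2).
  apply: LV => [z||]; first by rewrite exprn_ge0// nc_ge0.
    by have := meas_nc (cmeasX 2 (@cmeas_id R)); congr meas; apply/funext => z; rewrite ncX.
  by have := Lp_monomial (2 + k); congr Lp; apply/funext => z; rewrite exprD.
have [n an0 Hn] := quotient_mean p1 V0 mV radV (af' k) aG GF anz' LF' L1 L2 e0.
set c := coef_shift k a n in an0 Hn.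
have Mpsum : M (fun z => psum (coef_shift n a) z k) by exact: psumM.
have Mg := linM c^-1 (linM (-1) Mpsum (iterM n Mf)) M0.
exists (fun z => c^-1 * (-1 * psum (coef_shift n a) z k + iter n L f z) + 0); first exact: Mg.
have E : (fun z => nc (iter n L (iter k L f) z / c - 1) * nc z ^+ k) =
    (fun z => nc (z ^+ k - (c^-1 * (-1 * psum (coef_shift n a) z k + iter n L f z) + 0))).
  apply/funext => z.
  rewrite -ncX -ncM -[RHS]ncN; congr nc.
  rewrite mulN1r addr0 opprB [- _ + _]addrC.
  rewrite -(iter_backward_shiftM k z (fun i => @entM i _ (iterM n Mf)) (af' n)).
  by rewrite -!iterD addnC mulrBl mul1r mulrA [c^-1 * _]mulrC.
move: Hn; rewrite pintV; first by rewrite E; exact.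
by move=> z; exact: nc_ge0.
Qed.

(** [L^(n-i) f] is a polynomial of degree [i] with leading coefficient [a_n]; its lower terms are in
    [M] by induction and can be subtracted. *)
Lemma monomial_of_polynomial a f n : M f -> expansion a f -> a n != 0 ->
  (forall m, (n < m)%N -> a m = 0) -> forall i, (i <= n)%N -> M (fun z => z ^+ i).
Proof.
move=> Mf af an am; elim/ltn_ind => i IH i_n.
have ag := expansion_iter (n - i) (fun j => @entM j _ Mf) af.
have Mp : M (fun z => psum (coef_shift (n - i) a) z i).
  by apply: psumM => j ji; apply: IH => //; exact: leq_trans (ltnW ji) i_n.
have := linM (a n)^-1 (linM (-1) Mp (iterM (n - i) Mf)) M0; congr M; apply/funext => z.
rewrite (expansion_finite (N := i.+1) z ag); last first.
  by move=> m im; rewrite /coef_shift am//; lia.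
rewrite {2}/psum big_ord_recr/= -/(psum _ z i) mulN1r addrA addNr add0r addr0.
by rewrite /coef_shift subnK// mulrA mulVf// mul1r.
Qed.

Lemma monomial_of_coef a f n : M f -> expansion a f -> a n != 0 ->
  forall i, (i <= n)%N -> M (fun z => z ^+ i).
Proof.
move=> Mf af an.
have [anz|] := pselect (forall N, exists2 m, (N <= m)%N & a m != 0).
  by move=> i _; exact: (monomial_of_nonpolynomial Mf af anz i).
move=> /existsNP[N noN].
have aN m : (N <= m)%N -> a m = 0.
  by move=> Nm; apply/eqP; apply: contrapT => /negP am; apply: noN; exists m.
have ex : exists m, a m != 0 by exists n.
have ub m : a m != 0 -> (m <= N)%N.
  by move=> am; rewrite leqNgt; apply: contra am => /ltnW/aN ->.
have [m am maxm] := ex_maxnP ex ub.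
move=> i i_n; apply: (monomial_of_polynomial Mf af am) => [l ml|].
  by apply/eqP; rewrite -[_ == _]negbK; apply/negP => /maxm; rewrite leqNgt ml.
exact: leq_trans i_n (maxm n an).
Qed.

Lemma all_monomials : (forall k, M (fun z => z ^+ k)) -> M = fock p W.
Proof.
move=> Mk; apply/seteqP; split => [f|f Ff]; first exact: subM.
apply: closedM => // e e0; have [a af Lf] := fock_expansion Ff.
have [N HN] := fejer_mean_dense p1 W0 mW radW af Lf e0.
exists (fejer_mean a N); first exact: psumM.
have -> : (fun z => nc (f z - fejer_mean a N z)) = (fun z => nc (fejer_mean a N z - f z)).
  by apply/funext => z; rewrite nc_distC.
exact: HN.
Qed.

(** Let [k] be the least exponent with [z^k] outside [M], if there is one. A nonzero coefficient of
    index at least [k] in an element of [M] would put [z^k] into [M], so [M] consists exactly of the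
    polynomials of degree below [k]; [k = 0] gives the zero subspace. *)
Lemma invariant_subspace_classification :
  [\/ M = [set 0], exists n, M = @polynomials_upto R n | M = fock p W].
Proof.
have [Mk|] := pselect (forall k, M (fun z => z ^+ k)).
  by apply: Or33; exact: all_monomials.
move=> /existsNP[k0 nk0].
have ex : exists k, `[< ~ M (fun z => z ^+ k) >] by exists k0; exact/asboolP.
have [k /asboolP nk mink] := ex_minnP ex.
have Mi i : (i < k)%N -> M (fun z => z ^+ i).
  move=> ik; apply: contrapT => ni; have := mink i; rewrite leqNgt ik => h.
  by have /h : `[< ~ M (fun z => z ^+ i) >] by exact/asboolP.
have Mf f : M f -> exists a, f = (fun z => psum a z k).
  move=> Mf; have [a af _] := fock_expansion (subM Mf); exists a; apply/funext => z.
  apply: (expansion_finite z af) => n kn; apply/eqP; apply: contrapT => /negP an.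
  by apply: nk; exact: (monomial_of_coef Mf af an).
case: k nk {mink} Mi Mf => [|k] nk Mi Mf.
  apply: Or31; apply/seteqP; split => [f /Mf[a ->]|f ->]; last exact: M0.
  by apply/funext => z; rewrite /psum big_ord0.
apply: Or32; exists k; apply/seteqP; split => [f /Mf[a ->]|_ [q sq ->]].
  by exists (\poly_(i < k.+1) a i); [exact: size_poly|exact: psum_horner].
have := psumM (fun i => q`_i) Mi; congr M; apply/funext => z.
by rewrite (horner_coef_wide z sq).
Qed.

End fock_space.

Theorem theorem1p2 (R : realType) (p : R) (W : R[i]^o -> R) :
  1 < p ->
  weight W -> radial W ->
  @polynomials R `<=` fock p W ->
  (forall M : set (R[i]^o -> R[i]^o),
      invariant_subspace p W (@backward_shift R) M ->
      nontrivial (fock p W) M ->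
      exists n : nat, M = @polynomials_upto R n) /\
  unicellular p W (@backward_shift R).
Proof.
move=> p1 wW rW polyW; split=> [M invM [nM0 nMX]|M N invM invN].
  by have [] := invariant_subspace_classification p1 wW rW polyW invM.
have [[M_fock M0 _] _ _] := invM; have [[N_fock N0 _] _ _] := invN.
have [MN|[m Mm]|Mall] := invariant_subspace_classification p1 wW rW polyW invM.
- by left; rewrite MN => f ->.
- have [NN|[n Nn]|Nall] := invariant_subspace_classification p1 wW rW polyW invN.
  + by right; rewrite NN => f ->.
  + rewrite Mm Nn; have [mn|/ltnW nm] := leqP m n; [left|right] => f [q sq ->]; exists q => //.
      exact: leq_trans sq _.
    exact: leq_trans sq _.
  + by left; rewrite Nall.
- by right; rewrite Mall.
Qed.
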